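(* Let $R$ be any associative ring with unity. A complex $X$ of left $R$-modules is Ding injective if and only if it is a complex of Ding injective $R$-modules, i.e. if and only if $X_n$ is a Ding injective left $R$-module for every $n \in \mathbb{Z}$.
   Context: $R$ is an associative ring with unity; modules are left $R$-modules and $Ch(R)$ is the abelian category of (unbounded) chain complexes of left $R$-modules. For complexes $C, D$, $Hom(C,D)$ is the abelian group of chain maps $C \to D$, and $Ext^i(C,D)$ are the right derived functors of $Hom$ in $Ch(R)$. A module $A$ is $FP$-injective if $Ext^1_R(F,A)=0$ for all finitely presented modules $F$. A module $M$ is Ding injective if there is an exact complex $\cdots \to E_1 \to E_0 \to E_{-1} \to \cdots$ of injective modules with $M = \mathrm{Ker}(E_0 \to E_{-1})$ that remains exact after applying $Hom_R(A,-)$ for every $FP$-injective module $A$. A complex $A$ is $FP$-injective if $Ext^1(F,A)=0$ for every finitely presented complex $F$ (finitely presented object of $Ch(R)$). A complex $X$ is Ding injective if there is an exact sequence $\cdots \to E_1 \to E_0 \to E_{-1} \to \cdots$ in $Ch(R)$ of injective complexes (injective objects of $Ch(R)$) with $X = \mathrm{Ker}(E_0 \to E_{-1})$ that remains exact after applying $Hom(A,-)$ for every $FP$-injective complex $A$. *)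

(* Defs.v *)
From HB Require Import structures.
From mathcomp Require Import all_boot all_order all_algebra.

Set Implicit Arguments.
Unset Strict Implicit.
Unset Printing Implicit Defensive.

Import GRing.Theory.
Local Open Scope ring_scope.

(* Differentials lower the degree, d_n : C_n -> C_(n-1).  Since n ranges over
   all of [int], exactness at degree [n - 1] for every [n] is exactness in every
   degree; it is stated in this form to avoid transports along n + 1 - 1 = n. *)
Record complex (R : pzRingType) := Complex {
  cobj :> int -> lmodType R;
  cdiff : forall n : int, {linear cobj n -> cobj (n - 1)};
  cdiffK : forall (n : int) (x : cobj n), cdiff (n - 1) (cdiff n x) = 0
}.
Arguments cdiff {R} c n.

Record chain_map (R : pzRingType) (C D : complex R) := ChainMap {
  cmap :> forall n : int, {linear C n -> D n};
  cmapC : forall (n : int) (x : C n),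
    cmap (n - 1) (cdiff C n x) = cdiff D n (cmap n x)
}.

Definition exact_at (R : pzRingType) (A B C : lmodType R)
    (f : {linear A -> B}) (g : {linear B -> C}) : Prop :=
  forall y : B, g y = 0 <-> exists x : A, f x = y.

Definition is_surjective (A B : Type) (f : A -> B) : Prop :=
  forall y : B, exists x : A, f x = y.

Definition is_kernel (R : pzRingType) (K B C : lmodType R)
    (i : {linear K -> B}) (g : {linear B -> C}) : Prop :=
  injective i /\ exact_at i g.

(* Kernels, images, monomorphisms and epimorphisms of complexes are computed
   degreewise. *)
Definition cexact_at (R : pzRingType) (A B C : complex R)
    (f : chain_map A B) (g : chain_map B C) : Prop :=
  forall k : int, exact_at (f k) (g k).

Definition cinjective (R : pzRingType) (A B : complex R) (f : chain_map A B) :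
    Prop :=
  forall k : int, injective (f k).

Definition csurjective (R : pzRingType) (A B : complex R) (f : chain_map A B) :
    Prop :=
  forall k : int, is_surjective (f k).

Definition cis_kernel (R : pzRingType) (K B C : complex R)
    (i : chain_map K B) (g : chain_map B C) : Prop :=
  cinjective i /\ cexact_at i g.

Definition injective_module (R : pzRingType) (E : lmodType R) : Prop :=
  forall (A B : lmodType R) (i : {linear A -> B}) (f : {linear A -> E}),
    injective i -> exists g : {linear B -> E}, forall x : A, g (i x) = f x.

Definition projective_module (R : pzRingType) (P : lmodType R) : Prop :=
  forall (A B : lmodType R) (p : {linear A -> B}) (f : {linear P -> B}),
    is_surjective p -> exists g : {linear P -> A}, forall x : P, p (g x) = f x.

Record projective_resolution (R : pzRingType) (M : lmodType R) := ProjRes {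
  pobj :> nat -> lmodType R;
  pdiff : forall n : nat, {linear pobj n.+1 -> pobj n};
  paug : {linear pobj 0%N -> M};
  pproj : forall n : nat, projective_module (pobj n);
  paug_surj : is_surjective paug;
  paug_exact : exact_at (pdiff 0) paug;
  pdiff_exact : forall n : nat, exact_at (pdiff n.+1) (pdiff n)
}.
Arguments pdiff {R M} p n.

(* Ext^1(M, N) = H^1(Hom(P, N)) for a projective resolution P of M, so its
   vanishing is exactness of Hom(P, N) at Hom(P_1, N); this does not depend on
   the choice of P. *)
Definition Ext1_eq0 (R : pzRingType) (M N : lmodType R) : Prop :=
  forall (P : projective_resolution M) (f : {linear P 1%N -> N}),
    (forall x : P 2%N, f (pdiff P 1 x) = 0) ->
    exists g : {linear P 0%N -> N}, forall x : P 1%N, g (pdiff P 0 x) = f x.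

Definition finitely_presented_module (R : pzRingType) (F : lmodType R) : Prop :=
  exists (m n : nat) (f : {linear 'rV[R]_m -> 'rV[R]_n})
         (p : {linear 'rV[R]_n -> F}),
    is_surjective p /\ exact_at f p.

Definition FP_injective_module (R : pzRingType) (A : lmodType R) : Prop :=
  forall F : lmodType R, finitely_presented_module F -> Ext1_eq0 F A.

(* "M = Ker (E_0 -> E_(-1))" is understood up to isomorphism. *)
Definition Ding_injective_module (R : pzRingType) (M : lmodType R) : Prop :=
  exists E : complex R,
    [/\ forall n : int, injective_module (E n),
        forall n : int, exact_at (cdiff E n) (cdiff E (n - 1)),
        exists i : {linear M -> E 0}, is_kernel i (cdiff E 0)
      & forall A : lmodType R, FP_injective_module A ->
        forall (n : int) (f : {linear A -> E (n - 1)}),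
          (forall a : A, cdiff E (n - 1) (f a) = 0) ->
          exists g : {linear A -> E n}, forall a : A, cdiff E n (g a) = f a].

Definition directed (I : Type) (le : I -> I -> Prop) : Prop :=
  [/\ inhabited I,
      forall i, le i i,
      forall i j k, le i j -> le j k -> le i k
    & forall i j, exists k, le i k /\ le j k].

(* Taking [h] and [hik] arbitrary makes the transition maps independent of the
   proofs of [le]. *)
Record direct_system (R : pzRingType) (I : Type) (le : I -> I -> Prop) :=
  DirectSystem {
    sobj :> I -> complex R;
    smap : forall i j : I, le i j -> chain_map (sobj i) (sobj j);
    smap_id : forall (i : I) (h : le i i) (n : int) (x : sobj i n),
      smap h n x = x;
    smap_comp : forall (i j k : I) (hij : le i j) (hjk : le j k) (hik : le i k)
        (n : int) (x : sobj i n),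
      smap hjk n (smap hij n x) = smap hik n x
  }.
Arguments smap {R I le} d {i j} h.

Definition cocone (R : pzRingType) (I : Type) (le : I -> I -> Prop)
    (S : direct_system R le) (L : complex R)
    (c : forall i : I, chain_map (S i) L) : Prop :=
  forall (i j : I) (h : le i j) (n : int) (x : S i n),
    c j n (smap S h n x) = c i n x.

Definition direct_limit (R : pzRingType) (I : Type) (le : I -> I -> Prop)
    (S : direct_system R le) (L : complex R)
    (c : forall i : I, chain_map (S i) L) : Prop :=
  cocone c /\
  forall (T : complex R) (t : forall i : I, chain_map (S i) T), cocone t ->
    (exists u : chain_map L T,
       forall (i : I) (n : int) (x : S i n), u n (c i n x) = t i n x) /\
    (forall u v : chain_map L T,
       (forall (i : I) (n : int) (x : S i n), u n (c i n x) = t i n x) ->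
       (forall (i : I) (n : int) (x : S i n), v n (c i n x) = t i n x) ->
       forall (n : int) (y : L n), u n y = v n y).

(* Hom(F, -) preserves direct limits: the canonical map from
   colim_i Hom(F, S_i) to Hom(F, colim_i S_i) is surjective (first clause) and
   injective (second clause). *)
Definition finitely_presented_complex (R : pzRingType) (F : complex R) : Prop :=
  forall (I : Type) (le : I -> I -> Prop) (S : direct_system R le)
         (L : complex R) (c : forall i : I, chain_map (S i) L),
    directed le -> direct_limit c ->
    (forall f : chain_map F L,
       exists (i : I) (g : chain_map F (S i)),
         forall (n : int) (x : F n), c i n (g n x) = f n x) /\
    (forall (i : I) (g g' : chain_map F (S i)),
       (forall (n : int) (x : F n), c i n (g n x) = c i n (g' n x)) ->
       exists (j : I) (h : le i j),
         forall (n : int) (x : F n), smap S h n (g n x) = smap S h n (g' n x)).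

Definition injective_complex (R : pzRingType) (E : complex R) : Prop :=
  forall (A B : complex R) (i : chain_map A B) (f : chain_map A E),
    cinjective i ->
    exists g : chain_map B E, forall (n : int) (x : A n), g n (i n x) = f n x.

Definition projective_complex (R : pzRingType) (P : complex R) : Prop :=
  forall (A B : complex R) (p : chain_map A B) (f : chain_map P B),
    csurjective p ->
    exists g : chain_map P A, forall (n : int) (x : P n), p n (g n x) = f n x.

Record cprojective_resolution (R : pzRingType) (M : complex R) := CProjRes {
  cpobj :> nat -> complex R;
  cpdiff : forall n : nat, chain_map (cpobj n.+1) (cpobj n);
  cpaug : chain_map (cpobj 0%N) M;
  cpproj : forall n : nat, projective_complex (cpobj n);
  cpaug_surj : csurjective cpaug;
  cpaug_exact : cexact_at (cpdiff 0) cpaug;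
  cpdiff_exact : forall n : nat, cexact_at (cpdiff n.+1) (cpdiff n)
}.
Arguments cpdiff {R M} c n.

Definition cExt1_eq0 (R : pzRingType) (M N : complex R) : Prop :=
  forall (P : cprojective_resolution M) (f : chain_map (P 1%N) N),
    (forall (n : int) (x : P 2%N n), f n (cpdiff P 1 n x) = 0) ->
    exists g : chain_map (P 0%N) N,
      forall (n : int) (x : P 1%N n), g n (cpdiff P 0 n x) = f n x.

Definition FP_injective_complex (R : pzRingType) (A : complex R) : Prop :=
  forall F : complex R, finitely_presented_complex F -> cExt1_eq0 F A.

Definition Ding_injective_complex (R : pzRingType) (X : complex R) : Prop :=
  exists (E : int -> complex R) (d : forall n : int, chain_map (E n) (E (n - 1))),
    [/\ forall n : int, injective_complex (E n),
        forall n : int, cexact_at (d n) (d (n - 1)),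
        exists i : chain_map X (E 0), cis_kernel i (d 0)
      & forall A : complex R, FP_injective_complex A ->
        forall (n : int) (f : chain_map A (E (n - 1))),
          (forall (k : int) (a : A k), d (n - 1) k (f k a) = 0) ->
          exists g : chain_map A (E n),
            forall (k : int) (a : A k), d n k (g k a) = f k a].

(* Main.v *)
Require Import Defs.
From HB Require Import structures.
From mathcomp Require Import all_boot all_order all_algebra.
From mathcomp Require Import boolp classical_sets wochoice finmap.

(** Components of a Ding injective complex.  A disk on a module M represents, on
    either side, the components of a complex: chain maps from the disk to Y are maps
    from M to a component of Y, and chain maps from Y to the disk are maps from a
    component of Y to M.  Hence the degree k part of the resolution of X is a resolution
    of X_k as required, once disks on FP-injective modules are known to be FP-injective
    complexes (disk_FP_injective).  As Hom(F, disk) = Hom(F_k, M), this amounts to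
    fp_component: the components of a finitely presented complex are finitely presented
    modules, which is seen by mapping the complex to disks on the quotients of a module
    V by finitely generated submodules.

    Complexes with Ding injective components.  Cover, or embed, each X_n by an injective
    module and form disks: this gives short exact sequences 0 -> K -> E -> X -> 0 and
    0 -> X -> E -> Z -> 0 with E an injective complex, where K_n and Z_n are again Ding
    injective, being products of Ding injective and injective modules (cses_left,
    cses_right).  Splicing such sequences gives the resolution of X.  What remains is
    that chain maps from an FP-injective complex A lift along E -> Z when the kernel Y
    has Ding injective components (chain_lift).  Lifts exist in each degree, since the
    components of A are FP-injective; their failure to commute with the differentials is
    a chain map of degree -1 from A to Y, and the lifts can be corrected exactly when
    this map is null homotopic.  So everything rests on null_homotopy: chain maps from
    an FP-injective complex A to a complex Y of Ding injective modules are null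
    homotopic.  This is proved in two steps.

    First, let Y be a complex of injective modules (tot_null).  A is a direct limit of
    finitely presented complexes C.  As Ext^1(C[1], A) = 0, every map C -> A extends to
    the cone of the identity of C, which is contractible and finitely presented
    (contractible_ex); hence A is a direct limit of contractible complexes.  Call a complex L
    acyclic for Y when all chain maps from L to shifts of Y are null homotopic.
    Contractible complexes are acyclic for Y, and the point is that acyclicity passes to
    direct limits.  Since Hom(-, Y_n) is exact, it passes to quotients of acyclic
    complexes by acyclic subcomplexes (acyc_quo), hence to unions of well-ordered chains
    (union_acyc).  It then passes to colimits of well-ordered systems L_a (limit_acyc):
    the kernel of the map from the direct sum of the L_a to the colimit is the union of
    the subcomplexes K_b spanned by the differences of x in L_a, a < b, and its image in
    L_b, and each K_b is a direct sum of the L_a with a < b.  Finally directed systems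
    reduce to well-ordered ones by adding indices one at a time (directed_acyc).

    Secondly, a complex Y of Ding injective modules has a resolution ... -> E_1 -> E_0 ->
    Y by complexes of injective modules, whose total complex T, formed with products, is a
    complex of injective modules.  Hom(A_n, -) is exact on the resolution, so a chain map
    A -> Y lifts to A -> T, one E_j after the other; the lift is null homotopic by the
    first step, hence so is A -> Y (tot_null_left_resolving).

    Both steps forget the grading: A is replaced by the direct sum and Y by the product of
    its components, modules with an endomorphism d such that d o d = 0.  Null homotopies
    of graded maps are recovered by taking components.  In the first step all complexes
    are quotients G / H of submodules H <= G of one free module, and a map from G / H to
    an injective module is represented by a map from the whole free module, so that
    direct limits become unions and no quotient has to be formed. *)

Set Implicit Arguments.
Unset Strict Implicit.
Unset Printing Implicit Defensive.
Import GRing.Theory.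
Local Open Scope ring_scope.

(** * Modules: submodules, quotients, products, direct sums *)

Section Linear.
Context {R : pzRingType}.
Implicit Types A B C : lmodType R.

(** Locked, so that simplification does not unfold the maps built below. *)
Definition lin_of A B (f : A -> B) (H : linear f) : {linear A -> B} :=
  locked (HB.pack_for {linear A -> B} f (GRing.isLinear.Build R A B _ f H)).

Lemma lin_ofE A B (f : A -> B) (H : linear f) x : lin_of H x = f x.
Proof. by rewrite /lin_of -lock. Qed.

Definition compl A B C (g : {linear B -> C}) (f : {linear A -> B}) : {linear A -> C} :=
  (g \o f).
Definition addl A B (f g : {linear A -> B}) : {linear A -> B} := (f \+ g).
Definition oppl A B (f : {linear A -> B}) : {linear A -> B} := (\- f).
Definition subl A B (f g : {linear A -> B}) : {linear A -> B} := (f \- g).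
Definition zerol A B : {linear A -> B} := \0.
Definition idl A : {linear A -> A} := idfun.
Definition fstl A B : {linear (A * B)%type -> A} := fst.
Definition sndl A B : {linear (A * B)%type -> B} := snd.

End Linear.

Section Sub.
Context {R : pzRingType}.

Record submod (V : lmodType R) := Submod {
  sm_pred :> V -> Prop;
  sm0 : sm_pred 0;
  smL : forall (a : R) x y, sm_pred x -> sm_pred y -> sm_pred (a *: x + y) }.

Section SubT.
Context {V : lmodType R} (P : submod V).
Definition sm_bool : pred V := fun x => `[< P x >].
Fact sm_closed : GRing.submod_closed sm_bool.
Proof.
split; first by apply/asboolP; apply: sm0.
by move=> a x y /asboolP hx /asboolP hy; apply/asboolP; apply: smL.
Qed.
HB.instance Definition _ := GRing.isSubmodClosed.Build R V sm_bool sm_closed.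
Definition subT := {x : V | x \in sm_bool}.
HB.instance Definition _ := SubType.on subT.
HB.instance Definition _ := [Choice of subT by <:].
HB.instance Definition _ := [SubChoice_isSubLmodule of subT by <:].

End SubT.

End Sub.
Section SubTheory.
Context {R : pzRingType} {V : lmodType R}.
Implicit Type P : submod V.

Fact sub_val_linear P : linear (val : subT P -> V).
Proof. exact: linearP. Qed.
Definition sub_val P : {linear subT P -> V} := lin_of (@sub_val_linear P).

Lemma sub_valP P (x : subT P) : P (sub_val P x).
Proof. by rewrite lin_ofE; apply/asboolP; exact: (valP x). Qed.

Lemma sub_val_inj P : injective (sub_val P).
Proof. by move=> x y; rewrite !lin_ofE; exact: val_inj. Qed.

Definition sub_mk P x (h : P x) : subT P :=
  exist _ x (introT (asboolP _) h : x \in sm_bool P).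

Lemma sub_mkK P x (h : P x) : sub_val P (sub_mk h) = x.
Proof. by rewrite lin_ofE. Qed.

Lemma corestr_linear P (A : lmodType R) (f : {linear A -> V}) (h : forall x, P (f x)) :
  linear (fun x => sub_mk (h x)).
Proof. by move=> a x y; apply: sub_val_inj; rewrite [in RHS]linearP !sub_mkK linearP. Qed.

Definition corestr P (A : lmodType R) (f : {linear A -> V}) (h : forall x, P (f x)) :
  {linear A -> subT P} := lin_of (corestr_linear h).

Lemma corestrE P (A : lmodType R) (f : {linear A -> V}) (h : forall x, P (f x)) x :
  sub_val P (corestr h x) = f x.
Proof. by rewrite [corestr _ _]lin_ofE sub_mkK. Qed.

Lemma smD P x y : P x -> P y -> P (x + y).
Proof. by move=> hx hy; rewrite -[x]scale1r; apply: smL. Qed.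

Lemma smZ P a x : P x -> P (a *: x).
Proof. by move=> hx; rewrite -[_ *: _]addr0; apply: smL => //; apply: sm0. Qed.

Lemma smN P x : P x -> P (- x).
Proof. by move=> hx; rewrite -scaleN1r; apply: smZ. Qed.

Lemma smB P x y : P x -> P y -> P (x - y).
Proof. by move=> hx /smN; apply: smD. Qed.

Lemma sm_sum P (I : Type) (s : seq I) (F : I -> V) :
  (forall i, P (F i)) -> P (\sum_(i <- s) F i).
Proof.
move=> h; elim/big_ind: _ => //; first exact: sm0.
by move=> x y; apply: smD.
Qed.

End SubTheory.

Section Quo.
Context {R : pzRingType} {V : lmodType R} (P : submod V).

Definition qrep (x : V) : V := choose (fun y => `[< P (x - y) >]) x.

Lemma qrepP x : P (x - qrep x).
Proof.
by apply/asboolP; apply: (@chooseP _ (fun y => `[< P (x - y) >])); apply/asboolP; rewrite subrr; apply: sm0.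
Qed.

Lemma qrep_eq x y : P (x - y) -> qrep x = qrep y.
Proof.
move=> h; rewrite /qrep.
have e : (fun z => `[< P (x - z) >]) =1 (fun z => `[< P (y - z) >]).
  move=> z; apply: asbool_equiv_eq; split=> hz.
    have -> : y - z = (x - z) - (x - y) by rewrite opprB [RHS]addrC addrA subrK.
    exact: smB.
  have -> : x - z = (x - y) + (y - z) by rewrite addrA subrK.
  exact: smD.
rewrite (eq_choose e); apply: choose_id; apply/asboolP.
  by rewrite -opprB; apply: smN.
by rewrite subrr; apply: sm0.
Qed.

Lemma qrep_id x : qrep (qrep x) = qrep x.
Proof. by apply: qrep_eq; rewrite -opprB; apply: smN; apply: qrepP. Qed.

(** Classes are encoded by their chosen representatives, which makes the quotient a
    subtype of V. *)
Definition quoT := {x : V | qrep x == x}.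
HB.instance Definition _ := SubType.on quoT.
HB.instance Definition _ := [Choice of quoT by <:].

Definition qpi (x : V) : quoT := exist _ (qrep x) (introT eqP (qrep_id x)).

Lemma qpi_eq x y : P (x - y) -> qpi x = qpi y.
Proof. by move=> h; apply: val_inj; rewrite /= (qrep_eq h). Qed.

Lemma qpi_val (u : quoT) : qpi (val u) = u.
Proof. by apply: val_inj => /=; apply/eqP; apply: (valP u). Qed.

Lemma qpi_ex (u : quoT) : exists x, u = qpi x.
Proof. by exists (val u); rewrite qpi_val. Qed.

Definition qadd (u v : quoT) := qpi (val u + val v).
Definition qopp (u : quoT) := qpi (- val u).
Definition qscale a (u : quoT) := qpi (a *: val u).

Lemma qaddE x y : qadd (qpi x) (qpi y) = qpi (x + y).
Proof.
apply: qpi_eq => /=; rewrite -opprB; apply: smN; rewrite opprD addrACA.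
by apply: smD; apply: qrepP.
Qed.
Lemma qoppE x : qopp (qpi x) = qpi (- x).
Proof. by apply: qpi_eq => /=; rewrite opprK addrC; apply: qrepP. Qed.
Lemma qscaleE a x : qscale a (qpi x) = qpi (a *: x).
Proof.
by apply: qpi_eq => /=; rewrite -scalerBr; apply: smZ; rewrite -opprB; apply/smN/qrepP.
Qed.

Fact qaddA : associative qadd.
Proof.
move=> u v w; have [x ->] := qpi_ex u; have [y ->] := qpi_ex v; have [z ->] := qpi_ex w.
by rewrite !qaddE addrA.
Qed.
Fact qaddC : commutative qadd.
Proof.
by move=> u v; have [x ->] := qpi_ex u; have [y ->] := qpi_ex v; rewrite !qaddE addrC.
Qed.
Fact qadd0 : left_id (qpi 0) qadd.
Proof. by move=> u; have [x ->] := qpi_ex u; rewrite !qaddE add0r. Qed.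
Fact qaddN : left_inverse (qpi 0) qopp qadd.
Proof. by move=> u; have [x ->] := qpi_ex u; rewrite qoppE !qaddE addNr. Qed.
HB.instance Definition _ := GRing.isZmodule.Build quoT qaddA qaddC qadd0 qaddN.

Fact qscaleA a b v : qscale a (qscale b v) = qscale (a * b) v.
Proof. by have [x ->] := qpi_ex v; rewrite !qscaleE scalerA. Qed.
Fact qscale1 : left_id 1 qscale.
Proof. by move=> v; have [x ->] := qpi_ex v; rewrite !qscaleE scale1r. Qed.
Fact qpiD x y : qpi x + qpi y = qpi (x + y).
Proof. exact: qaddE. Qed.
Fact qscaleDr : right_distributive qscale +%R.
Proof.
move=> a u v; have [x ->] := qpi_ex u; have [y ->] := qpi_ex v.
by rewrite qpiD !qscaleE qpiD scalerDr.
Qed.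
Fact qscaleDl v : {morph qscale^~ v : a b / a + b}.
Proof.
move=> a b; have [x ->] := qpi_ex v.
by rewrite !qscaleE qpiD scalerDl.
Qed.
HB.instance Definition _ :=
  GRing.Zmodule_isLmodule.Build R quoT qscaleA qscale1 qscaleDr qscaleDl.

Fact qpi_linear : linear qpi.
Proof. by move=> a x y; rewrite -qpiD -qscaleE. Qed.

Definition quo_pi : {linear V -> quoT} := lin_of qpi_linear.

Lemma quo_pi_surj : is_surjective quo_pi.
Proof. by move=> u; have [x ->] := qpi_ex u; exists x; rewrite lin_ofE. Qed.

Lemma quo_piP x : quo_pi x = 0 <-> P x.
Proof.
split=> [|h]; last by rewrite -(linear0 quo_pi) !lin_ofE; apply: qpi_eq; rewrite subr0.
rewrite -(linear0 quo_pi) !lin_ofE => /(congr1 val) /= e.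
rewrite -[x](subrK (qrep x)) e; apply: smD; first by rewrite -e; apply: qrepP.
by rewrite -[qrep 0]subr0 -opprB; apply/smN/qrepP.
Qed.

End Quo.

Lemma exactP {R : pzRingType} (A B C : lmodType R) (f : {linear A -> B}) (g : {linear B -> C}) :
  exact_at f g -> forall y, g y = 0 <-> exists x, f x = y.
Proof. by []. Qed.

Section Factor.
Context {R : pzRingType}.
Implicit Types A B C : lmodType R.

Lemma factor_surj A B C (p : {linear A -> B}) (f : {linear A -> C}) :
  is_surjective p -> (forall x, p x = 0 -> f x = 0) ->
  exists g : {linear B -> C}, forall x, g (p x) = f x.
Proof.
move=> ps pf; have [s sP] := choice ps.
have fE x y : p x = p y -> f x = f y.
  by move=> e; apply/eqP; rewrite -subr_eq0 -linearB; apply/eqP/pf; rewrite linearB e subrr.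
have H : linear (f \o s).
  by move=> a x y /=; rewrite -linearP; apply: fE; rewrite linearP !sP.
by exists (lin_of H) => x; rewrite lin_ofE /=; apply: fE; rewrite sP.
Qed.

Lemma factor_inj A B C (i : {linear B -> C}) (f : {linear A -> C}) :
  injective i -> (forall x, exists y, i y = f x) ->
  exists g : {linear A -> B}, forall x, i (g x) = f x.
Proof.
move=> ii /choice [s sP].
have H : linear s by move=> a x y; apply: ii; rewrite linearP !sP linearP.
by exists (lin_of H) => x; rewrite lin_ofE.
Qed.

Lemma injective_extend (E A : lmodType R) (P : submod A) (f : {linear subT P -> E}) :
  injective_module E -> exists g : {linear A -> E}, forall x, g (sub_val P x) = f x.
Proof. by move=> /(_ _ _ (sub_val P) f) H; apply: H; apply: sub_val_inj. Qed.

Lemma prod_injective (E F : lmodType R) : injective_module E -> injective_module F ->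
  injective_module (E * F)%type.
Proof.
move=> iE iF A B i f ii.
have [g gP] := iE _ _ i (compl (fstl E F) f) ii.
have [h hP] := iF _ _ i (compl (sndl E F) f) ii.
have H : linear (fun x => (g x, h x)) by move=> a x y; rewrite !linearP.
by exists (lin_of H) => x; rewrite lin_ofE gP hP /= -surjective_pairing.
Qed.

End Factor.

Section EqSm.
Context {R : pzRingType} {V W : lmodType R} (f g : {linear V -> W}).
Fact eq_sm0 : f 0 = g 0. Proof. by rewrite !linear0. Qed.
Fact eq_smL a x y : f x = g x -> f y = g y -> f (a *: x + y) = g (a *: x + y).
Proof. by rewrite !linearP => -> ->. Qed.
Definition eq_sm : submod V := @Submod R V (fun x => f x = g x) eq_sm0 eq_smL.
End EqSm.

Section DProd.
Context {R : pzRingType} {I : Type} (M : I -> lmodType R).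
Definition dprod := forall i, M i.
HB.instance Definition _ := gen_eqMixin dprod.
HB.instance Definition _ := gen_choiceMixin dprod.

Definition dpadd (f g : dprod) : dprod := fun i => f i + g i.
Definition dpopp (f : dprod) : dprod := fun i => - f i.
Definition dpscale a (f : dprod) : dprod := fun i => a *: f i.
Definition dp0 : dprod := fun i => 0.

Fact dpaddA : associative dpadd.
Proof. by move=> f g h; apply: functional_extensionality_dep => i; apply: addrA. Qed.
Fact dpaddC : commutative dpadd.
Proof. by move=> f g; apply: functional_extensionality_dep => i; apply: addrC. Qed.
Fact dpadd0 : left_id dp0 dpadd.
Proof. by move=> f; apply: functional_extensionality_dep => i; apply: add0r. Qed.
Fact dpaddN : left_inverse dp0 dpopp dpadd.
Proof. by move=> f; apply: functional_extensionality_dep => i; apply: addNr. Qed.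
HB.instance Definition _ := GRing.isZmodule.Build dprod dpaddA dpaddC dpadd0 dpaddN.

Fact dpscaleA a b v : dpscale a (dpscale b v) = dpscale (a * b) v.
Proof. by apply: functional_extensionality_dep => i; apply: scalerA. Qed.
Fact dpscale1 : left_id 1 dpscale.
Proof. by move=> v; apply: functional_extensionality_dep => i; apply: scale1r. Qed.
Fact dpscaleDr : right_distributive dpscale +%R.
Proof. by move=> a u v; apply: functional_extensionality_dep => i; apply: scalerDr. Qed.
Fact dpscaleDl v : {morph dpscale^~ v : a b / a + b}.
Proof. by move=> a b; apply: functional_extensionality_dep => i; apply: scalerDl. Qed.
HB.instance Definition _ :=
  GRing.Zmodule_isLmodule.Build R dprod dpscaleA dpscale1 dpscaleDr dpscaleDl.

Lemma dprodP (f g : dprod) : (forall i, f i = g i) -> f = g.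
Proof. exact: functional_extensionality_dep. Qed.

Fact dp_proj_linear i : linear (fun f : dprod => f i).
Proof. by []. Qed.
Definition dp_proj i : {linear dprod -> M i} := lin_of (dp_proj_linear i).
Lemma dp_projE i f : dp_proj i f = f i.
Proof. by rewrite lin_ofE. Qed.

Fact dp_pair_linear (A : lmodType R) (f : forall i, {linear A -> M i}) :
  linear (fun x => (fun i => f i x) : dprod).
Proof. by move=> a x y; apply: dprodP => i; rewrite linearP. Qed.
Definition dp_pair (A : lmodType R) (f : forall i, {linear A -> M i}) : {linear A -> dprod} :=
  lin_of (dp_pair_linear f).
Lemma dp_pairE (A : lmodType R) (f : forall i, {linear A -> M i}) x i : dp_pair f x i = f i x.
Proof. by rewrite lin_ofE. Qed.

Lemma dprodZD a (f g : dprod) i : (a *: f + g) i = a *: f i + g i.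
Proof. by []. Qed.
Lemma dprodD (f g : dprod) i : (f + g) i = f i + g i.
Proof. by []. Qed.
Lemma dprodN (f : dprod) i : (- f) i = - f i.
Proof. by []. Qed.
End DProd.

Lemma choice_dep (I : Type) (T : I -> Type) (Q : forall i, T i -> Prop) :
  (forall i, exists x, Q i x) -> exists f : forall i, T i, forall i, Q i (f i).
Proof. by move=> h; exists (fun i => projT1 (cid (h i))) => i; exact: (projT2 (cid (h i))). Qed.

Lemma lchoice {R : pzRingType} (I : Type) (A B : I -> lmodType R)
  (Q : forall i, {linear A i -> B i} -> Prop) :
  (forall i, exists f, Q i f) -> exists f : forall i, {linear A i -> B i}, forall i, Q i (f i).
Proof.
move=> h; exists (fun i => projT1 (cid (h i))) => i; exact: (projT2 (cid (h i))).
Qed.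

Lemma dprod_injective {R : pzRingType} (I : Type) (E : I -> lmodType R) :
  (forall i, injective_module (E i)) -> injective_module (dprod E).
Proof.
move=> iE A B i f ii.
have [g gP] := @lchoice _ _ (fun=> B) E (fun k g => forall x, g (i x) = dp_proj E k (f x))
  (fun k => iE k _ _ i (compl (dp_proj E k) f) ii).
by exists (dp_pair g) => x; apply: dprodP => k; rewrite dp_pairE gP dp_projE.
Qed.

Section Transfer.
Context {R : pzRingType} {I : eqType}.
Implicit Type M : I -> lmodType R.

Definition xfer_fun M i j (x : M i) : M j :=
  if i =P j is ReflectT e then ecast k (M k) e x else 0.

Lemma xfer_linear M i j : linear (@xfer_fun M i j).
Proof.
move=> a x y; rewrite /xfer_fun; case: eqP => [e|_]; last by rewrite scaler0 addr0.
by case: j / e.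
Qed.

(** The transport along i = j, extended by 0 to all pairs of indices.  Being total and
    linear, it replaces casts between the components of a graded module, such as those
    in degrees n and n + 1 - 1. *)
Definition xfer M i j : {linear M i -> M j} := lin_of (@xfer_linear M i j).

Lemma xfer_id M i (x : M i) : xfer M i i x = x.
Proof.
rewrite lin_ofE /xfer_fun; case: eqP => // e.
by rewrite (eq_irrelevance e (erefl i)).
Qed.

Lemma xfer_ne M i j (x : M i) : i != j -> xfer M i j x = 0.
Proof. by rewrite lin_ofE /xfer_fun; case: eqP. Qed.

Lemma xfer_natural (M N : I -> lmodType R) (f : forall i, {linear M i -> N i}) i j (x : M i) :
  f j (xfer M i j x) = xfer N i j (f i x).
Proof.
case: (eqVneq i j) => [e|ne]; first by subst j; rewrite !xfer_id.
by rewrite !xfer_ne // linear0.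
Qed.
End Transfer.

Section DSum.
Context {R : pzRingType} {I : eqType} (M : I -> lmodType R).
Implicit Type N : lmodType R.

Definition fsupp (f : dprod M) (s : seq I) : Prop := forall i, i \notin s -> f i = 0.

Fact dsum_sm0 : exists s, fsupp 0 s.
Proof. by exists [::]. Qed.
Fact dsum_smL a (f g : dprod M) :
  (exists s, fsupp f s) -> (exists s, fsupp g s) -> exists s, fsupp (a *: f + g) s.
Proof.
move=> [s hs] [t ht]; exists (s ++ t) => i; rewrite mem_cat negb_or => /andP[/hs fi /ht gi].
by rewrite dprodZD fi gi scaler0 addr0.
Qed.
Definition dsum_sm : submod (dprod M) := Submod dsum_sm0 dsum_smL.
Definition dsum : lmodType R := subT dsum_sm.

Fact dcoord_linear i : linear (fun x : dsum => sub_val dsum_sm x i).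
Proof. by move=> a x y; rewrite linearP. Qed.
Definition dcoord i : {linear dsum -> M i} := lin_of (@dcoord_linear i).

Fact dsum_inj_supp i (x : M i) : dsum_sm (dp_pair (fun j => xfer M i j) x).
Proof. by exists [:: i] => j; rewrite inE eq_sym dp_pairE => /xfer_ne ->. Qed.
Definition dinj i : {linear M i -> dsum} := corestr (@dsum_inj_supp i).

Lemma dcoord_dinj i j (x : M i) : dcoord j (dinj i x) = xfer M i j x.
Proof. by rewrite lin_ofE corestrE dp_pairE. Qed.

Lemma dsum_eq (x y : dsum) : (forall i, dcoord i x = dcoord i y) -> x = y.
Proof. by move=> h; apply: sub_val_inj; apply: dprodP => i; move: (h i); rewrite !lin_ofE. Qed.

Definition dsupp (x : dsum) : seq I := undup (projT1 (cid (sub_valP x))).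
Lemma dsupp_uniq x : uniq (dsupp x).
Proof. exact: undup_uniq. Qed.
Lemma dsuppP x i : i \notin dsupp x -> dcoord i x = 0.
Proof. by rewrite mem_undup [dcoord _ _]lin_ofE; apply: (projT2 (cid (sub_valP x))). Qed.

Lemma dsum_sumE (x : dsum) (s : seq I) : uniq s -> (forall i, i \notin s -> dcoord i x = 0) ->
  x = \sum_(i <- s) dinj i (dcoord i x).
Proof.
move=> us hs; apply: dsum_eq => j; rewrite linear_sum.
have [js|js] := boolP (j \in s).
  rewrite (bigD1_seq j) //= dcoord_dinj xfer_id big1 ?addr0 // => i ne.
  by rewrite dcoord_dinj xfer_ne.
rewrite hs // big_seq big1 // => i si; rewrite dcoord_dinj xfer_ne //.
by apply: contraNneq js => <-.
Qed.

Lemma dsumE (x : dsum) : x = \sum_(i <- dsupp x) dinj i (dcoord i x).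
Proof. by apply: dsum_sumE; [apply: dsupp_uniq | apply: dsuppP]. Qed.

Lemma dsum_ext N (f g : {linear dsum -> N}) :
  (forall i x, f (dinj i x) = g (dinj i x)) -> forall x, f x = g x.
Proof. by move=> h x; rewrite (dsumE x) !linear_sum; apply: eq_bigr => i _; apply: h. Qed.

Section Map.
Context {N : lmodType R} (u : forall i, {linear M i -> N}).
Definition dsum_map_fun (x : dsum) : N := \sum_(i <- dsupp x) u i (dcoord i x).

Lemma dsum_map_supp x (s : seq I) : uniq s -> (forall i, i \notin s -> dcoord i x = 0) ->
  dsum_map_fun x = \sum_(i <- s) u i (dcoord i x).
Proof.
move=> us hs; rewrite /dsum_map_fun.
have aux (a b : seq I) : uniq a -> uniq b -> (forall i, i \notin a -> dcoord i x = 0) ->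
  \sum_(i <- a ) u i (dcoord i x) = \sum_(i <- undup (a ++ b)) u i (dcoord i x).
  move=> ua ub ha; rewrite [RHS](bigID [in a]) /= [X in _ + X]big1 ?addr0; last first.
    by move=> i ai; rewrite ha ?linear0.
  rewrite -[RHS]big_filter; apply: perm_big. apply: uniq_perm => //.
    by rewrite filter_uniq ?undup_uniq.
  by move=> i; rewrite mem_filter mem_undup mem_cat; case: (i \in a).
rewrite (aux _ s) ?dsupp_uniq //; last exact: dsuppP.
rewrite [RHS](aux _ (dsupp x)) ?dsupp_uniq //; apply: perm_big.
apply: uniq_perm; rewrite ?undup_uniq // => i.
by rewrite !mem_undup !mem_cat orbC.
Qed.

Fact dsum_map_linear : linear dsum_map_fun.
Proof.
move=> a x y; pose s := undup (dsupp x ++ dsupp y).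
have hx i : i \notin s -> dcoord i x = 0.
  by rewrite mem_undup mem_cat negb_or => /andP[/dsuppP].
have hy i : i \notin s -> dcoord i y = 0.
  by rewrite mem_undup mem_cat negb_or => /andP[_ /dsuppP].
rewrite !(@dsum_map_supp _ s) ?undup_uniq //; last first.
  by move=> i si; rewrite linearP hx // hy // scaler0 addr0.
by rewrite scaler_sumr -big_split; apply: eq_bigr => i _; rewrite /= !linearP.
Qed.
Definition dsum_map : {linear dsum -> N} := lin_of dsum_map_linear.

Lemma dsum_mapE i x : dsum_map (dinj i x) = u i x.
Proof.
rewrite lin_ofE (@dsum_map_supp _ [:: i]) //.
  by rewrite big_seq1 dcoord_dinj xfer_id.
by move=> j; rewrite inE dcoord_dinj eq_sym => /xfer_ne ->.
Qed.
End Map.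
End DSum.

Section Free.
Context {R : pzRingType} {S : eqType}.
Implicit Type N : lmodType R.

Definition freemod : lmodType R := dsum (fun _ : S => (R^o : lmodType R)).
Definition fbase (s : S) : freemod := dinj (fun _ : S => (R^o : lmodType R)) s (1 : R).

Fact freemod_coef_linear N (v : S -> N) s : linear (fun r : R^o => (r : R) *: v s).
Proof. by move=> a x y; rewrite scalerDl scalerA. Qed.
Definition freemod_map N (v : S -> N) : {linear freemod -> N} :=
  dsum_map (fun s => lin_of (freemod_coef_linear v s)).

Lemma freemod_mapE N (v : S -> N) s : freemod_map v (fbase s) = v s.
Proof. by rewrite dsum_mapE lin_ofE scale1r. Qed.

Lemma dinj_fbase s (r : R^o) :
  dinj (fun _ : S => (R^o : lmodType R)) s r = (r : R) *: fbase s.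
Proof. by rewrite -linearZ /= /GRing.scale /= mulr1. Qed.

Lemma freemodE (x : freemod) : x = \sum_(s <- dsupp x) (dcoord _ s x : R) *: fbase s.
Proof. by rewrite {1}(dsumE x); apply: eq_bigr => s _; rewrite dinj_fbase. Qed.

Lemma freemod_ext N (f g : {linear freemod -> N}) :
  (forall s, f (fbase s) = g (fbase s)) -> forall x, f x = g x.
Proof.
move=> h; apply: dsum_ext => s r.
by rewrite dinj_fbase !linearZ h.
Qed.

End Free.
Arguments freemod R S : clear implicits.
Arguments fbase {R S} s.

(** * Acyclic pairs of submodules of a differential module *)
Lemma zorn_preorder (T : Type) (le : T -> T -> Prop) (t0 : T) :
  (forall t, le t t) -> (forall r s t, le r s -> le s t -> le r t) ->
  (forall A : T -> Prop, (exists a, A a) ->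
     (forall s t, A s -> A t -> le s t \/ le t s) -> exists u, forall s, A s -> le s u) ->
  exists t, forall s, le t s -> le s t.
Proof.
move=> lr lt ub; pose r : rel T := fun s t => `[< le s t >].
have [||A tA|t ht] := @ZL_preorder T t0 r.
- by move=> t; apply/asboolP.
- by move=> a b c /asboolP ab /asboolP bc; apply/asboolP; apply: lt bc.
- have [/ub [|u hu]|nA] := pselect (exists a, A a).
  + by move=> s t As At; have [/asboolP|/asboolP] := tA s t As At; [left|right].
  + by exists u => s /hu ?; apply/asboolP.
  + by exists t0 => s As; case: nA; exists s.
by exists t => s /asboolP /ht /asboolP.
Qed.

Section Acyclic.
Context {R : pzRingType}.

(** Acyclicity of G / H for complexes of injective modules.  Maps from G / H to I are
    represented by maps g from V, of which only the restriction to G matters and which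
    vanish on H: since I is injective, every map on G / H arises in this way.  Replacing
    dI by - dI gives the same property for maps that anticommute with the
    differentials, see acyc_odd, so both parities of the degree are covered. *)
Definition acyc (V : lmodType R) (d : {linear V -> V}) (G H : V -> Prop) : Prop :=
  forall (I : lmodType R) (dI : {linear I -> I}) (g : {linear V -> I}),
    injective_module I -> (forall y, dI (dI y) = 0) ->
    (forall x, G x -> dI (g x) = g (d x)) -> (forall x, H x -> g x = 0) ->
    exists h : {linear V -> I},
      (forall x, H x -> h x = 0) /\ (forall x, G x -> g x = dI (h x) + h (d x)).

Section Fixed.
Context {V : lmodType R} (d : {linear V -> V}).
Hypothesis dd : forall x, d (d x) = 0.

Lemma acyc_odd (G H : V -> Prop) (I : lmodType R) (dI : {linear I -> I}) (g : {linear V -> I}) :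
    acyc d G H -> injective_module I -> (forall y, dI (dI y) = 0) ->
    (forall x, G x -> dI (g x) = - g (d x)) -> (forall x, H x -> g x = 0) ->
    exists h : {linear V -> I},
      (forall x, H x -> h x = 0) /\ (forall x, G x -> g x = dI (h x) - h (d x)).
Proof.
move=> a iI dIK gd gH; have [||//|h [hH hG]] := a I (oppl dI) g iI.
- by move=> y /=; rewrite linearN dIK !oppr0.
- by move=> x /gd /= ->; rewrite opprK.
exists (oppl h); split=> x /= => [/hH ->|/hG /= e]; first by rewrite oppr0.
by rewrite linearN opprK.
Qed.

(** Two-out-of-three for H <= K <= G: a null homotopy h of g on G / H is, over K, a
    cycle of the opposite parity, hence a boundary dI k - k d there; subtracting this
    boundary makes h vanish on K and does not change dI h + h d. *)
Lemma acyc_quo (G K H : V -> Prop) :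
  (forall x, H x -> K x) -> (forall x, K x -> G x) ->
  acyc d G H -> acyc d K H -> acyc d G K.
Proof.
move=> HK KG aG aK I dI g iI dIK gG gK.
have [|h [hH hG]] := aG I dI g iI dIK gG; first by move=> x /HK /gK.
have [| |k [kH kK]] := acyc_odd (g := h) aK iI dIK.
- move=> x Kx; apply/eqP; rewrite -subr_eq0 opprK; apply/eqP.
  by rewrite -hG ?gK //; apply: KG.
- exact: hH.
exists (subl h (subl (compl dI k) (compl k d))); split=> x => [/kK|/hG] /= e.
  by rewrite e subrr.
rewrite !(linearB dI) dIK dd (linear0 k) sub0r subr0 opprK.
by rewrite addrACA [dI (k (d x)) - _]addrN addr0.
Qed.

(** The error g - (dI h + h d) is a cycle on G that vanishes on K, and h is corrected by
    a null homotopy of it. *)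
Lemma acyc_extend (K G : V -> Prop) (I : lmodType R) (dI : {linear I -> I})
    (g h : {linear V -> I}) :
  acyc d G K -> injective_module I -> (forall y, dI (dI y) = 0) ->
  (forall x, G x -> dI (g x) = g (d x)) ->
  (forall x, K x -> g x = dI (h x) + h (d x)) ->
  exists h' : {linear V -> I},
    (forall x, K x -> h' x = h x) /\ (forall x, G x -> g x = dI (h' x) + h' (d x)).
Proof.
move=> aG iI dIK gG hK.
have [x Gx|x Kx|k [kK kG]] :=
    aG I dI (subl g (addl (compl dI h) (compl h d))) iI dIK.
- by rewrite /= linearB linearD dIK add0r dd linear0 addr0 gG.
- by rewrite /= hK // subrr.
exists (addl h k); split=> x => [/kK|/kG] /= e; first by rewrite e addr0.
by rewrite linearD addrACA -e addrC subrK.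
Qed.
End Fixed.

Section Union.
Context {V : lmodType R} {J : Type} (P : J -> submod V) (j0 : J).
Hypothesis dirP : forall i j, exists k, (forall x, P i x -> P k x) /\ (forall x, P j x -> P k x).
Fact union_sm0 : exists j, P j 0.
Proof. by exists j0; apply: sm0. Qed.
Fact union_smL a x y : (exists j, P j x) -> (exists j, P j y) -> exists j, P j (a *: x + y).
Proof.
move=> [i Pi] [j Pj]; have [k [ik jk]] := dirP i j.
by exists k; apply: smL; [apply: ik | apply: jk].
Qed.
Definition union_sm : submod V := Submod union_sm0 union_smL.

(** Compatible maps on a directed family of submodules glue to a map on their union,
    which extends to V because the target is injective. *)
Lemma glue (I : lmodType R) (h : J -> {linear V -> I}) : injective_module I ->
  (forall i j x, P i x -> P j x -> h i x = h j x) ->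
  exists g : {linear V -> I}, forall j x, P j x -> g x = h j x.
Proof.
move=> iI he.
pose c (x : subT union_sm) := projT1 (cid (sub_valP x)).
have cP x : P (c x) (sub_val _ x) := projT2 (cid (sub_valP x)).
have cE x j : P j (sub_val _ x) -> h (c x) (sub_val _ x) = h j (sub_val _ x).
  by move=> Pj; apply: he.
have H : linear (fun x => h (c x) (sub_val _ x)).
  move=> a x y; have [i [xi yi]] := dirP (c x) (c y).
  have ex := cE x i (xi _ (cP x)); have ey := cE y i (yi _ (cP y)).
  rewrite ex ey (cE _ i) ?linearP //.
  by apply: smL; [apply: xi; apply: cP | apply: yi; apply: cP].
have [g gP] := injective_extend (lin_of H) iI.
exists g => j x Pj.
have Ux : union_sm x by exists j.
by rewrite -(sub_mkK Ux) gP lin_ofE; apply: cE; rewrite sub_mkK.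
Qed.
End Union.

Record wellorder (L : Type) (le : L -> L -> Prop) : Prop := WellOrder {
  wo_refl : forall x, le x x;
  wo_trans : forall x y z, le x y -> le y z -> le x z;
  wo_anti : forall x y, le x y -> le y x -> x = y;
  wo_total : forall x y, le x y \/ le y x;
  wo_min : forall P : L -> Prop, (exists x, P x) -> exists x, P x /\ forall y, P y -> le x y }.

Lemma wo_ind (L : Type) (le : L -> L -> Prop) (w : wellorder le) (P : L -> Prop) :
  (forall x, (forall y, le y x -> y <> x -> P y) -> P x) -> forall x, P x.
Proof.
move=> h x; apply: contrapT => nx.
have [|z [nz zm]] := wo_min w (P := fun x => ~ P x); first by exists x.
apply: nz; apply: h => y yz ne; apply: contrapT => /zm zy.
by apply: ne; apply: (wo_anti w).
Qed.

Section UnionAcyclic.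
Context {V : lmodType R} (d : {linear V -> V}).
Hypothesis dd : forall x, d (d x) = 0.
Context {L : Type} {le : L -> L -> Prop} (w : wellorder le).
Context (K : L -> submod V) (N : submod V).
Hypothesis Kmono : forall a b x, le a b -> K a x -> K b x.
Hypothesis NK : forall a x, N x -> K a x.
Hypothesis Kd : forall a x, K a x -> K a (d x).
Hypothesis Nd : forall x, N x -> N (d x).
Hypothesis Kacyc : forall a, acyc d (K a) N.

(* The union of N and of the K b with b in J; adding N takes care of the empty J. *)
Let KJ (J : L -> Prop) (x : V) : Prop := N x \/ exists2 b, J b & K b x.
Let lt a b := le a b /\ a <> b.
Let down (J : L -> Prop) := forall a b, le a b -> J b -> J a.

Fact KJ0 J : KJ J 0. Proof. by left; apply: sm0. Qed.
Fact KJL J a x y : KJ J x -> KJ J y -> KJ J (a *: x + y).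
Proof.
move=> [Nx|[b Jb bx]] [Ny|[c Jc cy]]; first by left; apply: smL.
- by right; exists c => //; apply: smL => //; apply: NK.
- by right; exists b => //; apply: smL => //; apply: NK.
right; have [bc|cb] := wo_total w b c.
  by exists c => //; apply: smL => //; apply: Kmono bx.
by exists b => //; apply: smL => //; apply: Kmono cy.
Qed.
Let KJs J : submod V := Submod (@KJ0 J) (@KJL J).

(** By Zorn's lemma, a given cycle has a null homotopy on a maximal initial segment J'
    of J.  If J' is not J and b is the least index of J outside J', then J' consists
    of the indices below b, so K b is acyclic relative to the union over J' by
    two-out-of-three, and the homotopy extends to K b. *)
Lemma KJ_acyc_step (J : L -> Prop) : down J -> (forall b, J b -> acyc d (KJ (lt^~ b)) N) ->
  acyc d (KJ J) N.
Proof.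
move=> dJ aJ I dI g iI dIK gJ gN.
pose good (p : (L -> Prop) * {linear V -> I}) :=
  [/\ forall a, p.1 a -> J a, down p.1, forall x, N x -> p.2 x = 0
    & forall x, KJ p.1 x -> g x = dI (p.2 x) + p.2 (d x)].
pose T := {p | good p}.
pose leT (p q : T) := (forall a, (sval p).1 a -> (sval q).1 a) /\
  (forall x, KJ (sval p).1 x -> (sval q).2 x = (sval p).2 x).
have dKJ J' x : KJ J' x -> KJ J' (d x).
  by move=> [Nx|[b Jb bx]]; [left; apply: Nd|right; exists b => //; apply: Kd].
have KJm (J1 J2 : L -> Prop) x : (forall a, J1 a -> J2 a) -> KJ J1 x -> KJ J2 x.
  by move=> s [Nx|[b /s Jb bx]]; [left|right; exists b].
have [h0 [h0N h0K]] : exists h : {linear V -> I}, (forall x, N x -> h x = 0) /\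
    forall x, N x -> g x = dI (h x) + h (d x).
  have [[b Jb]|nJ] := pselect (exists b, J b).
    have [|//|h [hN hK]] := @Kacyc b I dI g iI dIK.
      by move=> x bx; apply: gJ; right; exists b.
    by exists h; split=> // x Nx; apply: hK; apply: NK.
  have [|[b Jb]] := pselect (forall b, ~ J b); last by case: nJ; exists b; apply: contrapT.
  move=> _; exists (zerol V I); split=> // x Nx /=.
  by rewrite gN // linear0 addr0.
have t0P : good (fun=> False, h0).
  split=> //= x [Nx|[]] //; exact: h0K.
have [||A [p0 Ap0] tA|] := @zorn_preorder T leT (exist _ _ t0P).
- by move=> t; split.
- move=> r s t [rs rs'] [st st']; split=> [a /rs /st //|x rx].
  by rewrite st' ?rs' //; apply: KJm rx.
- pose Q (q : {q : T | A q}) := KJs (sval (sval q)).1.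
  have dirQ i j : exists k, (forall x, Q i x -> Q k x) /\ (forall x, Q j x -> Q k x).
    have [[ij _]|[ji _]] := tA _ _ (svalP i) (svalP j).
      by exists j; split=> // x; apply: KJm.
    by exists i; split=> // x; apply: KJm.
  have [i j x Qi Qj|h hP] := @glue _ _ Q (exist _ _ Ap0) dirQ _ (fun q => (sval (sval q)).2) iI.
    have [[_ e]|[_ e]] := tA _ _ (svalP i) (svalP j); first by rewrite e.
    by rewrite e.
  pose J' a := exists2 q : T, A q & (sval q).1 a.
  have KJ' x : KJ J' x -> exists q, Q q x.
    move=> [Nx|[b [q Aq qb] bx]]; first by exists (exist _ _ Ap0); left.
    by exists (exist _ _ Aq); right; exists b.
  have gd : good (J', h).
    split=> /=.
    - by move=> a [q Aq]; case: (svalP q) => + _ _ _; apply.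
    - by move=> a b ab [q Aq qb]; exists q => //; case: (svalP q) => _ dq _ _; apply: dq qb.
    - move=> x Nx; rewrite (hP (exist _ _ Ap0)); last by left.
      by case: (svalP p0) => _ _ + _; apply.
    - move=> x /KJ' [q Qx]; rewrite (hP q) // (hP q).
        by case: (svalP (sval q)) => _ _ _; apply.
      exact: dKJ Qx.
  exists (exist _ _ gd) => s As; split=> /=.
    by move=> a sa; exists s.
  by move=> x sx; rewrite (hP (exist _ _ As)).
move=> [[J' h] gd0] tmax; have [/= J'J dJ' hN hK] := gd0.
have [J'e|exb] : (forall a, J a -> J' a) \/ exists b, J b /\ ~ J' b.
  have [?|n] := pselect (exists b, J b /\ ~ J' b); first by right.
  by left=> a Ja; apply: contrapT => nJ'; apply: n; exists a.
- by exists h; split=> // x Jx; apply: hK; apply: KJm Jx.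
have [b [[Jb nJ'b] bmin]] := wo_min w exb.
have ltJ' a : lt a b -> J' a.
  move=> [ab ne]; apply: contrapT => na.
  by apply: ne; apply: (wo_anti w) => //; apply: bmin; split=> //; apply: dJ Jb.
have J'lt a : J' a -> lt a b.
  move=> J'a; split; last by move=> e; apply: nJ'b; rewrite -e.
  by case: (wo_total w a b) => // ba; case: nJ'b; apply: dJ' J'a.
have Kle a x : J' a -> K a x -> K b x by move=> /J'lt [ab _]; apply: Kmono.
have aKb : acyc d (K b) (KJ J').
  apply: acyc_quo (@Kacyc b) _ => //; first by move=> x; left.
    by move=> x [/NK|[a J'a]] //; apply: Kle.
  move=> I' dI' g' iI' dI'K gJ' gN'.
  have [x Jx|//|k [kN kK]] := aJ b Jb I' dI' g' iI' dI'K.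
    by apply: gJ'; apply: KJm Jx.
  by exists k; split=> // x J'x; apply: kK; apply: KJm J'x.
have [x bx|h' [h'J' h'b]] := acyc_extend (h := h) dd aKb iI dIK (g := g) _ hK.
  by apply: gJ; right; exists b.
pose J'' a := J' a \/ a = b.
have KJ'' x : KJ J'' x -> K b x.
  by move=> [/NK //|[a [J'a|->] //]]; apply: Kle.
have gd : good (J'', h').
  split=> /=.
  - by move=> a [/J'J|->].
  - move=> a c ac [J'c|e]; first by left; apply: dJ' J'c.
    by subst c; have [->|ne] := pselect (a = b); [right | left; apply: ltJ'].
  - by move=> x Nx; rewrite h'J' ?hN //; left.
  - by move=> x /KJ'' /h'b.
have [|/(_ b) bJ' _] := tmax (exist _ _ gd).
  by split=> /= [a|//]; left.
by case: nJ'b; apply: bJ'; right.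
Qed.

(** Well-founded induction on b shows that the union over the indices below b, which may
    be smaller than K b, is acyclic as well. *)
Lemma union_acyc : (exists a : L, True) -> acyc d (fun x => exists a, K a x) N.
Proof.
move=> [a0 _].
have lta b : acyc d (KJ (lt^~ b)) N.
  apply: (wo_ind w (P := fun b => acyc d (KJ (lt^~ b)) N)) b => b ih.
  apply: KJ_acyc_step => [a c ac [cb ne]|a [ab ne]]; last exact: ih.
  split; first by apply: wo_trans cb => //.
  by move=> e; apply: ne; apply: (wo_anti w) => //; rewrite -e.
have := @KJ_acyc_step (fun=> True) (fun _ _ _ _ => Logic.I) (fun b _ => lta b).
move=> aT I dI g iI dIK gG gN.
have [x Kx|//|h [hN hK]] := aT I dI g iI dIK.
  by apply: gG; case: Kx => [Nx|[b _ bx]]; [exists a0; apply: NK | exists b].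
by exists h; split=> // x [a ax]; apply: hK; right; exists a.
Qed.
End UnionAcyclic.
End Acyclic.

Lemma acyc_ext {R : pzRingType} {V : lmodType R} (d : {linear V -> V}) (G H G' H' : V -> Prop) :
  (forall x, G x <-> G' x) -> (forall x, H x <-> H' x) -> acyc d G H -> acyc d G' H'.
Proof.
move=> eG eH a I dI g iI dIK gG gH.
have [x /eG /gG //|x /eH /gH //|h [hH hG]] := a I dI g iI dIK.
by exists h; split=> x; [move/eH/hH | move/eG/hG].
Qed.

(** * Direct limits of acyclic pairs *)
Section Limit.
Context {R : pzRingType} {V : lmodType R} (d : {linear V -> V}).
Hypothesis dd : forall x, d (d x) = 0.
Context {L : eqType} {le : L -> L -> Prop} (w : wellorder le) (l0 : L).
Context (G H : L -> submod V).
Hypothesis Gmono : forall a b x, le a b -> G a x -> G b x.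
Hypothesis Hmono : forall a b x, le a b -> H a x -> H b x.
Hypothesis HG : forall a x, H a x -> G a x.
Hypothesis Gd : forall a x, G a x -> G a (d x).
Hypothesis Hd : forall a x, H a x -> H a (d x).
Hypothesis GHacyc : forall a, acyc d (G a) (H a).

Let Phi := dsum (fun _ : L => V).
Let inj a : {linear V -> Phi} := dinj (fun _ : L => V) a.
Let D : {linear Phi -> Phi} := dsum_map (fun a => compl (inj a) d).

Let Dinj a x : D (inj a x) = inj a (d x).
Proof. by rewrite dsum_mapE. Qed.

Let DD x : D (D x) = 0.
Proof.
apply: (@dsum_ext _ _ _ _ (compl D D) (zerol _ _)) => a y /=.
by rewrite !Dinj dd linear0.
Qed.

Section Comp.
Context (P : L -> submod V).
Fact comp_sm0 a : P a (dcoord (fun=> V) a 0).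
Proof. by rewrite linear0; apply: sm0. Qed.
Fact comp_smL k (x y : Phi) : (forall a, P a (dcoord (fun=> V) a x)) ->
  (forall a, P a (dcoord (fun=> V) a y)) -> forall a, P a (dcoord (fun=> V) a (k *: x + y)).
Proof. by move=> hx hy a; rewrite linearP; apply: smL. Qed.
Definition comp_sm : submod Phi := @Submod R Phi _ comp_sm0 comp_smL.

Lemma comp_inj a x : P a x -> comp_sm (inj a x).
Proof.
move=> Px i; rewrite dcoord_dinj; case: (eqVneq a i) => [e|ne].
  by subst i; rewrite xfer_id.
by rewrite xfer_ne //; apply: sm0.
Qed.

Lemma comp_ind (W : lmodType R) (Q : submod W) (f : {linear Phi -> W}) :
  (forall a x, P a x -> Q (f (inj a x))) -> forall x, comp_sm x -> Q (f x).
Proof.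
by move=> h x Px; rewrite (dsumE x) linear_sum; apply: sm_sum => a; apply: h.
Qed.
End Comp.

Let PG := comp_sm G.
Let PH := comp_sm H.

Let sum_acyc : acyc D PG PH.
Proof.
move=> I dI g iI dIK gG gH.
have [|h hP] := @lchoice _ L (fun=> V) (fun=> I) (fun a h => (forall x, H a x -> h x = 0) /\
    (forall x, G a x -> g (inj a x) = dI (h x) + h (d x))).
  move=> a; have [x Gx|x Hx|h hP] := GHacyc (a := a) (dI := dI) (g := compl g (inj a)) iI dIK.
  - by rewrite /= -Dinj; apply: gG; apply: comp_inj.
  - by apply: gH; apply: comp_inj.
  - by exists h.
exists (dsum_map h); split.
  apply: (comp_ind (Q := eq_sm (dsum_map h) (zerol _ _)) (f := idl _)) => a x Hx /=.
  by rewrite dsum_mapE; apply: (hP a).1.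
apply: (comp_ind (Q := eq_sm g (addl (compl dI (dsum_map h)) (compl (dsum_map h) D))) (f := idl _)).
by move=> a x Gx /=; rewrite Dinj !dsum_mapE; apply: (hP a).2.
Qed.

(* kap b is the projection of Phi onto the span of the differences inj a x - inj b x with
   a < b, along the summands of index at least b. *)
Let kap b : {linear Phi -> Phi} :=
  dsum_map (fun a => if `[< le a b /\ a <> b >] then subl (inj a) (inj b) else zerol V Phi).

Let kap_lt a b x : le a b -> a <> b -> kap b (inj a x) = inj a x - inj b x.
Proof. by move=> ab ne; rewrite dsum_mapE; case: asboolP => // -[]. Qed.
Let kap_ge a b x : le b a -> kap b (inj a x) = 0.
Proof.
move=> ba; rewrite dsum_mapE; case: asboolP => // -[ab ne].
by case: ne; apply: (wo_anti w).
Qed.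
Let ltP a b : (le a b /\ a <> b) \/ le b a.
Proof.
have [?|?] := wo_total w a b; last by right.
by have [->|?] := pselect (a = b); [right; apply: wo_refl | left].
Qed.

Let kapD b x : kap b (D x) = D (kap b x).
Proof.
apply: (@dsum_ext _ _ _ _ (compl (kap b) D) (compl D (kap b))) => a y /=; rewrite Dinj.
have [[ab ne]|ba] := ltP a b; last by rewrite !kap_ge // linear0.
by rewrite !kap_lt // linearB !Dinj.
Qed.

Let kapK b c x : le b c -> kap c (kap b x) = kap b x.
Proof.
move=> bc; apply: (@dsum_ext _ _ _ _ (compl (kap c) (kap b)) (kap b)) => a y /=.
have [[ab ne]|ba] := ltP a b; last by rewrite !kap_ge // linear0.
rewrite kap_lt // linearB kap_lt; first 1 last.
- exact: wo_trans ab bc.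
- by move=> e; apply: ne; apply: (wo_anti w) => //; rewrite e.
have [[_ ne']|cb] := ltP b c; last by rewrite [kap c (inj b y)]kap_ge // subr0 (wo_anti w bc cb).
by rewrite kap_lt // opprB addrA subrK.
Qed.

Let kap_comp (P : L -> submod V) b :
  (forall a b x, le a b -> P a x -> P b x) -> forall x, comp_sm P x -> comp_sm P (kap b x).
Proof.
move=> mono; apply: comp_ind => a x Px.
have [[ab ne]|ba] := ltP a b; last by rewrite kap_ge //; apply: sm0.
by rewrite kap_lt //; apply: smB; apply: comp_inj => //; apply: mono Px.
Qed.

Let Dcomp (P : L -> submod V) :
  (forall a x, P a x -> P a (d x)) -> forall x, comp_sm P x -> comp_sm P (D x).
Proof. by move=> Pd; apply: comp_ind => a x /Pd Px; rewrite Dinj; apply: comp_inj. Qed.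

Let Kpred b (x : Phi) := exists y z, [/\ PG y, PH z & x = kap b y + z].
Let K0 b : Kpred b 0.
Proof. by exists 0, 0; rewrite linear0 addr0; split=> //; apply: sm0. Qed.
Let KL b k x y : Kpred b x -> Kpred b y -> Kpred b (k *: x + y).
Proof.
move=> [x1 [x2 [Gx Hx ->]]] [y1 [y2 [Gy Hy ->]]].
exists (k *: x1 + y1), (k *: x2 + y2); split; [exact: smL|exact: smL|].
by rewrite scalerDr linearP addrACA.
Qed.
Let K b : submod Phi := Submod (@K0 b) (@KL b).

Let HGc x : PH x -> PG x.
Proof. by move=> Hx a; apply: HG. Qed.

(* K b / PH is a retract of PG / PH, by means of kap b. *)
Let K_acyc b : acyc D (K b) PH.
Proof.
move=> I dI g iI dIK gK gH.
have [x Gx|x Hx|h [hH hG]] := @sum_acyc I dI (compl g (kap b)) iI dIK.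
- rewrite /= kapD; apply: gK; exists x, 0; rewrite addr0; split=> //; exact: sm0.
- by apply: gH; apply: kap_comp.
exists (compl h (kap b)); split=> x.
  by move=> Hx; apply: hH; apply: kap_comp.
move=> [y [z [Gy Hz ->]]] /=.
have Gk : PG (kap b y) by apply: kap_comp.
have bb : le b b by apply: wo_refl.
have kz : PH (kap b z) by apply: kap_comp.
have kDz : PH (kap b (D z)) by apply: kap_comp => //; apply: Dcomp.
have -> : h (kap b (kap b y + z)) = h (kap b y).
  by rewrite (linearD (kap b)) linearD (hH _ kz) addr0 kapK.
have -> : h (kap b (D (kap b y + z))) = h (D (kap b y)).
  by rewrite (linearD D) (linearD (kap b)) linearD (hH _ kDz) addr0 kapD kapK.
have := hG _ Gk; rewrite /= kapK // => <-.
by rewrite linearD (gH z) // addr0.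
Qed.

Let K_union : acyc D (fun x => exists b, K b x) PH.
Proof.
apply: (union_acyc DD w (K := K) (N := PH)) => //.
- move=> a b x ab [y [z [Gy Hz ->]]]; exists (kap a y), z; rewrite kapK //.
  by split=> //; apply: kap_comp.
- by move=> a x Hx; exists 0, x; rewrite linear0 add0r; split=> //; apply: sm0.
- move=> a x [y [z [Gy Hz ->]]]; exists (D y), (D z).
  by rewrite linearD kapD; split=> //; apply: Dcomp.
- by apply: Dcomp.
Qed.

(** The kernel of the sum map PG -> (union of G) / (union of H) is the union of the K b,
    so this quotient is PG modulo that union, and two-out-of-three applies. *)
Lemma limit_acyc : acyc d (fun x => exists a, G a x) (fun x => exists a, H a x).
Proof.
have Kacyc : acyc D PG (fun x => exists b, K b x).
  apply: acyc_quo sum_acyc K_union => //.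
    by move=> x Hx; exists l0, 0, x; rewrite linear0 add0r; split=> //; apply: sm0.
  move=> x [b [y [z [Gy Hz ->]]]]; apply: smD; first exact: kap_comp.
  exact: HGc.
move=> I dI g iI dIK gG gH.
pose s : {linear Phi -> V} := dsum_map (fun a => idl V).
have sinj a x : s (inj a x) = x by rewrite dsum_mapE.
have sD x : s (D x) = d (s x).
  by apply: (@dsum_ext _ _ _ _ (compl s D) (compl d s)) => a y /=; rewrite Dinj !sinj.
have skap b x : s (kap b x) = 0.
  apply: (@dsum_ext _ _ _ _ (compl s (kap b)) (zerol _ _)) => a y /=.
  have [[ab ne]|ba] := ltP a b; last by rewrite kap_ge // linear0.
  by rewrite kap_lt // linearB !sinj subrr.
have [x Gx|x [b [y [z [Gy Hz ->]]]]|h [hK hG]] := Kacyc I dI (compl g s) iI dIK.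
- rewrite /= sD.
  apply: (comp_ind (Q := eq_sm (compl dI g) (compl g d)) (f := s)) Gx => a y Gy /=.
  by rewrite sinj; apply: gG; exists a.
- rewrite /= linearD skap add0r.
  apply: (comp_ind (Q := eq_sm g (zerol _ _)) (f := s)) Hz => a t Ht /=.
  by rewrite sinj; apply: gH; exists a.
have dirG i j : exists k, (forall x, G i x -> G k x) /\ (forall x, G j x -> G k x).
  have [ij|ji] := wo_total w i j; first by exists j; split=> // x; apply: Gmono.
  by exists i; split=> // x; apply: Gmono.
(* On G i the maps h o inj i and h o inj j agree, as h vanishes on K j. *)
have hlt i j x : le i j -> i <> j -> G i x -> h (inj i x) = h (inj j x).
  move=> ij ne Gi; apply/eqP; rewrite -subr_eq0 -linearB -kap_lt //; apply/eqP.
  apply: hK; exists j, (inj i x), 0; rewrite addr0; split=> //; last exact: sm0.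
  exact: comp_inj.
have [i j x Gi Gj|k kP] := @glue _ _ _ G l0 dirG _ (fun a => compl h (inj a)) iI.
  rewrite /=; have [[ij ne]|ji] := ltP i j; first exact: hlt.
  by have [->//|ne] := pselect (j = i); rewrite (hlt j i).
exists k; split=> x [a ax].
  rewrite (kP a) /=; last exact: HG.
  apply: hK; exists a, 0, (inj a x); rewrite linear0 add0r; split=> //; first exact: sm0.
  exact: comp_inj.
have Gi : PG (inj a x) by apply: comp_inj.
rewrite (kP a) // (kP a) /=; last exact: Gd.
by rewrite -Dinj -hG //= sinj.
Qed.
End Limit.

Lemma wellorder_ex (T : eqType) : exists le : T -> T -> Prop, wellorder le.
Proof.
have [r wo] := @well_ordering_principle T.
have mn (P : T -> Prop) : (exists x, P x) -> exists x, P x /\ forall y, P y -> r x y.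
  move=> [x Px]; have [|z [[Pz zm] _]] := wo [pred x | `[< P x >]].
    by exists x; rewrite inE; apply/asboolP.
  exists z; split; first by move: Pz; rewrite inE => /asboolP.
  by move=> y Py; apply: zm; rewrite inE; apply/asboolP.
have un (P : T -> Prop) x y : P x -> P y -> (forall z, P z -> r x z) ->
    (forall z, P z -> r y z) -> x = y.
  move=> Px Py xm ym; have [|z [_ zu]] := wo [pred x | `[< P x >]].
    by exists x; rewrite inE; apply/asboolP.
  have h u : P u -> (forall z, P z -> r u z) -> z = u.
    move=> Pu um; apply: zu; split; first by rewrite inE; apply/asboolP.
    by move=> v; rewrite inE => /asboolP; apply: um.
  by rewrite -(h x) // -(h y).
have rr x : r x x by have [|z [-> h]] := mn (eq x); [exists x | apply: h].
have tot x y : r x y \/ r y x.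
  have [|z [[]-> h]] := mn (fun z => z = x \/ z = y); first by exists x; left.
    by left; apply: h; right.
  by right; apply: h; left.
have anti x y : r x y -> r y x -> x = y.
  move=> xy yx; apply: (un (fun z => z = x \/ z = y)); [by left|by right| |].
    by move=> z [->|->].
  by move=> z [->|->].
exists r; split => // x y z xy yz.
have [|u [[->|[->|->]] h]] := mn (fun u => u = x \/ u = y \/ u = z).
- by exists x; left.
- by apply: h; right; right.
- have e : x = y by apply: anti => //; apply: h; left.
  by rewrite e.
- have e : y = z by apply: anti => //; apply: h; right; left.
  by rewrite -e.
Qed.

Section Directed.
Local Open Scope fset_scope.
Context {R : pzRingType} {V : lmodType R} (d : {linear V -> V}).
Hypothesis dd : forall x, d (d x) = 0.
Context {P : choiceType} {le : P -> P -> Prop} (p0 : P).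
Hypothesis le_refl : forall p, le p p.
Hypothesis le_trans : forall p q r, le p q -> le q r -> le p r.
Hypothesis le_dir : forall p q, exists r, le p r /\ le q r.
Context (G H : P -> submod V).
Hypothesis Gmono : forall a b x, le a b -> G a x -> G b x.
Hypothesis Hmono : forall a b x, le a b -> H a x -> H b x.
Hypothesis HG : forall a x, H a x -> G a x.
Hypothesis Gd : forall a x, G a x -> G a (d x).
Hypothesis Hd : forall a x, H a x -> H a (d x).
Hypothesis GHacyc : forall a, acyc d (G a) (H a).

Let ub_ex (s : seq P) : exists p, forall q, q \in s -> le q p.
Proof.
elim: s => [|q s [p ih]]; first by exists p0.
have [r [qr pr]] := le_dir q p; exists r => u.
by rewrite inE => /orP[/eqP -> //|/ih up]; apply: le_trans pr.
Qed.
Let ub (s : seq P) : P := sval (cid (ub_ex s)).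
Let ubP s q : q \in s -> le q (ub s).
Proof. exact: (svalP (cid (ub_ex s))). Qed.

(** An upper bound of the finite set F that is monotone in F: it is chosen above the
    elements of F and above the bounds of all the sets obtained by removing one element.
    The first argument is the cardinal of F. *)
Fixpoint mono_ub_rec (n : nat) (F : {fset P}) : P :=
  ub (enum_fset F ++
    if n is k.+1 then [seq mono_ub_rec k (F `\ x) | x <- enum_fset F] else [::]).
Definition mono_ub F := mono_ub_rec #|` F| F.

Lemma mono_ub_ge F p : p \in F -> le p (mono_ub F).
Proof. by move=> pF; rewrite /mono_ub; case: #|` F| => [|n]; apply: ubP; rewrite mem_cat; apply/orP; left. Qed.

Lemma mono_ub_mono F F' : F' `<=` F -> le (mono_ub F') (mono_ub F).
Proof.
move: {2}(#|` F| - #|` F'|)%N (leqnn (#|` F| - #|` F'|)%N) => n.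
elim: n F F' => [|n ih] F F' hn sF.
  have/eqP -> : F' == F; last exact: le_refl.
  by rewrite eqEfcard sF /= -subn_eq0 -leqn0.
have [->|ne] := eqVneq F' F; first exact: le_refl.
have [x xF xF'] : exists2 x, x \in F & x \notin F'.
  have /fsubsetPn[x xF xF'] : ~~ (F `<=` F').
    by apply: contra ne => ?; rewrite eqEfsubset sF.
  by exists x.
have cF : #|` F| = #|` F `\ x|.+1 by rewrite (cardfsD1 x F) xF.
apply: (@le_trans _ (mono_ub (F `\ x))).
  apply: ih; first by move: hn; rewrite cF; case: #|` F'| => [|m]; rewrite ?subn0 ?subSS ?ltnS // => h; rewrite leq_subLR (leq_trans (n := (m + n).+1)) //; move: h; rewrite leq_subLR addnS.
  by rewrite fsubsetD1 sF.
rewrite [X in le _ X]/mono_ub cF /=; apply: ubP; rewrite mem_cat; apply/orP; right.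
by apply/mapP; exists x.
Qed.

Let sub (F : {fset P}) (X : P -> Prop) := forall x, x \in F -> X x.

Let subU F F' X : sub F X -> sub F' X -> sub (F `|` F') X.
Proof. by move=> h h' x; rewrite inE => /orP[/h|/h']. Qed.

(* For a set X of indices, lsm Q X is the union of the Q (mono_ub F) over the finite parts F
   of X.  Unlike a union over X itself, it makes sense for all X, and it commutes with
   unions of chains. *)
Section LU.
Context (Q : P -> submod V) (Qmono : forall a b x, le a b -> Q a x -> Q b x) (X : P -> Prop).
Definition lpred (x : V) := exists2 F, sub F X & Q (mono_ub F) x.
Fact lsm0 : lpred 0.
Proof. by exists fset0 => //; apply: sm0. Qed.
Fact lsmL a x y : lpred x -> lpred y -> lpred (a *: x + y).
Proof.
move=> [F FX Fx] [F' FX' Fy]; exists (F `|` F'); first exact: subU.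
apply: smL; first by apply: Qmono Fx; apply: mono_ub_mono; apply: fsubsetUl.
by apply: Qmono Fy; apply: mono_ub_mono; apply: fsubsetUr.
Qed.
Definition lsm : submod V := Submod lsm0 lsmL.
End LU.

Lemma lsm_sub (Q : P -> submod V) Qm (X Y : P -> Prop) x : (forall p, X p -> Y p) ->
  @lsm Q Qm X x -> @lsm Q Qm Y x.
Proof. by move=> XY [F FX Fx]; exists F => // p /FX /XY. Qed.

Let LG := lsm Gmono.
Let LH := lsm Hmono.

Lemma lsm_acyc_fin (F : {fset P}) : acyc d (LG [in F]) (LH [in F]).
Proof.
have e (Q : P -> submod V) Qm x : Q (mono_ub F) x <-> @lsm Q Qm [in F] x.
  split=> [h|[F' sF Fx]]; first by exists F.
  by apply: Qm Fx; apply: mono_ub_mono; apply/fsubsetP => p /sF.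
by apply: acyc_ext (@GHacyc (mono_ub F)) => x; apply: e.
Qed.

Section Step.
Context {lw : P -> P -> Prop} (w : wellorder lw) (J : P -> Prop) (F : {fset P}).
Let below b p := lw p b \/ p \in F.

Lemma fin_below (s : seq P) : (exists b, J b) -> (forall x, x \in s -> J x \/ x \in F) ->
  exists2 b, J b & forall x, x \in s -> below b x.
Proof.
move=> [b0 Jb0]; elim: s => [|p s ih] hs; first by exists b0.
have [|b Jb bP] := ih; first by move=> x xs; apply: hs; rewrite inE xs orbT.
have [Jp|Fp] := hs p (mem_head _ _); last first.
  by exists b => // x; rewrite inE => /orP[/eqP -> |/bP //]; right.
have [pb|bp] := wo_total w p b.
  by exists b => // x; rewrite inE => /orP[/eqP -> |/bP //]; left.
exists p => // x; rewrite inE => /orP[/eqP -> |/bP]; first by left; apply: wo_refl.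
by case; [left; apply: wo_trans bp | right].
Qed.

(** Writing J as the increasing union of the initial segments below its elements b turns
    the pair of index set J together with F into the colimit of a well-ordered system. *)
Lemma lsm_acyc_step : (exists b, J b) ->
  (forall b, J b -> acyc d (LG (below b)) (LH (below b))) ->
  (forall a b, lw a b -> J b -> J a) ->
  acyc d (LG (fun p => J p \/ p \in F)) (LH (fun p => J p \/ p \in F)).
Proof.
move=> [b0 Jb0] aJ dJ.
pose L : eqType := {classic {b | J b}}.
pose lL (a b : L) := lw (sval a) (sval b).
have wL : wellorder lL.
  split; rewrite /lL.
  - by move=> x; apply: wo_refl.
  - by move=> x y z; apply: wo_trans.
  - move=> [x Jx] [y Jy] /= xy yx; have e := wo_anti w xy yx; subst y.
    by rewrite (Prop_irrelevance Jx Jy).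
  - by move=> x y; apply: wo_total.
  - move=> Q [x Qx]; case: x Qx => x Jx Qx; have [|z [[Jz Qz] zm]] := wo_min w (P := fun b => exists Jb : J b, Q (exist _ b Jb)).
      by exists x; exists Jx.
    by exists (exist _ z Jz); split=> // -[y Jy] Qy; apply: zm; exists Jy.
have bm (a b : L) p : lL a b -> below (sval a) p -> below (sval b) p.
  by move=> ab [pa|Fp]; [left; exact: (wo_trans w pa ab) | right].
have e (Q : P -> submod V) Qm x : (exists a : L, @lsm Q Qm (below (sval a)) x) <->
                @lsm Q Qm (fun p => J p \/ p \in F) x.
  split.
    move=> [a]; apply: lsm_sub => p [pa|]; last by right.
    by left; apply: dJ pa (svalP a).
  move=> [F' F'J Fx]; have [b Jb bP] := fin_below (ex_intro _ b0 Jb0) F'J.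
  by exists (exist _ b Jb); exists F'.
apply: acyc_ext (@limit_acyc _ _ d dd L lL wL (exist _ b0 Jb0)
   (fun a => LG (below (sval a))) (fun a => LH (below (sval a))) _ _ _ _ _ _).
- by move=> x; apply: e.
- by move=> x; apply: e.
- by move=> a b x /bm ab; apply: lsm_sub => p /ab.
- by move=> a b x /bm ab; apply: lsm_sub => p /ab.
- by move=> a x [F' ? Fx]; exists F' => //; apply: HG.
- by move=> a x [F' ? Fx]; exists F' => //; apply: Gd.
- by move=> a x [F' ? Fx]; exists F' => //; apply: Hd.
- by move=> a; apply: aJ; apply: svalP.
Qed.
End Step.

(** Well-order the indices and show by induction on b that, for every finite F, the pair
    attached to the indices up to b and to F is acyclic.  Allowing a finite set F makes
    the passage from the indices below b to those up to b trivial: b is put into F. *)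
Lemma directed_acyc : acyc d (fun x => exists p, G p x) (fun x => exists p, H p x).
Proof.
have [lw w] := wellorder_ex P.
have below_acyc b : forall F : {fset P}, acyc d (LG (fun p => lw p b \/ p \in F))
    (LH (fun p => lw p b \/ p \in F)).
  apply: (wo_ind w (P := fun b => forall F : {fset P}, acyc d (LG (fun p => lw p b \/ p \in F))
    (LH (fun p => lw p b \/ p \in F)))) b => b ih F.
  have e (Q : P -> submod V) Qm x : @lsm Q Qm (fun p => (lw p b /\ p <> b) \/ p \in b |` F) x <->
                  @lsm Q Qm (fun p => lw p b \/ p \in F) x.
    split; apply: lsm_sub => p; rewrite !inE.
      by case=> [[]|/orP[/eqP ->|]]; [left|left; apply: wo_refl|right].
    case=> [pb|->]; last by right; rewrite orbT.
    by have [->|ne] := pselect (p = b); [right; rewrite eqxx | left].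
  (* If b is the least index, then only the finite set b |` F remains. *)
  have [ex|nex] := pselect (exists c, lw c b /\ c <> b).
    apply: acyc_ext (lsm_acyc_step w (F := b |` F) ex _ _).
    - by move=> x; apply: e.
    - by move=> x; apply: e.
    - by move=> c [cb ne]; apply: ih.
    - move=> a c ac [cb ne]; split; first exact: wo_trans ac cb.
      by move=> ea; subst a; apply: ne; apply: wo_anti w _ _ cb ac.
  apply: acyc_ext (@lsm_acyc_fin (b |` F)).
    move=> x; rewrite -e; split; apply: lsm_sub => p; first by right.
    by case=> // pb; case: nex; exists p.
  move=> x; rewrite -e; split; apply: lsm_sub => p; first by right.
  by case=> // pb; case: nex; exists p.
have e (Q : P -> submod V) Qm x : @lsm Q Qm (fun p => True \/ p \in fset0) x <-> exists p, Q p x.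
  split=> [[F _ Fx]|[p px]]; first by exists (mono_ub F).
  exists [fset p]; first by left.
  by apply: Qm px; apply: mono_ub_ge; rewrite inE.
apply: acyc_ext (lsm_acyc_step w (J := fun=> True) (F := fset0) _ _ _) => //.
- by move=> x; apply: e.
- by move=> x; apply: e.
Qed.
End Directed.

(** * Constructions on complexes; disks *)
Section Basics.
Context {R : pzRingType}.
Implicit Types C D Y : complex R.

Lemma cdiff_xfer C k m (x : C k) :
  cdiff C m (xfer C k m x) = xfer C (k - 1) (m - 1) (cdiff C k x).
Proof.
case: (eqVneq k m) => [e|ne]; first by subst m; rewrite !xfer_id.
by rewrite !xfer_ne ?linear0 // (inj_eq (addIr _)).
Qed.

Lemma cdiff_xfer_cdiff C k n (x : C k) : cdiff C n (xfer C (k - 1) n (cdiff C k x)) = 0.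
Proof. by rewrite cdiff_xfer cdiffK linear0. Qed.

Definition ccomp C D Y (g : chain_map D Y) (f : chain_map C D) : chain_map C Y.
Proof.
exists (fun n => compl (g n) (f n)) => n x /=.
by rewrite !cmapC.
Defined.

Definition czero C D : chain_map C D :=
  @ChainMap R C D (fun n => zerol (C n) (D n)) (fun n x => esym (linear0 (cdiff D n))).

Section SubCx.
Context (C : complex R) (P : forall n, submod (C n)).
Hypothesis Pd : forall n (x : C n), P n x -> P (n - 1) (cdiff C n x).
Fact subcx_diffP n (x : subT (P n)) : P (n - 1) (compl (cdiff C n) (sub_val (P n)) x).
Proof. by apply: Pd; apply: sub_valP. Qed.
Definition subcx : complex R.
Proof.
exists (fun n => subT (P n) : lmodType R) (fun n => corestr (@subcx_diffP n)) => n x.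
by apply: sub_val_inj; rewrite corestrE /= corestrE /= cdiffK linear0.
Defined.
Definition subcx_incl : chain_map subcx C.
Proof. by exists (fun n => sub_val (P n)) => n x; rewrite corestrE. Defined.

Lemma subcx_inclP n (x : subcx n) : P n (subcx_incl n x).
Proof. exact: sub_valP. Qed.
Lemma subcx_incl_inj n : injective (subcx_incl n).
Proof. exact: sub_val_inj. Qed.
Lemma subcx_incl_ex n (x : C n) : P n x -> exists y, subcx_incl n y = x.
Proof. by move=> Px; exists (sub_mk Px); apply: sub_mkK. Qed.
End SubCx.

Section QuoCx.
Context (C : complex R) (P : forall n, submod (C n)).
Hypothesis Pd : forall n (x : C n), P n x -> P (n - 1) (cdiff C n x).
Fact quocx_diff_ex n : exists f : {linear quoT (P n) -> quoT (P (n - 1))},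
  forall x, f (quo_pi (P n) x) = quo_pi (P (n - 1)) (cdiff C n x).
Proof.
apply: (factor_surj (f := compl (quo_pi (P (n - 1))) (cdiff C n))).
  exact: quo_pi_surj.
by move=> x /quo_piP /Pd h /=; apply/quo_piP.
Qed.
Definition quocx_diff n := projT1 (cid (quocx_diff_ex n)).
Lemma quocx_diffE n x : quocx_diff n (quo_pi (P n) x) = quo_pi (P (n - 1)) (cdiff C n x).
Proof. exact: (projT2 (cid (quocx_diff_ex n))). Qed.
Definition quocx : complex R.
Proof.
exists (fun n => quoT (P n) : lmodType R) quocx_diff => n x.
by have [y <-] := quo_pi_surj x; rewrite !quocx_diffE cdiffK linear0.
Defined.
Definition quocx_pi : chain_map C quocx.
Proof. by exists (fun n => quo_pi (P n)) => n x; rewrite [RHS]quocx_diffE. Defined.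
Lemma quocx_pi_surj : csurjective quocx_pi.
Proof. by move=> n; apply: quo_pi_surj. Qed.
Lemma quocx_piP n x : quocx_pi n x = 0 <-> P n x.
Proof. exact: quo_piP. Qed.
End QuoCx.

Lemma cfactor_surj C D Y (p : chain_map C D) (f : chain_map C Y) : csurjective p ->
  (forall n x, p n x = 0 -> f n x = 0) ->
  exists g : chain_map D Y, forall n x, g n (p n x) = f n x.
Proof.
move=> ps pf.
have [g gP] := @lchoice _ _ (fun n => D n) (fun n => Y n) (fun n g => forall x, g (p n x) = f n x)
  (fun n => factor_surj (ps n) (pf n)).
have gC n x : g (n - 1) (cdiff D n x) = cdiff Y n (g n x).
  by have [y <-] := ps n x; rewrite -cmapC !gP cmapC.
by exists (ChainMap gC).
Qed.

Lemma cfactor_inj C D Y (i : chain_map C D) (f : chain_map Y D) : cinjective i ->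
  (forall n x, exists y, i n y = f n x) ->
  exists g : chain_map Y C, forall n x, i n (g n x) = f n x.
Proof.
move=> ii fi.
have [g gP] := @lchoice _ _ (fun n => Y n) (fun n => C n) (fun n g => forall x, i n (g x) = f n x)
  (fun n => factor_inj (ii n) (fi n)).
have gC n x : g (n - 1) (cdiff Y n x) = cdiff C n (g n x).
  by apply: (ii (n - 1)); rewrite cmapC !gP cmapC.
by exists (ChainMap gC).
Qed.

Section Kernel.
Context {C D : complex R} (f : chain_map C D).
Definition ker_sm n : submod (C n) := eq_sm (f n) (zerol (C n) (D n)).
Fact ker_smd n (x : C n) : ker_sm n x -> ker_sm (n - 1) (cdiff C n x).
Proof. by rewrite /= => h; rewrite cmapC h linear0. Qed.
Definition kercx : complex R := subcx ker_smd.
Definition kercx_incl : chain_map kercx C := subcx_incl ker_smd.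
Lemma kercx_is_kernel : cis_kernel kercx_incl f.
Proof.
split=> n; first exact: subcx_incl_inj.
move=> y; split; last by move=> [x <-]; have h := subcx_inclP (P := ker_sm) x; exact: h.
by move=> h; apply: (subcx_incl_ex ker_smd).
Qed.
End Kernel.

Section Disk.
Context (M : int -> lmodType R).
Fact diskf_linear n : linear (fun x : M n * M (n - 1) => (x.2, 0) : (M (n - 1) * M (n - 1 - 1))%type).
Proof. by move=> a x y; congr pair => /=; rewrite scaler0 addr0. Qed.
(** The sum over n of the disks on M (n - 1) in degrees n and n - 1, where M (n - 1)
    generates freely in degree n.  Indexing by n - 1 makes the differential a map of
    pairs without any cast. *)
Definition diskf : complex R.
Proof.
exists (fun n => (M n * M (n - 1))%type : lmodType R) (fun n => lin_of (@diskf_linear n)) => n x.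
by rewrite !lin_ofE.
Defined.
Lemma diskf_diff n (x : diskf n) : cdiff diskf n x = (x.2, 0).
Proof. by rewrite lin_ofE. Qed.

Fact disk_gen_linear n : linear (fun y : M (n - 1) => (0, y) : (M n * M (n - 1))%type).
Proof. by move=> a x y; congr pair => /=; rewrite scaler0 addr0. Qed.
Definition disk_gen n : {linear M (n - 1) -> diskf n} := lin_of (@disk_gen_linear n).
Lemma disk_genE n y : disk_gen n y = (0, y).
Proof. by rewrite lin_ofE. Qed.

Fact disk_bd_linear n : linear (fun x : M n => (x, 0) : (M n * M (n - 1))%type).
Proof. by move=> a x y; congr pair => /=; rewrite scaler0 addr0. Qed.
Definition disk_bd n : {linear M n -> diskf n} := lin_of (@disk_bd_linear n).
Lemma disk_bdE n x : disk_bd n x = (x, 0).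
Proof. by rewrite lin_ofE. Qed.
Lemma disk_split n (x : diskf n) : x = disk_gen n x.2 + disk_bd n x.1.
Proof. by rewrite disk_genE disk_bdE; case: x => a b; congr pair; rewrite /= ?add0r ?addr0. Qed.

Section In.
Context {Y : complex R} (g : forall n, {linear Y n -> M n}).
Fact disk_in_linear n : linear (fun x : Y n => (g n x, g (n - 1) (cdiff Y n x))).
Proof. by move=> a x y; rewrite !linearP. Qed.
Definition disk_in : chain_map Y diskf.
Proof.
exists (fun n => lin_of (@disk_in_linear n)) => n x.
by rewrite diskf_diff !lin_ofE /= cdiffK linear0.
Defined.
Lemma disk_inE n x : disk_in n x = (g n x, g (n - 1) (cdiff Y n x)).
Proof. by rewrite lin_ofE. Qed.
End In.

Lemma disk_in_eq Y (f : chain_map Y diskf) n x : f n x = ((f n x).1, (f (n - 1) (cdiff Y n x)).1).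
Proof. by rewrite cmapC diskf_diff /= -surjective_pairing. Qed.

Section Out.
Context {Y : complex R} (g : forall n, {linear M (n - 1) -> Y n}).
Definition disk_out_fun n : {linear diskf n -> Y n} :=
  addl (compl (g n) (sndl (M n) (M (n - 1))))
       (compl (xfer Y (n + 1 - 1) n) (compl (cdiff Y (n + 1)) (compl (g (n + 1))
          (compl (xfer M n (n + 1 - 1)) (fstl (M n) (M (n - 1))))))).
(** The chain map determined by the images of the generators; an element (x, 0) is the
    boundary of the generator (0, x) one degree higher, which is where the transports
    between degrees n and n + 1 - 1 come from. *)
Definition disk_out : chain_map diskf Y.
Proof.
exists disk_out_fun => n x; rewrite diskf_diff /= linear0 add0r linearD cdiff_xfer_cdiff addr0.
have aux j (e : j = n) (y : M (n - 1)) :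
    xfer Y (j - 1) (n - 1) (cdiff Y j (g j (xfer M (n - 1) (j - 1) y))) = cdiff Y n (g n y).
  by subst j; rewrite !xfer_id.
by apply: aux; rewrite subrK.
Defined.
Lemma disk_outE n y : disk_out n (0, y) = g n y.
Proof. by rewrite /= !linear0 addr0. Qed.
End Out.

Lemma disk_out_ext Y (f h : chain_map diskf Y) :
  (forall n (y : M (n - 1)), f n (0, y) = h n (0, y)) -> forall n x, f n x = h n x.
Proof.
move=> e n [x y].
have -> : (x, y) = (0, y) + (x, 0) :> diskf n by congr pair; rewrite /= ?addr0 ?add0r.
rewrite !linearD e; congr (_ + _).
have [j ej] : exists j, j - 1 = n by exists (n + 1); rewrite addrK.
subst n.
have -> : (x, 0) = cdiff diskf j (0, x) by rewrite diskf_diff.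
by rewrite !cmapC e.
Qed.

(** Chain maps to a disk are arbitrary families of maps to the M n. *)
Lemma disk_injective : (forall n, injective_module (M n)) -> injective_complex diskf.
Proof.
move=> iM A B i f ii.
have [g gP] := @lchoice _ _ (fun n => B n) M
  (fun n g => forall x, g (i n x) = compl (fstl _ _) (f n : {linear A n -> (M n * M (n-1))%type}) x)
  (fun n => iM n _ _ (i n) (compl (fstl _ _) (f n : {linear A n -> (M n * M (n-1))%type})) (ii n)).
exists (disk_in g) => n x; rewrite disk_inE -cmapC !gP /=.
by rewrite [RHS]disk_in_eq.
Qed.

(** Chain maps out of a disk are arbitrary families of maps from the M (n - 1). *)
Lemma disk_projective : (forall n, projective_module (M n)) -> projective_complex diskf.
Proof.
move=> pM A B p f ps.
have [g gP] := @lchoice _ _ (fun n => M (n - 1)) (fun n => A n)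
  (fun n g => forall x, p n (g x) = compl (f n) (disk_gen n) x)
  (fun n => pM (n - 1) _ _ (p n) (compl (f n) (disk_gen n)) (ps n)).
exists (disk_out g); apply: (disk_out_ext (f := ccomp p (disk_out g)) (h := f)) => n y /=.
by rewrite -[X in p n X]/(disk_out g n (0, y)) disk_outE gP /= disk_genE.
Qed.
End Disk.

End Basics.

(** * Free complexes, projective resolutions and Ext^1 *)
Section Cells.
Context {R : pzRingType} {S : eqType} (deg : S -> int).

(** The free module on the symbols s (cgen) and their boundaries (cbd), all degrees
    together: the total module of the sum of the disks on the generators s. *)
Definition cells : lmodType R := freemod R (S * bool)%type.
Definition cgen (s : S) : cells := fbase (s, false).
Definition cbd (s : S) : cells := fbase (s, true).
Definition cmapl (N : lmodType R) (u v : S -> N) : {linear cells -> N} :=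
  freemod_map (fun b => if b.2 then v b.1 else u b.1).
Lemma cmapl_gen (N : lmodType R) (u v : S -> N) s : cmapl u v (cgen s) = u s.
Proof. by rewrite freemod_mapE. Qed.
Lemma cmapl_bd (N : lmodType R) (u v : S -> N) s : cmapl u v (cbd s) = v s.
Proof. by rewrite freemod_mapE. Qed.
Lemma cells_ext (N : lmodType R) (f g : {linear cells -> N}) :
  (forall s, f (cgen s) = g (cgen s)) -> (forall s, f (cbd s) = g (cbd s)) ->
  forall x, f x = g x.
Proof. by move=> e1 e2; apply: freemod_ext => -[s []]; [exact: e2 | exact: e1]. Qed.

Definition cd : {linear cells -> cells} := cmapl cbd (fun=> 0).
Lemma cd_gen s : cd (cgen s) = cbd s. Proof. exact: cmapl_gen. Qed.
Lemma cd_bd s : cd (cbd s) = 0. Proof. exact: cmapl_bd. Qed.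
Lemma cdK x : cd (cd x) = 0.
Proof.
by apply: (cells_ext (f := compl cd cd) (g := zerol _ _)) => s /=; rewrite ?cd_gen ?cd_bd ?linear0.
Qed.

Section Part.
Context (D : pred S).
(** The component of degree n of the part spanned by the cells of D. *)
Definition cproj n : {linear cells -> cells} :=
  cmapl (fun s => if D s && (deg s == n) then cgen s else 0)
        (fun s => if D s && (deg s - 1 == n) then cbd s else 0).
Lemma cproj_gen n s : cproj n (cgen s) = if D s && (deg s == n) then cgen s else 0.
Proof. exact: cmapl_gen. Qed.
Lemma cproj_bd n s : cproj n (cbd s) = if D s && (deg s - 1 == n) then cbd s else 0.
Proof. exact: cmapl_bd. Qed.

Lemma cprojK n x : cproj n (cproj n x) = cproj n x.
Proof.
apply: (cells_ext (f := compl (cproj n) (cproj n)) (g := cproj n)) => s /=.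
  by rewrite cproj_gen; case: ifP => [h|]; rewrite ?cproj_gen ?h ?linear0.
by rewrite cproj_bd; case: ifP => [h|]; rewrite ?cproj_bd ?h ?linear0.
Qed.

Lemma cproj_d n x : cproj (n - 1) (cd x) = cd (cproj n x).
Proof.
apply: (cells_ext (f := compl (cproj (n - 1)) cd) (g := compl cd (cproj n))) => s /=.
  rewrite cd_gen cproj_bd cproj_gen (inj_eq (addIr _)).
  by case: ifP => h; rewrite ?cd_gen ?linear0.
by rewrite cd_bd cproj_bd linear0; case: ifP => h; rewrite ?cd_bd ?linear0.
Qed.

Definition csm n : submod cells := eq_sm (cproj (n - 1)) (idl cells).

Fact cellcx_diffP n (x : subT (csm n)) : csm (n - 1) (oppl (compl cd (sub_val (csm n))) x).
Proof. by rewrite /= linearN cproj_d (sub_valP x). Qed.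
(** The free complex on the cells of D, shifted: the cell s sits in degree deg s + 1 and
    the differential is - cd.  The shift is the one needed in cell_extend. *)
Definition cellcx : complex R.
Proof.
exists (fun n => subT (csm n) : lmodType R) (fun n => corestr (@cellcx_diffP n)) => n x.
by apply: sub_val_inj; rewrite corestrE /= corestrE /= (linearN cd) cdK !oppr0 linear0.
Defined.
Definition cval n : {linear cellcx n -> cells} := sub_val (csm n).
Arguments cval {n}.
Lemma cval_inj n : injective (cval (n := n)).
Proof. exact: sub_val_inj. Qed.
Lemma cval_d n x : cval (cdiff cellcx n x) = - cd (cval x).
Proof. by rewrite /cval corestrE. Qed.
Lemma cvalP n (x : cellcx n) : cproj (n - 1) (cval x) = cval x.
Proof. exact: (sub_valP x). Qed.

Fact cret_fact n x : csm n (cproj (n - 1) x).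
Proof. exact: cprojK. Qed.
Definition cret n : {linear cells -> cellcx n} := corestr (@cret_fact n).
Lemma cretE n x : cval (cret n x) = cproj (n - 1) x.
Proof. exact: corestrE. Qed.
Lemma cretK n (x : cellcx n) : cret n (cval x) = x.
Proof. by apply: cval_inj; rewrite cretE cvalP. Qed.

Lemma cret_gen_ne n s : ~~ (D s && (deg s + 1 == n)) -> cret n (cgen s) = 0.
Proof.
move=> h; apply: cval_inj; rewrite cretE cproj_gen linear0 -(inj_eq (addIr 1)) subrK.
by rewrite (negbTE h).
Qed.
Lemma cret_bd_ne n s : ~~ (D s && (deg s == n)) -> cret n (cbd s) = 0.
Proof.
move=> h; apply: cval_inj; rewrite cretE cproj_bd linear0 (inj_eq (addIr _)).
by rewrite (negbTE h).
Qed.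
Lemma cret_bd j s : deg s = j - 1 -> cret (j - 1) (cbd s) = - cdiff cellcx j (cret j (cgen s)).
Proof.
move=> e; apply: cval_inj; rewrite linearN cval_d !cretE opprK cproj_bd cproj_gen e.
by rewrite !eqxx !andbT; case: ifP; rewrite ?cd_gen ?linear0.
Qed.

Section Out.
Context {Y : complex R} (y : forall s, Y (deg s + 1)).
Definition cell_lin n : {linear cells -> Y n} :=
  cmapl (fun s => xfer Y (deg s + 1) n (y s))
        (fun s => - xfer Y (deg s + 1 - 1) n (cdiff Y (deg s + 1) (y s))).
Lemma cell_lin_d n x : cell_lin (n - 1) (- cd x) = cdiff Y n (cell_lin n x).
Proof.
apply: (cells_ext (f := compl (cell_lin (n - 1)) (oppl cd)) (g := compl (cdiff Y n) (cell_lin n))) => s /=.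
  by rewrite cd_gen linearN cmapl_bd cmapl_gen opprK cdiff_xfer.
by rewrite cd_bd cmapl_bd oppr0 linear0 linearN cdiff_xfer_cdiff oppr0.
Qed.
Definition cell_out : chain_map cellcx Y.
Proof.
exists (fun n => compl (cell_lin n) (cval (n := n))) => n x /=.
by rewrite cval_d cell_lin_d.
Defined.
Lemma cell_outE s : D s -> cell_out (deg s + 1) (cret (deg s + 1) (cgen s)) = y s.
Proof. by move=> Ds; rewrite /= cretE cproj_gen Ds addrK eqxx cmapl_gen xfer_id. Qed.
End Out.

Lemma cell_lift_ext (Y : complex R) (f g : chain_map cellcx Y) :
  (forall s, D s -> f (deg s + 1) (cret (deg s + 1) (cgen s)) = g (deg s + 1) (cret (deg s + 1) (cgen s))) ->
  forall n x, f n x = g n x.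
Proof.
move=> e n x; rewrite -(cretK x).
apply: (cells_ext (f := compl (f n) (cret n)) (g := compl (g n) (cret n))) => s /=.
  have [/andP[Ds /eqP en]|/cret_gen_ne ->] := boolP (D s && (deg s + 1 == n)); last by rewrite !linear0.
  by subst n; apply: e.
have [/andP[Ds /eqP en]|/cret_bd_ne ->] := boolP (D s && (deg s == n)); last by rewrite !linear0.
have [j ej] : exists j, j = deg s + 1 by exists (deg s + 1).
have ej' : n = j - 1 by rewrite ej en addrK.
rewrite ej' cret_bd; last by rewrite -ej'.
by rewrite !linearN !cmapC ej e.
Qed.

Lemma cell_projective : projective_complex cellcx.
Proof.
move=> A B p f ps.
have [y yP] := choice_dep (fun s => ps (deg s + 1) (f _ (cret (deg s + 1) (cgen s)))).
exists (cell_out y).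
apply: (cell_lift_ext (f := ccomp p (cell_out y))) => s Ds /=.
by rewrite -yP -[X in p _ X = _]/(cell_out y _ _) cell_outE.
Qed.
End Part.
End Cells.
Arguments cells R S : clear implicits.
Arguments cval {R S deg D n}.

Section Cover.
Context {R : pzRingType}.

Definition celts (M : complex R) : eqType := {classic {n : int & M n}}.
Definition covdeg (M : complex R) (s : celts M) : int := tag s - 1.
(** One cell for each homogeneous element of M; subtracting 1 undoes the shift of
    cellcx. *)
Definition cover (M : complex R) : complex R := @cellcx R (celts M) (@covdeg M) predT.
Definition cover_map (M : complex R) : chain_map (cover M) M :=
  cell_out predT (fun s : celts M => xfer M (tag s) (covdeg s + 1) (tagged s)).
Lemma cover_surj (M : complex R) : csurjective (cover_map M).
Proof.
move=> n x; pose s : celts M := Tagged (fun k => M k) x.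
have aux j (e : j = n) : exists z, cover_map M j z = xfer M n j x -> exists z, cover_map M n z = x.
  by subst j; exists 0 => h; exists 0; rewrite h xfer_id.
have e : covdeg s + 1 = n by rewrite /covdeg subrK.
have h := cell_outE (fun s : celts M => xfer M (tag s) (covdeg s + 1) (tagged s)) (D := predT) (s := s) isT.
have : exists z, cover_map M (covdeg s + 1) z = xfer M n (covdeg s + 1) x by eexists; exact: h.
by move: e; move: (covdeg s + 1) => j e; subst j => -[z zP]; exists z; rewrite zP xfer_id.
Qed.
Lemma cover_projective (M : complex R) : projective_complex (cover M).
Proof. exact: cell_projective. Qed.

Section Resolution.
Context (C P0 K : complex R) (p : chain_map P0 C) (i : chain_map K P0).
Hypothesis projP0 : projective_complex P0.
Hypothesis p_surj : csurjective p.
Hypothesis iker : cis_kernel i p.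

Fixpoint syz (n : nat) : complex R := if n is k.+1 then kercx (cover_map (syz k)) else K.
Definition res_obj (n : nat) : complex R := if n is k.+1 then cover (syz k) else P0.
Definition res_diff (n : nat) : chain_map (res_obj n.+1) (res_obj n) :=
  match n with
  | 0 => ccomp i (cover_map K)
  | k.+1 => ccomp (kercx_incl (cover_map (syz k))) (cover_map (syz k.+1))
  end.

Lemma cexact_comp (A B D M : complex R) (q : chain_map A M) (j : chain_map M B) (f : chain_map B D) :
  csurjective q -> cis_kernel j f -> cexact_at (ccomp j q) f.
Proof.
move=> qs [ji je] n y; rewrite (je n y); split=> [[x <-]|[x <-]].
  by have [z <-] := qs n x; exists z.
by exists (q n x).
Qed.

Lemma res_proj n : projective_complex (res_obj n).
Proof. by case: n => [|n]; [apply: projP0 | apply: cover_projective]. Qed.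
Lemma res_exact n : cexact_at (res_diff n.+1) (res_diff n).
Proof.
have kercomp (A B D : complex R) (f : chain_map A B) (g : chain_map B D) (E : complex R)
    (k : chain_map E A) : cinjective g -> cexact_at k f -> cexact_at k (ccomp g f).
  move=> gi ke m y; rewrite -(ke m y); split=> [/= h|/= ->]; last by rewrite linear0.
  by apply: (gi m); rewrite linear0.
case: n => [|n]; apply: kercomp.
- by case: iker.
- by apply: cexact_comp; [apply: cover_surj | apply: kercx_is_kernel].
- by case: (kercx_is_kernel (cover_map (syz n))).
- by apply: cexact_comp; [apply: cover_surj | apply: kercx_is_kernel].
Qed.

Definition resolution : cprojective_resolution C :=
  @CProjRes R C res_obj res_diff p res_proj p_surj (cexact_comp (cover_surj (M := K)) iker) res_exact.

(** If Ext^1(C, A) = 0 and K is the kernel of a projective presentation P0 -> C, then all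
    maps K -> A extend to P0: continue P0 -> C to a projective resolution whose first
    term covers K. *)
Lemma cExt1_extend (A : complex R) (t : chain_map K A) : cExt1_eq0 C A ->
  exists g : chain_map P0 A, forall n x, g n (i n x) = t n x.
Proof.
move=> /(_ resolution (ccomp t (cover_map K))) [n x|g gP].
  have h : cover_map K n (cpdiff resolution 1 n x) = 0.
    by apply: (subcx_inclP (P := ker_sm (cover_map K))).
  exact: (etrans (congr1 (t n) h) (linear0 _)).
exists g => n x; have [z <-] := cover_surj x.
exact: gP.
Qed.
End Resolution.
End Cover.

(** * Finitely presented complexes *)
Section FPCriterion.
Context {R : pzRingType}.

Section DirectLimit.
Context {I : Type} {le : I -> I -> Prop} {S : direct_system R le} {L : complex R}
  (c : forall i : I, chain_map (S i) L).
Hypothesis dir : directed le.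
Hypothesis lim : direct_limit c.

(** Otherwise the zero map and the projection of L onto the quotient by the images of
    the stages would be two different maps extending the zero cocone. *)
Lemma dlim_surj n (y : L n) : exists i x, c i n x = y.
Proof.
have [[i0] lr lt ld] := dir; have [cc lu] := lim.
have P0 m : exists i (x : S i m), c i m x = 0 by exists i0, 0; rewrite linear0.
have PL m a (u v : L m) : (exists i x, c i m x = u) -> (exists i x, c i m x = v) ->
    exists i x, c i m x = a *: u + v.
  move=> [i [x <-]] [j [z <-]]; have [k [ik jk]] := ld i j.
  by exists k, (a *: smap S ik m x + smap S jk m z); rewrite linearP !cc.
pose P m : submod (L m) := @Submod R (L m) (fun u => exists i x, c i m x = u) (P0 m) (PL m).
have Pd m u : P m u -> P (m - 1) (cdiff L m u).
  by move=> [i [x <-]]; exists i, (cdiff (S i) m x); rewrite cmapC.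
pose z := czero L (quocx Pd).
have zc i m x : z m (c i m x) = 0 by [].
have pc i m x : quocx_pi Pd m (c i m x) = 0 by apply/quocx_piP; exists i, x.
have [_ uq] := lu (quocx Pd) (fun i => ccomp z (c i)) (fun _ _ _ _ _ => erefl).
have := uq z (quocx_pi Pd) (fun _ _ _ => erefl) (fun i m x => pc i m x) n y.
by move=> /esym /quocx_piP.
Qed.

(** The reduced product of the system, the product modulo the families that vanish from
    some index on, carries a cocone whose i-th map kills only the elements that die at a
    later stage. *)
Lemma dlim_inj i n (x : S i n) : c i n x = 0 -> exists j (h : le i j), smap S h n x = 0.
Proof.
have [[i0] lr lt ld] := dir; have [cc lu] := lim.
pose Pobj m : lmodType R := dprod (fun j => S j m).
pose Pdif m : {linear Pobj m -> Pobj (m - 1)} :=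
  dp_pair (fun j => compl (cdiff (S j) m) (dp_proj (fun j => S j m) j)).
have PdifE m (s : Pobj m) j : Pdif m s j = cdiff (S j) m (s j).
  by rewrite dp_pairE /= dp_projE.
have PdifK m (s : Pobj m) : Pdif (m - 1) (Pdif m s) = 0.
  by apply: dprodP => j; rewrite !PdifE cdiffK.
pose Pi := @Complex R Pobj Pdif PdifK.
pose ev m (s : Pi m) := exists j0, forall j, le j0 j -> s j = 0.
have ev0 m : ev m 0 by exists i0.
have evL m a (s t : Pi m) : ev m s -> ev m t -> ev m (a *: s + t).
  move=> [j1 h1] [j2 h2]; have [k [k1 k2]] := ld j1 j2; exists k => j kj.
  by rewrite dprodZD h1 ?h2 ?scaler0 ?addr0 //; apply: lt kj.
pose Z m : submod (Pi m) := Submod (@ev0 m) (@evL m).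
have Zd m (s : Pi m) : Z m s -> Z (m - 1) (cdiff Pi m s).
  by move=> [j0 h]; exists j0 => j /h e; rewrite /= PdifE e linear0.
pose e i m : {linear S i m -> Pi m} := dp_pair (fun j =>
  match pselect (le i j) with left h => (smap S h m : {linear _ -> _}) | right _ => zerol _ _ end).
have eE i' m (y : S i' m) j (h : le i' j) : e i' m y j = smap S h m y.
  by rewrite dp_pairE; case: pselect => // h'; rewrite (Prop_irrelevance h' h).
have eC i' m (y : S i' m) : e i' (m - 1) (cdiff (S i') m y) = cdiff Pi m (e i' m y).
  apply: dprodP => j; rewrite /= PdifE !dp_pairE; case: pselect => [h|h] /=.
    by rewrite cmapC.
  by rewrite linear0.
pose t i' := ccomp (quocx_pi Zd) (@ChainMap R (S i') Pi (e i') (eC i')).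
have tc : cocone t.
  move=> i' j h m y; apply/eqP; rewrite -subr_eq0 /= -linearB; apply/eqP/quo_piP.
  exists j => k jk; rewrite dprodD dprodN (eE _ _ _ _ jk) (eE _ _ _ _ (lt _ _ _ h jk)).
  by rewrite (smap_comp h jk (lt _ _ _ h jk)) subrr.
have [[u uP] _] := lu _ t tc.
move=> cx; have := uP i n x; rewrite cx linear0 => /esym /quo_piP [j0 h0].
have [k [ik jk]] := ld i j0; exists k, ik.
by rewrite -eE h0.
Qed.
End DirectLimit.

Lemma directed_fin (I : Type) (le : I -> I -> Prop) (m : nat) (Q : 'I_m -> I -> Prop) :
  directed le -> (forall a i j, le i j -> Q a i -> Q a j) -> (forall a, exists i, Q a i) ->
  exists i, forall a, Q a i.
Proof.
move=> [[i0] lr lt ld] Qm Qex.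
have [i h] : exists i, forall a, a \in enum 'I_m -> Q a i.
  elim: (enum 'I_m) => [|a s [i ih]]; first by exists i0.
  have [j aj] := Qex a; have [k [ik jk]] := ld i j; exists k => b.
  by rewrite inE => /orP[/eqP ->|/ih]; [apply: Qm aj | apply: Qm].
by exists i => a; apply: h; rewrite mem_enum.
Qed.

(** G is free on finitely many homogeneous generators g, and the kernel of G -> C is
    generated by finitely many relations k.  A map from C to a direct limit lifts on the
    generators to some stage, and at a later stage the relations hold. *)
Lemma fp_criterion (C G : complex R) (p : chain_map G C)
    (m : nat) (dg : 'I_m -> int) (g : forall a, G (dg a))
    (r : nat) (dr : 'I_r -> int) (k : forall b, G (dr b)) :
  csurjective p ->
  (forall (Y : complex R) (f h : chain_map G Y),
     (forall a, f _ (g a) = h _ (g a)) -> forall n x, f n x = h n x) ->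
  (forall (Y : complex R) (y : forall n, G n -> Y n),
     exists f : chain_map G Y, forall a, f _ (g a) = y _ (g a)) ->
  (forall b, p _ (k b) = 0) ->
  (forall (Y : complex R) (f : chain_map G Y), (forall b, f _ (k b) = 0) ->
     forall n x, p n x = 0 -> f n x = 0) ->
  finitely_presented_complex C.
Proof.
move=> ps guniq gfree pk krel I le S L c dir lim.
have [[i0] lr lt ld] := dir; have [cc _] := lim.
have sirr i j (h h' : le i j) n x : smap S h n x = smap S h' n x.
  by rewrite (Prop_irrelevance h h').
split=> [f|i u v uv].
  pose Q (a : 'I_m) i := exists x : S i (dg a), c i _ x = f _ (p _ (g a)).
  have [||i iP] := @directed_fin I le m Q dir.
  - by move=> a i j ij [x e]; exists (smap S ij _ x); rewrite cc.
  - by move=> a; have [i [x xe]] := dlim_surj dir lim (f _ (p _ (g a))); exists i, x.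
  pose y n z : S i n := if pselect (exists x, c i n x = f n (p n z)) is left h then projT1 (cid h) else 0.
  have [u uy] := gfree _ y.
  have cu n x : c i n (u n x) = f n (p n x).
    apply: (guniq _ (ccomp (c i) u) (ccomp f p)) => a /=; rewrite uy /y.
    by case: pselect => [h|[]]; [exact: (projT2 (cid h)) | exact: iP].
  have [||j0 j0P] := @directed_fin I le r (fun b j => exists h : le i j, smap S h _ (u _ (k b)) = 0) dir.
  - move=> b j j' jj' [h e]; exists (lt _ _ _ h jj').
    by rewrite -(smap_comp h jj') e linear0.
  - move=> b; have [//|j [h e]] := dlim_inj dir lim (i := i) (x := u _ (k b)).
      by rewrite cu pk linear0.
    by exists j, h.
  have [j [ij j0j]] := ld i j0.
  have [|w wP] := cfactor_surj (f := ccomp (smap S ij) u) ps.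
    apply: krel => b /=; have [h e] := j0P b.
    by rewrite -(smap_comp h j0j) e linear0.
  exists j, w => n x; have [z <-] := ps n x.
  by rewrite wP /= cc cu.
have [||j0 j0P] := @directed_fin I le m (fun a j => exists h : le i j,
    smap S h _ (u _ (p _ (g a)) - v _ (p _ (g a))) = 0) dir.
- move=> b j j' jj' [h e]; exists (lt _ _ _ h jj').
  by rewrite -(smap_comp h jj') e linear0.
- move=> a; have [|j [h e]] := dlim_inj dir lim (i := i) (x := u _ (p _ (g a)) - v _ (p _ (g a))).
    by rewrite linearB uv subrr.
  by exists j, h.
have [j [ij j0j]] := ld i j0.
exists j, ij => n x; have [z <-] := ps n x.
apply: (guniq _ (ccomp (smap S ij) (ccomp u p)) (ccomp (smap S ij) (ccomp v p))) => a /=.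
apply/eqP; rewrite -subr_eq0 -linearB; have [h e] := j0P a.
by rewrite -(smap_comp h j0j) e linear0.
Qed.
End FPCriterion.

Section Single.
Context {R : pzRingType}.
Implicit Types M N F : lmodType R.

(** Used for the components of a disk concentrated in two degrees. *)
Definition sel (b : bool) M : lmodType R := if b then M else 'rV[R]_0.
Definition selin (b : bool) M : {linear M -> sel b M} :=
  if b as b return {linear M -> sel b M} then idl M else zerol M 'rV[R]_0.
Definition selout (b : bool) M : {linear sel b M -> M} :=
  if b as b return {linear sel b M -> M} then idl M else zerol 'rV[R]_0 M.
Lemma seloutK b M (x : sel b M) : selin b M (selout b M x) = x.
Proof. by case: b x => //= x; rewrite [RHS]thinmx0. Qed.
Lemma selinK (b : bool) M (x : M) : b -> selout b M (selin b M x) = x.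
Proof. by case: b. Qed.
Definition selmap (b : bool) M N (f : {linear M -> N}) : {linear sel b M -> sel b N} :=
  compl (selin b N) (compl f (selout b M)).
Lemma selmap_exact b M N F (f : {linear M -> N}) (g : {linear N -> F}) :
  exact_at f g -> exact_at (selmap b f) (selmap b g).
Proof.
case: b => // _ y; split=> _; last by rewrite /= /zerol.
by exists 0; rewrite [RHS]thinmx0.
Qed.
Lemma selmap_surj b M N (f : {linear M -> N}) : is_surjective f -> is_surjective (selmap b f).
Proof. by case: b => // _ y; exists 0; rewrite [RHS]thinmx0. Qed.
Lemma sel_projective b M : projective_module M -> projective_module (sel b M).
Proof.
case: b => // _ A B p f ps; exists (zerol _ _) => x.
by rewrite [x]thinmx0 !linear0.
Qed.

(** The disk on M generated in degree k. *)
Definition sdisk k M : complex R := diskf (fun n => sel (n == k - 1) M).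
Definition sdisk_map k M N (f : {linear M -> N}) : chain_map (sdisk k M) (sdisk k N) :=
  disk_in (fun n => compl (selmap (n == k - 1) f) (fstl _ _) : {linear sdisk k M n -> _}).
Lemma sdisk_mapE k M N (f : {linear M -> N}) n x :
  sdisk_map k f n x = (selmap (n == k - 1) f x.1, selmap (n - 1 == k - 1) f x.2).
Proof. by rewrite disk_inE diskf_diff. Qed.
Lemma sdisk_exact k M N F (f : {linear M -> N}) (g : {linear N -> F}) :
  exact_at f g -> cexact_at (sdisk_map k f) (sdisk_map k g).
Proof.
move=> e n [y1 y2]; rewrite sdisk_mapE.
have e1 := selmap_exact (b := n == k - 1) e y1; have e2 := selmap_exact (b := n - 1 == k - 1) e y2.
split=> [[/e1 [x1 <-] /e2 [x2 <-]]|[[x1 x2]]]; first by exists (x1, x2); rewrite sdisk_mapE.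
rewrite sdisk_mapE => -[h1 h2]; congr pair; first by apply/e1; exists x1.
by apply/e2; exists x2.
Qed.
Lemma sdisk_surj k M N (f : {linear M -> N}) : is_surjective f -> csurjective (sdisk_map k f).
Proof.
move=> pres_cells n [y1 y2]; have [x1 e1] := selmap_surj (b := n == k - 1) pres_cells y1.
have [x2 e2] := selmap_surj (b := n - 1 == k - 1) pres_cells y2.
by exists (x1, x2); rewrite sdisk_mapE e1 e2.
Qed.

Definition sgen k M (x : M) : sdisk k M k := (0, selin (k - 1 == k - 1) M x).
Lemma sdisk_map_gen k M N (f : {linear M -> N}) x : sdisk_map k f k (sgen k x) = sgen k (f x).
Proof.
rewrite sdisk_mapE /sgen; congr pair; first exact: linear0.
rewrite -[LHS]/(selin (k - 1 == k - 1) N (f (selout _ M (selin (k - 1 == k - 1) M x)))).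
by rewrite selinK.
Qed.

Lemma sgen_linear k M : linear (@sgen k M).
Proof. by move=> a x y; congr pair; rewrite ?linearP //= scaler0 addr0. Qed.

Section Out.
Context {Y : complex R} {k : int} {M : lmodType R} (f : {linear M -> Y k}).
Definition sdisk_out : chain_map (sdisk k M) Y :=
  disk_out (fun n => compl (xfer Y k n) (compl f (selout (n - 1 == k - 1) M))).
Lemma sdisk_outE x : sdisk_out k (sgen k x) = f x.
Proof.
rewrite disk_outE -[LHS]/(xfer Y k k (f (selout _ M (selin (k - 1 == k - 1) M x)))).
by rewrite selinK // xfer_id.
Qed.
End Out.

Lemma sdisk_ext k M (Y : complex R) (f g : chain_map (sdisk k M) Y) :
  (forall x, f k (sgen k x) = g k (sgen k x)) -> forall n x, f n x = g n x.
Proof.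
move=> e; apply: disk_out_ext => n y.
have [en|ne] := eqVneq n k; first by subst n; rewrite -(seloutK y); apply: e.
have -> : y = 0.
  by rewrite -(seloutK y); move: (selout _ _ _); rewrite (inj_eq (addIr _)) (negbTE ne).
by rewrite -[(0, 0)]/(0 : sdisk k M n) !linear0.
Qed.

Lemma rV_ext m N (f g : {linear 'rV[R]_m -> N}) :
  (forall i, f (delta_mx 0 i) = g (delta_mx 0 i)) -> forall x, f x = g x.
Proof.
move=> e x; rewrite (row_sum_delta x) !linear_sum; apply: eq_bigr => i _.
by rewrite !linearZ e.
Qed.
Lemma rV_map_linear m N (v : 'I_m -> N) : linear (fun x : 'rV[R]_m => \sum_i x 0 i *: v i).
Proof.
move=> a x y; rewrite scaler_sumr -big_split; apply: eq_bigr => i _.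
by rewrite !mxE scalerDl scalerA.
Qed.
Definition rV_map m N (v : 'I_m -> N) : {linear 'rV[R]_m -> N} := lin_of (rV_map_linear v).
Lemma rV_mapE m N (v : 'I_m -> N) i : rV_map v (delta_mx 0 i) = v i.
Proof.
rewrite lin_ofE (bigD1 i) //= big1 ?addr0 ?mxE ?eqxx ?scale1r // => j ne.
by rewrite mxE eqxx (negbTE ne) scale0r.
Qed.

Lemma sdisk_fp k F : finitely_presented_module F -> finitely_presented_complex (sdisk k F).
Proof.
move=> [m [n [f [p [ps fp]]]]].
pose gen q (i : 'I_q) : sdisk k 'rV[R]_q k := sgen k (delta_mx 0 i).
have gext q (Y : complex R) (u v : chain_map (sdisk k 'rV[R]_q) Y) :
    (forall i, u k (gen q i) = v k (gen q i)) -> forall n x, u n x = v n x.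
  move=> e; apply: sdisk_ext => x.
  have := @rV_ext _ _ (compl (u k) (lin_of (@sgen_linear k _)))
    (compl (v k) (lin_of (@sgen_linear k _))) _ x.
  by rewrite /= !lin_ofE; apply => i; rewrite /= !lin_ofE; apply: e.
apply: (fp_criterion (p := sdisk_map k p) (dg := fun=> k) (g := gen n)
   (dr := fun=> k) (k := fun j => sdisk_map k f k (gen m j))).
- exact: sdisk_surj.
- by move=> Y u v; apply: gext.
- move=> Y y; exists (sdisk_out (rV_map (fun i => y k (gen n i)))) => i.
  by rewrite sdisk_outE rV_mapE.
- by move=> b; apply: (proj2 (@sdisk_exact k _ _ _ f p fp k _)); exists (gen m b).
- move=> Y u uk d x h; have [z <-] := proj1 (@sdisk_exact k _ _ _ f p fp d x) h.
  by apply: (gext _ _ (ccomp u (sdisk_map k f)) (czero _ Y)) => i; apply: uk.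
Qed.

Section SRes.
Context (k : int) (F : lmodType R) (P : projective_resolution F).
Fact sres_proj n : projective_complex (sdisk k (P n)).
Proof. by apply: disk_projective => m; apply: sel_projective; apply: pproj. Qed.
Definition sres : cprojective_resolution (sdisk k F) :=
  @CProjRes R (sdisk k F) (fun n => sdisk k (P n)) (fun n => sdisk_map k (pdiff P n))
    (sdisk_map k (paug P)) sres_proj (@sdisk_surj k _ _ _ (@paug_surj _ _ P))
    (@sdisk_exact k _ _ _ _ _ (@paug_exact _ _ P))
    (fun n => @sdisk_exact k _ _ _ _ _ (@pdiff_exact _ _ P n)).
End SRes.

(** Ext^1(F, A_k) = 0 follows from Ext^1 = 0 for the disk on F generated in degree k,
    whose projective resolutions include the disks on those of F. *)
Lemma FP_injective_component (A : complex R) k :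
  FP_injective_complex A -> FP_injective_module (A k).
Proof.
move=> FA F fF P f fd.
have [n x|g gP] := FA _ (sdisk_fp k fF) (sres k P) (sdisk_out f).
  apply: (sdisk_ext (f := ccomp (sdisk_out f) (sdisk_map k (pdiff P 1))) (g := czero _ A)) => y.
  by rewrite /ccomp -[LHS]/(sdisk_out f k (sdisk_map k (pdiff P 1) k _)) sdisk_map_gen sdisk_outE fd.
exists (compl (g k) (lin_of (@sgen_linear k (P 0%N)))) => x /=.
by rewrite lin_ofE -sdisk_map_gen -[RHS](sdisk_outE f); apply: gP.
Qed.

End Single.

(** * FP-injective complexes as direct limits of contractible complexes *)
Section Span.
Context {R : pzRingType} {V : lmodType R}.

Section Preim.
Context {W : lmodType R} (f : {linear V -> W}) (P : submod W).
Fact preim_sm0 : P (f 0). Proof. by rewrite linear0; apply: sm0. Qed.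
Fact preim_smL a x y : P (f x) -> P (f y) -> P (f (a *: x + y)).
Proof. by rewrite linearP; apply: smL. Qed.
Definition preim_sm : submod V := @Submod R V (fun x => P (f x)) preim_sm0 preim_smL.
End Preim.

Context (hs : seq V).
(** The span as an intersection, whose induction principle is its definition. *)
Definition mspan_pred (x : V) := forall P : submod V, (forall y, y \in hs -> P y) -> P x.
Fact mspan_sm0 : mspan_pred 0. Proof. by move=> P _; apply: sm0. Qed.
Fact mspan_smL a x y : mspan_pred x -> mspan_pred y -> mspan_pred (a *: x + y).
Proof. by move=> hx hy P hP; apply: smL; [apply: hx | apply: hy]. Qed.
Definition mspan : submod V := Submod mspan_sm0 mspan_smL.
Lemma mem_mspan y : y \in hs -> mspan y.
Proof. by move=> h P; apply. Qed.
Lemma mspan_ind (W : lmodType R) (f : {linear V -> W}) (P : submod W) :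
  (forall y, y \in hs -> P (f y)) -> forall x, mspan x -> P (f x).
Proof. by move=> h x hx; apply: (hx (preim_sm f P)). Qed.
Lemma mspan_eq0 (W : lmodType R) (f : {linear V -> W}) :
  (forall y, y \in hs -> f y = 0) -> forall x, mspan x -> f x = 0.
Proof. by move=> h x hx; apply: (hx (eq_sm f (zerol _ _))) => y /h. Qed.
End Span.

Lemma mspan_sub {R : pzRingType} {V : lmodType R} (s t : seq V) x :
  {subset s <= t} -> mspan s x -> mspan t x.
Proof. by move=> st; apply: (mspan_ind (f := idl V)) => y /st; apply: mem_mspan. Qed.

Section CellExtend.
Context {R : pzRingType} {S : eqType} (deg : S -> int) (s : seq S) (hs : seq (cells R S)).
Let D : pred S := fun x => x \in s.
Hypothesis hhom : forall y, y \in hs -> exists n, cproj deg D n y = y.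
Hypothesis hd : forall y, y \in hs -> mspan hs (cd y).

Let cspan n : submod (@cellcx R S deg D n) := preim_sm (cval (n := n)) (mspan hs).
Let cspand n (x : @cellcx R S deg D n) : cspan n x -> cspan (n - 1) (cdiff (cellcx deg D) n x).
Proof.
move=> h; rewrite /= -[mspan_pred _ _]/(mspan hs _) cval_d; apply: smN.
exact: (mspan_ind (f := cd) hd).
Qed.

Lemma cproj_ne n m (x : cells R S) : n != m -> cproj deg D n (cproj deg D m x) = 0.
Proof.
move=> ne; apply: (cells_ext (f := compl (cproj deg D n) (cproj deg D m)) (g := zerol _ _)) => c /=.
  rewrite cproj_gen; case: ifP => [/andP[_ /eqP e]|]; rewrite ?linear0 // cproj_gen e.
  by rewrite (eq_sym m) (negbTE ne) andbF.
rewrite cproj_bd; case: ifP => [/andP[_ /eqP e]|]; rewrite ?linear0 // cproj_bd e.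
by rewrite (eq_sym m) (negbTE ne) andbF.
Qed.

Let nd_ex : exists nd : cells R S -> int, forall y, y \in hs -> cproj deg D (nd y) y = y.
Proof.
have h y : exists n, y \in hs -> cproj deg D n y = y.
  by have [/hhom [n e]|n] := boolP (y \in hs); [exists n | exists 0].
by have [nd ndP] := choice h; exists nd.
Qed.

Lemma cell_quo_fp : finitely_presented_complex (quocx cspand).
Proof.
have [nd ndP] := nd_ex.
have ts (a : 'I_(size s)) : D (tnth (in_tuple s) a) by apply: mem_tnth.
have th (b : 'I_(size hs)) : tnth (in_tuple hs) b \in hs by apply: mem_tnth.
apply: (fp_criterion (G := cellcx deg D) (p := quocx_pi cspand)
  (dg := fun a : 'I_(size s) => deg (tnth (in_tuple s) a) + 1)
  (g := fun a : 'I_(size s) => cret deg D (deg (tnth (in_tuple s) a) + 1) (cgen (tnth (in_tuple s) a)))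
  (dr := fun b : 'I_(size hs) => nd (tnth (in_tuple hs) b) + 1)
  (k := fun b : 'I_(size hs) => cret deg D (nd (tnth (in_tuple hs) b) + 1) (tnth (in_tuple hs) b))).
- exact: quocx_pi_surj.
- move=> Y f h e; apply: cell_lift_ext => c Dc.
  have /tnthP[a ->] : c \in in_tuple s by [].
  exact: e.
- move=> Y y; exists (cell_out D (fun c => y (deg c + 1) (cret deg D (deg c + 1) (cgen c)))) => a.
  by rewrite cell_outE.
- move=> b; apply/quocx_piP; rewrite /= -[mspan_pred _ _]/(mspan hs _) cretE addrK ndP //.
  exact: mem_mspan.
- move=> Y f fk n x /quocx_piP; rewrite -{2}(cretK x).
  apply: (mspan_eq0 (f := compl (f n) (cret deg D n))) => y hy /=.
  have /tnthP[b e] : y \in in_tuple hs by [].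
  have [en|ne] := eqVneq (nd y + 1) n; first by subst n; rewrite e; apply: fk.
  rewrite [cret _ _ _ _](_ : _ = 0) ?linear0 //; apply: cval_inj.
  rewrite linear0 cretE -(ndP _ hy) cproj_ne //.
  by apply: contra ne => /eqP <-; rewrite subrK.
Qed.

(** For a finitely generated graded subcomplex, spanned by hs, of the free complex on
    finitely many cells, the quotient is finitely presented, so cExt1_extend applies.
    In the hypothesis on t, the differential - cd is that of the shifted complex. *)
Lemma cell_extend (A : complex R) (t : forall n, {linear cells R S -> A n}) : FP_injective_complex A ->
  (forall n (x : cellcx deg D n), mspan hs (cval x) ->
     t (n - 1) (- cd (cval x)) = cdiff A n (t n (cval x))) ->
  exists g : chain_map (cellcx deg D) A, forall n x, mspan hs (cval x) -> g n x = t n (cval x).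
Proof.
move=> FA tC.
pose K := subcx cspand.
have tKC n (x : K n) : compl (t (n - 1)) (compl cval (subcx_incl cspand (n - 1))) (cdiff K n x) =
    cdiff A n (compl (t n) (compl cval (subcx_incl cspand n)) x).
  rewrite -[LHS]/(t (n - 1) (cval (subcx_incl cspand (n - 1) (cdiff K n x)))).
  by rewrite cmapC cval_d; apply: tC; exact: (subcx_inclP (P := cspan) x).
have ker : cis_kernel (subcx_incl cspand) (quocx_pi cspand).
  split=> n; first exact: subcx_incl_inj.
  move=> y; rewrite quocx_piP; split=> [h|[x <-]]; first exact: (subcx_incl_ex cspand).
  exact: (subcx_inclP (P := cspan) x).
have [g gP] := cExt1_extend (cell_projective (D := D)) (quocx_pi_surj (Pd := cspand)) ker
  (@ChainMap R K A _ tKC) (FA _ cell_quo_fp).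
exists g => n x hx; have [z <-] := subcx_incl_ex cspand (n := n) (x := x) hx.
exact: gP.
Qed.
End CellExtend.

Section Lazard.
Context {R : pzRingType} (A : complex R).
Hypothesis FA : FP_injective_complex A.

(** A cell is a homogeneous element of A with a label; the labels provide an unlimited
    supply of new cells over a given element. *)
Definition lcell : eqType := {classic ({n : int & A n} * nat)}.
Definition ldeg (c : lcell) : int := tag c.1.
Definition lval (c : lcell) : A (ldeg c) := tagged c.1.
Let F := cells R lcell.
Definition inp (s : seq lcell) : pred lcell := fun c => c \in s.

(** The canonical map from the free complex on all cells to A, in degree n.  It is onto,
    so that A is the quotient of the free complex by the intersection of the kernels. *)
Definition ev n : {linear F -> A n} :=
  cmapl (fun c => xfer A (ldeg c) n (lval c)) (fun c => xfer A (ldeg c - 1) n (cdiff A _ (lval c))).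
Lemma ev_gen n c : ev n (cgen c) = xfer A (ldeg c) n (lval c).
Proof. exact: cmapl_gen. Qed.
Lemma ev_bd n c : ev n (cbd c) = xfer A (ldeg c - 1) n (cdiff A _ (lval c)).
Proof. exact: cmapl_bd. Qed.
Lemma ev_d n x : ev (n - 1) (cd x) = cdiff A n (ev n x).
Proof.
apply: (cells_ext (f := compl (ev (n - 1)) cd) (g := compl (cdiff A n) (ev n))) => c /=.
  by rewrite cd_gen ev_bd ev_gen cdiff_xfer.
by rewrite cd_bd ev_bd linear0 cdiff_xfer_cdiff.
Qed.

Definition cpr (s : seq lcell) : {linear F -> F} :=
  cmapl (fun c => if c \in s then cgen c else 0) (fun c => if c \in s then cbd c else 0).
Lemma cpr_gen s c : cpr s (cgen c) = if c \in s then cgen c else 0.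
Proof. exact: cmapl_gen. Qed.
Lemma cpr_bd s c : cpr s (cbd c) = if c \in s then cbd c else 0.
Proof. exact: cmapl_bd. Qed.
Lemma cpr_d s x : cpr s (cd x) = cd (cpr s x).
Proof.
apply: (cells_ext (f := compl (cpr s) cd) (g := compl cd (cpr s))) => c /=.
  by rewrite cd_gen cpr_gen cpr_bd; case: ifP => _; rewrite ?cd_gen ?linear0.
by rewrite cd_bd cpr_bd linear0; case: ifP => _; rewrite ?cd_bd ?linear0.
Qed.
Lemma cpr_sub (s t : seq lcell) (x : F) : {subset s <= t} -> cpr t (cpr s x) = cpr s x.
Proof.
move=> st; apply: (cells_ext (f := compl (cpr t) (cpr s)) (g := cpr s)) => c /=.
  by rewrite cpr_gen; case: ifP => [/st h|_]; rewrite ?cpr_gen ?h ?linear0.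
by rewrite cpr_bd; case: ifP => [/st h|_]; rewrite ?cpr_bd ?h ?linear0.
Qed.
Lemma cproj_cpr s n (x : F) : cproj ldeg (inp s) n x = cpr s (cproj ldeg predT n x).
Proof.
apply: (cells_ext (f := cproj ldeg (inp s) n) (g := compl (cpr s) (cproj ldeg predT n))) => c /=.
  rewrite !cproj_gen /=; case: eqP => _; rewrite ?andbF ?linear0 // andbT cpr_gen //.
rewrite !cproj_bd /=; case: eqP => _; rewrite ?andbF ?linear0 // andbT cpr_bd //.
Qed.
Lemma cpr_cproj s n (x : F) : cpr s (cproj ldeg (inp s) n x) = cproj ldeg (inp s) n x.
Proof. by rewrite cproj_cpr cpr_sub. Qed.
Lemma cproj_sub (s t : seq lcell) n (x : F) : {subset s <= t} -> cproj ldeg (inp s) n x = x -> cproj ldeg (inp t) n x = x.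
Proof.
move=> st e; rewrite cproj_cpr.
have h z : cproj ldeg predT n (cproj ldeg (inp s) n z) = cproj ldeg (inp s) n z.
  apply: (cells_ext (f := compl (cproj ldeg predT n) (cproj ldeg (inp s) n)) (g := cproj ldeg (inp s) n)) => c /=.
    by rewrite cproj_gen; case: ifP => [/andP[_ h]|_]; rewrite ?linear0 // cproj_gen h.
  by rewrite cproj_bd; case: ifP => [/andP[_ h]|_]; rewrite ?linear0 // cproj_bd h.
have e1 : cproj ldeg predT n x = x by rewrite -{1}e h.
have e2 : cpr s x = x by rewrite -e cpr_cproj.
by rewrite e1 -e2 cpr_sub.
Qed.

(** A finitely presented complex over A: the quotient of the part of the free complex on
    finitely many cells by the span of finitely many homogeneous relations that hold in
    A; the span is stable under the differential. *)
Record fpres := FPres {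
  pres_cells : seq lcell;
  pres_list : seq F;
  pres_list_hom : forall y, y \in pres_list -> exists n, cproj ldeg (inp pres_cells) n y = y;
  pres_list_d : forall y, y \in pres_list -> mspan pres_list (cd y);
  pres_list_ev : forall y, y \in pres_list -> forall n, ev n y = 0 }.

Definition pres_gen (p : fpres) : submod F := eq_sm (cpr (pres_cells p)) (idl F).
Definition pres_rel (p : fpres) : submod F := mspan (pres_list p).
Definition pres_le (p q : fpres) := {subset pres_cells p <= pres_cells q} /\ {subset pres_list p <= pres_list q}.

Lemma pres_rel_sub p x : pres_rel p x -> pres_gen p x.
Proof.
apply: (mspan_ind (f := idl F)) => y /(pres_list_hom) [n e] /=.
by rewrite -e cpr_cproj.
Qed.
Lemma pres_gen_d p x : pres_gen p x -> pres_gen p (cd x).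
Proof. by rewrite /= cpr_d => ->. Qed.
Lemma pres_rel_d p x : pres_rel p x -> pres_rel p (cd x).
Proof. exact: (mspan_ind (f := cd) (@pres_list_d p)). Qed.
Lemma pres_gen_mono p q x : pres_le p q -> pres_gen p x -> pres_gen q x.
Proof. by move=> [s _] /= e; rewrite -e cpr_sub. Qed.
Lemma pres_rel_mono p q x : pres_le p q -> pres_rel p x -> pres_rel q x.
Proof. by move=> [_ s]; apply: mspan_sub. Qed.
Lemma pres_rel_ev p x n : pres_rel p x -> ev n x = 0.
Proof. by apply: mspan_eq0 => y /pres_list_ev. Qed.

(** The quotient presented by p is contractible, by a homotopy that is a contraction
    of the whole free complex. *)
Definition contractible (p : fpres) := exists sg : {linear F -> F},
  [/\ forall x, cd (sg x) + sg (cd x) = x,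
      forall x, pres_gen p x -> pres_gen p (sg x) & forall x, pres_rel p x -> pres_rel p (sg x)].

Lemma contractible_acyc p : contractible p -> acyc cd (pres_gen p) (pres_rel p).
Proof.
move=> [sg [sgE sgG sgH]] I dI g iI dIK gG gH.
exists (compl g sg); split=> x /=; first by move=> /sgH /gH.
by move=> Gx; rewrite (gG _ (sgG _ Gx)) -(linearD g) sgE.
Qed.

Lemma pres_join_ex p q : exists r, pres_le p r /\ pres_le q r.
Proof.
have sl (T : eqType) (a b : seq T) : {subset a <= a ++ b} by move=> x h; rewrite mem_cat h.
have sr (T : eqType) (a b : seq T) : {subset b <= a ++ b} by move=> x h; rewrite mem_cat h orbT.
have h1 y : y \in pres_list p ++ pres_list q -> exists n, cproj ldeg (inp (pres_cells p ++ pres_cells q)) n y = y.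
  rewrite mem_cat => /orP[/pres_list_hom|/pres_list_hom] [n e]; exists n.
    by apply: cproj_sub e; apply: sl.
  by apply: cproj_sub e; apply: sr.
have h2 y : y \in pres_list p ++ pres_list q -> mspan (pres_list p ++ pres_list q) (cd y).
  rewrite mem_cat => /orP[/pres_list_d|/pres_list_d]; apply: mspan_sub; [apply: sl | apply: sr].
have h3 y : y \in pres_list p ++ pres_list q -> forall n, ev n y = 0.
  by rewrite mem_cat => /orP[/pres_list_ev|/pres_list_ev].
by exists (FPres h1 h2 h3); split; split; [apply: sl|apply: sl|apply: sr|apply: sr].
Qed.

(** The presentation q is that of the cone of the identity of the complex C presented by
    p.  The canonical map C -> A, restricted to the cells, has the null homotopy t that
    sends a cell to 0 and the boundary of a cell to the value of the cell.  On the
    relations t is a chain map of degree 1, as they hold in A, so by cell_extend it extends to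
    a chain map g on all cells, and t - g is a null homotopy of C -> A.  Adding to
    each cell c a new cell nc c over the value - g c of t - g at c, one obtains the
    cone: its contraction sg maps c to nc c, and the relations of the cone are those of C
    and their images under sg. *)
Lemma contractible_ex p : exists q, pres_le p q /\ contractible q.
Proof.
case: p => s hs hhom hd hev.
pose t n : {linear F -> A n} := cmapl (fun c => 0) (fun c => xfer A (ldeg c) n (lval c)).
have tgen n c : t n (cgen c) = 0 by apply: cmapl_gen.
have tbd n c : t n (cbd c) = xfer A (ldeg c) n (lval c) by apply: cmapl_bd.
have tE n x : t (n - 1) (cd x) + cdiff A n (t n x) = ev (n - 1) x.
  apply: (cells_ext (f := addl (compl (t (n - 1)) cd) (compl (cdiff A n) (t n))) (g := ev (n - 1))) => c /=.
    by rewrite cd_gen tbd tgen linear0 addr0 ev_gen.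
  by rewrite cd_bd linear0 add0r tbd cdiff_xfer ev_bd.
have [n x hx|g gP] := cell_extend (s := s) hhom hd (t := t) FA.
  have := tE n (cval x); rewrite (mspan_eq0 (f := ev (n - 1)) (hs := hs)) //.
    by move=> /eqP; rewrite addr_eq0 => /eqP e; rewrite linearN e opprK.
  by move=> y hy; apply: hev.
pose D : pred lcell := (inp s).
pose a c : A (ldeg c + 1) := - g (ldeg c + 1) (cret ldeg D (ldeg c + 1) (cgen c)).
(* a label that does not occur in s *)
pose N := (\max_(c <- s) c.2).+1.
pose nc (c : lcell) : lcell := (Tagged (fun n => A n) (a c), N).
have ncN c : (nc c \in s) = false.
  apply/negP => h; have : (N <= \max_(c <- s) c.2)%N.
    exact: (@leq_bigmax_seq lcell s xpredT (fun c : lcell => c.2) (nc c) h isT).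
  by rewrite ltnn.
pose sg : {linear F -> F} := cmapl (fun c => if c \in s then cgen (nc c) else 0)
  (fun c => if c \in s then cgen c - cbd (nc c) else cgen c).
have sgen c : sg (cgen c) = if c \in s then cgen (nc c) else 0 by apply: cmapl_gen.
have sbd c : sg (cbd c) = if c \in s then cgen c - cbd (nc c) else cgen c by apply: cmapl_bd.
have sgE x : cd (sg x) + sg (cd x) = x.
  apply: (cells_ext (f := addl (compl cd sg) (compl sg cd)) (g := idl F)) => c /=.
    rewrite cd_gen sgen sbd; case: ifP => _; last by rewrite linear0 add0r.
    by rewrite cd_gen addrC subrK.
  rewrite cd_bd linear0 addr0 sbd; case: ifP => _; last by rewrite cd_gen.
  by rewrite linearB cd_gen cd_bd subr0.
(* ev o sg is the null homotopy t - g. *)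
have evsg n x : ev n (sg (cpr s x)) = t n (cpr s x) - g n (cret ldeg D n x).
  apply: (cells_ext (f := compl (ev n) (compl sg (cpr s)))
    (g := subl (compl (t n) (cpr s)) (compl (g n) (cret ldeg D n)))) => c /=.
    rewrite cpr_gen; case: ifP => cs; last by rewrite cret_gen_ne ?/D /= ?cs // !(linear0, subr0, addr0).
    rewrite sgen cs ev_gen tgen sub0r.
    have [e|ne] := eqVneq (ldeg c + 1) n; first by subst n; rewrite xfer_id.
    by rewrite cret_gen_ne ?(negbTE ne) ?andbF // linear0 oppr0 xfer_ne.
  rewrite cpr_bd; case: ifP => cs; last by rewrite cret_bd_ne ?/D /= ?cs // !(linear0, subr0, addr0).
  rewrite sbd cs linearB ev_gen tbd ev_bd; congr (_ - _).
  have [e|ne] := eqVneq (ldeg c) n; last first.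
    by rewrite cret_bd_ne ?(negbTE ne) ?andbF // linear0 xfer_ne // /ldeg /= addrK.
  have [j ej] : exists j, j = ldeg c + 1 by exists (ldeg c + 1).
  have ejn : n = j - 1 by rewrite ej addrK.
  rewrite ejn cret_bd; last by rewrite e ejn.
  rewrite [RHS]linearN cmapC; clear ejn; subst j.
  by rewrite -[RHS](linearN (cdiff A _)); apply: xfer_id.
pose s' := s ++ map nc s; pose hs' := hs ++ map sg hs.
have ss' : {subset s <= s'} by move=> c cs; rewrite mem_cat cs.
have ns' c : c \in s -> nc c \in s' by move=> cs; rewrite mem_cat map_f ?orbT.
have shs' : {subset hs <= hs'} by move=> c cs; rewrite mem_cat cs.
have cprhs y : y \in hs -> cpr s y = y by move=> /hhom [n e]; rewrite -e cpr_cproj.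
have cprojsg n x : cproj ldeg (inp s') (n + 1) (sg (cproj ldeg (inp s) n x)) = sg (cproj ldeg (inp s) n x).
  apply: (cells_ext (f := compl (cproj ldeg (inp s') (n + 1)) (compl sg (cproj ldeg (inp s) n)))
    (g := compl sg (cproj ldeg (inp s) n))) => c /=.
    rewrite cproj_gen; case: ifP => [/andP[cs /eqP e]|_]; last by rewrite !linear0.
    rewrite sgen (cs : c \in s) cproj_gen /inp ns' //= /ldeg /= -/(ldeg c) e eqxx //.
  rewrite cproj_bd; case: ifP => [/andP[cs /eqP e]|_]; last by rewrite !linear0.
  rewrite sbd (cs : c \in s) linearB cproj_gen cproj_bd /inp ns' // ss' //= -e subrK eqxx.
  by rewrite /ldeg /= addrK eqxx.
have h1 y : y \in hs' -> exists n, cproj ldeg (inp s') n y = y.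
  rewrite mem_cat => /orP[/hhom [n e]|/mapP[z /hhom [n e] ->]].
    by exists n; apply: cproj_sub e.
  by exists (n + 1); rewrite -e cprojsg.
have h2 y : y \in hs' -> mspan hs' (cd y).
  rewrite mem_cat => /orP[/hd|/mapP[z hz ->]]; first exact: mspan_sub.
  have -> : cd (sg z) = z - sg (cd z) by rewrite -{2}(sgE z) addrK.
  apply: smB; first by apply: mem_mspan; apply: shs'.
  apply: (mspan_ind (f := sg) (P := mspan hs')) (hd z hz) => y' hy'.
  by apply: mem_mspan; rewrite mem_cat map_f ?orbT.
have h3 y : y \in hs' -> forall n, ev n y = 0.
  rewrite mem_cat => /orP[/hev //|/mapP[z hz ->]] n.
  rewrite -(cprhs z hz) evsg cprhs //; have [m e] := hhom z hz.
  have [en|ne] := eqVneq (m + 1) n.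
    have ez : cval (cret ldeg D n z) = z by rewrite cretE -en addrK.
    have := gP n (cret ldeg D n z); rewrite ez => ->; first by rewrite subrr.
    exact: mem_mspan.
  have -> : cret ldeg D n z = 0.
    apply: cval_inj; rewrite linear0 cretE -e cproj_ne //.
    by apply: contra ne => /eqP <-; rewrite subrK.
  rewrite linear0 subr0 -e.
  apply: (cells_ext (f := compl (t n) (cproj ldeg (inp s) m)) (g := zerol _ _)) => c /=.
    by rewrite cproj_gen; case: ifP; rewrite ?tgen ?linear0.
  rewrite cproj_bd; case: ifP => [/andP[_ /eqP ec]|_]; rewrite ?linear0 // tbd xfer_ne //.
  by rewrite -ec subrK in ne.
exists (FPres h1 h2 h3); split; first by split.
exists sg; split=> //= x.
  move=> e; rewrite -e.
  apply: (cells_ext (f := compl (cpr s') (compl sg (cpr s'))) (g := compl sg (cpr s'))) => c /=.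
    rewrite cpr_gen; case: ifP => [cs'|_]; last by rewrite !linear0.
    by rewrite sgen; case: ifP => [cs|_]; rewrite ?linear0 // cpr_gen ns'.
  rewrite cpr_bd; case: ifP => [cs'|_]; last by rewrite !linear0.
  rewrite sbd; case: ifP => [cs|_]; last by rewrite cpr_gen cs'.
  by rewrite linearB cpr_gen cpr_bd cs' ns'.
apply: (mspan_ind (f := sg) (P := mspan hs')) => y.
rewrite mem_cat => /orP[hy|/mapP[z hz ->]].
  by apply: mem_mspan; rewrite mem_cat map_f ?orbT.
rewrite -(cprhs z hz).
have -> : sg (sg (cpr s z)) = 0; last exact: sm0.
apply: (cells_ext (f := compl sg (compl sg (cpr s))) (g := zerol _ _)) => c /=.
  rewrite cpr_gen; case: ifP => [cs|_]; last by rewrite !linear0.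
  by rewrite sgen cs sgen ncN.
rewrite cpr_bd; case: ifP => [cs|_]; last by rewrite !linear0.
by rewrite sbd cs linearB sgen cs sbd ncN subrr.
Qed.

Let P : choiceType := {classic {p : fpres | contractible p}}.
Let le (p q : P) := pres_le (sval p) (sval q).
Let p_ex p : exists q : P, pres_le p (sval q).
Proof. by have [q [pq cq]] := contractible_ex p; exists (exist _ q cq). Qed.
Let le_trans p q r : pres_le p q -> pres_le q r -> pres_le p r.
Proof. by move=> [a b] [c d]; split=> x; [move/a/c | move/b/d]. Qed.
Let le_dir (p q : P) : exists r, le p r /\ le q r.
Proof.
have [r [pr qr]] := pres_join_ex (sval p) (sval q); have [r' rr'] := p_ex r.
by exists r'; split; [apply: le_trans pr rr' | apply: le_trans qr rr'].
Qed.
Let p0_ex : exists p : P, True.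
Proof.
have h1 (y : F) : y \in [::] -> exists n, cproj ldeg (inp [::]) n y = y by [].
have h2 (y : F) : y \in [::] -> mspan [::] (cd y) by [].
have h3 (y : F) : y \in [::] -> forall n, ev n y = 0 by [].
by have [q _] := p_ex (FPres h1 h2 h3); exists q.
Qed.

Lemma pres_gen_cover x : exists p : P, pres_gen (sval p) x.
Proof.
pose s : seq lcell := [seq b.1 | b <- dsupp x].
have h1 (y : F) : y \in [::] -> exists n, cproj ldeg (inp s) n y = y by [].
have h2 (y : F) : y \in [::] -> mspan [::] (cd y) by [].
have h3 (y : F) : y \in [::] -> forall n, ev n y = 0 by [].
have [q lq] := p_ex (FPres h1 h2 h3); exists q; apply: pres_gen_mono lq _.
rewrite /= {2}(freemodE x) {1}(freemodE x) linear_sum big_seq [RHS]big_seq.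
apply: eq_bigr => -[c b] cb; rewrite linearZ; congr (_ *: _).
have cs : c \in s by apply/mapP; exists (c, b).
by case: b {cb}; [rewrite cpr_bd cs | rewrite cpr_gen cs].
Qed.

Lemma cproj_sum (x : F) : exists s : seq int, x = \sum_(n <- s) cproj ldeg predT n x.
Proof.
pose bdeg (b : lcell * bool) : int := if b.2 then ldeg b.1 - 1 else ldeg b.1.
pose s := undup [seq bdeg b | b <- dsupp x]; exists s.
have pE n b : cproj ldeg predT n (fbase b) = if bdeg b == n then fbase b else 0.
  by case: b => c [] /=; [rewrite cproj_bd | rewrite cproj_gen].
have xE n : cproj ldeg predT n x =
    \sum_(b <- dsupp x) (dcoord (fun=> R^o) b x : R) *: cproj ldeg predT n (fbase b).
  rewrite {1}(freemodE x) linear_sum.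
  by apply: eq_bigr => b _; rewrite linearZ.
under [RHS]eq_bigr do rewrite xE.
rewrite exchange_big /= {1}(freemodE x) big_seq [RHS]big_seq; apply: eq_bigr => b bx.
have bd : bdeg b \in s by rewrite mem_undup map_f.
rewrite (bigD1_seq (bdeg b)) ?undup_uniq //= pE eqxx big1 ?addr0 // => n ne.
by rewrite pE eq_sym (negbTE ne) scaler0.
Qed.

Lemma ev_cproj n m x : ev m (cproj ldeg predT n x) = if n == m then ev m x else 0.
Proof.
case: eqP => [->|/eqP ne].
  apply: (cells_ext (f := compl (ev m) (cproj ldeg predT m)) (g := ev m)) => c /=.
    rewrite cproj_gen /=; case: eqP => // /eqP ne; rewrite linear0 ev_gen xfer_ne //.
  rewrite cproj_bd /=; case: eqP => // /eqP ne; rewrite linear0 ev_bd xfer_ne //.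
apply: (cells_ext (f := compl (ev m) (cproj ldeg predT n)) (g := zerol _ _)) => c /=.
  rewrite cproj_gen /=; case: eqP => [e|_]; rewrite ?linear0 // ev_gen xfer_ne // e //.
rewrite cproj_bd /=; case: eqP => [e|_]; rewrite ?linear0 // ev_bd xfer_ne // e //.
Qed.

Lemma pres_rel_cover n y : cproj ldeg predT n y = y -> (forall m, ev m y = 0) ->
  exists p : P, pres_rel (sval p) y.
Proof.
move=> e evy; have [p0 Gy] := pres_gen_cover y.
pose s := pres_cells (sval p0); pose l := [:: y; cd y].
have Gd : cpr s (cd y) = cd y by rewrite cpr_d Gy.
have h1 z : z \in l -> exists n, cproj ldeg (inp s) n z = z.
  rewrite !inE => /orP[/eqP ->|/eqP ->]; [exists n | exists (n - 1)].
    by rewrite cproj_cpr e; apply: Gy.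
  by rewrite cproj_cpr cproj_d e.
have h2 z : z \in l -> mspan l (cd z).
  rewrite !inE => /orP[/eqP ->|/eqP ->]; first by apply: mem_mspan; rewrite !inE eqxx orbT.
  by rewrite cdK; apply: sm0.
have h3 z : z \in l -> forall m, ev m z = 0.
  rewrite !inE => /orP[/eqP ->//|/eqP ->] m.
  have -> : m = (m + 1) - 1 by rewrite addrK.
  by rewrite ev_d evy linear0.
have [q lq] := p_ex (FPres h1 h2 h3); exists q; apply: pres_rel_mono lq _.
by apply: mem_mspan; rewrite inE eqxx.
Qed.

(** The contractible finite presentations form a directed system of acyclic pairs with
    union the presentation of A by all cells and all relations. *)
Lemma cells_acyc : acyc (@cd R lcell) (fun _ => True) (fun x => forall n, ev n x = 0).
Proof.
have [p0 _] := p0_ex.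
have := @directed_acyc R F cd (@cdK R lcell) P le p0 _ _ le_dir
  (fun p => pres_gen (sval p)) (fun p => pres_rel (sval p)).
move=> /(_ (fun p => conj (fun _ h => h) (fun _ h => h)) (fun p q r => @le_trans _ _ _)).
move=> /(_ (fun p q x => @pres_gen_mono _ _ x) (fun p q x => @pres_rel_mono _ _ x)).
move=> /(_ (fun p => @pres_rel_sub _) (fun p => @pres_gen_d _) (fun p => @pres_rel_d _) (fun p => contractible_acyc (svalP p))).
apply: acyc_ext => x; first by split=> // _; apply: pres_gen_cover.
split=> [[p Hx] n|evx]; first exact: pres_rel_ev Hx.
have dirH (i j : P) : exists k : P, (forall x, pres_rel (sval i) x -> pres_rel (sval k) x) /\
    (forall x, pres_rel (sval j) x -> pres_rel (sval k) x).
  have [k [ik jk]] := le_dir i j; exists k.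
  by split=> z; [apply: pres_rel_mono ik | apply: pres_rel_mono jk].
change (union_sm p0 dirH x).
have [s ->] := cproj_sum x; apply: sm_sum => n.
apply: (@pres_rel_cover n); first by rewrite cprojK.
by move=> m; rewrite ev_cproj; case: ifP.
Qed.

Definition tot : lmodType R := dsum (fun n => A n).
Definition totd : {linear tot -> tot} :=
  dsum_map (fun n => compl (dinj (fun n => A n) (n - 1)) (cdiff A n)).
Lemma totd_inj n x : totd (dinj (fun n => A n) n x) = dinj (fun n => A n) (n - 1) (cdiff A n x).
Proof. by rewrite dsum_mapE. Qed.

(** A is the quotient of the free complex on all cells, along E, so this is cells_acyc
    for the map g o E. *)
Lemma tot_null (I : lmodType R) (dI : {linear I -> I}) (g : {linear tot -> I}) :
  injective_module I -> (forall y, dI (dI y) = 0) -> (forall x, dI (g x) = g (totd x)) ->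
  exists h : {linear tot -> I}, forall x, g x = dI (h x) + h (totd x).
Proof.
move=> iI dIK gd.
pose inj n := dinj (fun n => A n) n.
pose E : {linear F -> tot} := cmapl (fun c => inj (ldeg c) (lval c))
  (fun c => inj (ldeg c - 1) (cdiff A _ (lval c))).
have Egen c : E (cgen c) = inj (ldeg c) (lval c) by apply: cmapl_gen.
have Ebd c : E (cbd c) = inj (ldeg c - 1) (cdiff A _ (lval c)) by apply: cmapl_bd.
have Ed x : E (cd x) = totd (E x).
  apply: (cells_ext (f := compl E cd) (g := compl totd E)) => c /=.
    by rewrite cd_gen Egen Ebd totd_inj.
  by rewrite cd_bd Ebd totd_inj cdiffK !linear0.
have Eev x n : dcoord (fun n => A n) n (E x) = ev n x.
  apply: (cells_ext (f := compl (dcoord (fun n => A n) n) E) (g := ev n)) => c /=.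
    by rewrite Egen ev_gen dcoord_dinj.
  by rewrite Ebd ev_bd dcoord_dinj.
have Esurj : is_surjective E.
  move=> y; pose c n : lcell := (Tagged (fun n => A n) (dcoord (fun n => A n) n y), 0%N).
  exists (\sum_(n <- dsupp y) cgen (c n)); rewrite linear_sum [RHS](dsumE y).
  by apply: eq_bigr => n _; rewrite Egen.
have E0 x : E x = 0 <-> forall n, ev n x = 0.
  split=> [e n|e]; first by rewrite -Eev e linear0.
  by apply: dsum_eq => n; rewrite Eev e linear0.
have [x _|x /E0 e|h [h0 hE]] := @cells_acyc I dI (compl g E) iI dIK.
- by rewrite /= Ed gd.
- by rewrite /= e linear0.
have [k kP] := factor_surj Esurj (fun x (e : E x = 0) => h0 x (proj1 (E0 x) e)).
exists k => y; have [x <-] := Esurj y.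
by rewrite -Ed !kP -hE.
Qed.
End Lazard.

(** * Null homotopies into complexes of Ding injective modules *)
Section Resolvable.
Context {R : pzRingType}.
Implicit Types (A E K M N J : lmodType R) (C : lmodType R -> Prop).

Definition lifts A E N (p : {linear E -> N}) : Prop :=
  forall f : {linear A -> N}, exists g : {linear A -> E}, forall x, p (g x) = f x.
Definition FPlifts E N (p : {linear E -> N}) : Prop :=
  forall A, FP_injective_module A -> lifts A p.
Definition inj_ses K E N (i : {linear K -> E}) (p : {linear E -> N}) : Prop :=
  [/\ injective_module E, injective i, exact_at i p, is_surjective p & FPlifts p].

(** left_resolving and right_resolving express coinductively that a module has an infinite
    resolution on the left, or on the right, by injective modules, on which Hom(A, -) is
    exact for FP-injective A: a class of modules is given in which one step is always
    possible. *)
Definition left_resolving C := forall N, C N ->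
  exists K E (i : {linear K -> E}) (p : {linear E -> N}), C K /\ inj_ses i p.
Definition right_resolving C := forall N, C N ->
  exists M E (i : {linear N -> E}) (p : {linear E -> M}), C M /\ inj_ses i p.

Lemma injective_FP E : injective_module E -> FP_injective_module E.
Proof.
move=> iE F _ P f fd.
pose Z := eq_sm (paug P) (zerol _ F).
have h x : Z (pdiff P 0 x).
  have e : paug P (pdiff P 0 x) = 0 by apply/(exactP (@paug_exact _ _ P)); exists x.
  exact: e.
have ps : is_surjective (corestr h).
  move=> y; have e : paug P (sub_val Z y) = 0 := sub_valP y.
  have [x xe] := proj1 (exactP (@paug_exact _ _ P) _) e.
  by exists x; apply: sub_val_inj; rewrite corestrE.
have [|u uP] := factor_surj (f := f) ps.
  move=> x e; have : pdiff P 0 x = 0 by rewrite -(corestrE h) e linear0.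
  by move=> /(exactP (@pdiff_exact _ _ P 0)) [y <-]; apply: fd.
have [g gP] := injective_extend u iE.
by exists g => x; rewrite -(corestrE h) gP uP.
Qed.

Definition prod_class C N := C N \/ exists M J, [/\ C M, injective_module J & N = (M * J)%type].

(** The kernels needed for products M * J with J injective are those for M. *)
Lemma prod_class_cover C : left_resolving C -> forall N, prod_class C N ->
  exists K E (i : {linear K -> E}) (p : {linear E -> N}), C K /\ inj_ses i p.
Proof.
move=> lC N [/lC [K [E [i [p [CK s]]]]]|[M [J [CM iJ ->]]]].
  by exists K, E, i, p.
have [K [E [i [p [CK [iE ii ip ps pl]]]]]] := lC _ CM.
have H1 : linear (fun k : K => (i k, 0) : (E * J)%type).
  by move=> a x y; congr pair; rewrite ?linearP //= scaler0 addr0.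
have H2 : linear (fun x : E * J => (p x.1, x.2) : (M * J)%type).
  by move=> a x y; congr pair; rewrite ?linearP.
exists K, (E * J)%type, (lin_of H1), (lin_of H2); split=> //.
split.
- exact: prod_injective.
- by move=> x y; rewrite !lin_ofE => -[/ii].
- move=> [x y]; rewrite lin_ofE /=; split=> [[/(exactP ip) [k <-] ->]|[k]].
    by exists k; rewrite lin_ofE.
  by rewrite lin_ofE => -[<- <-]; congr pair; apply/(exactP ip); exists k.
- by move=> [x y]; have [z <-] := ps x; exists (z, y); rewrite lin_ofE.
- move=> A FA f; have [g gP] := pl A FA (compl (fstl M J) f).
  have H3 : linear (fun a : A => (g a, (f a).2) : (E * J)%type).
    by move=> a x y; congr pair; rewrite !linearP.
  by exists (lin_of H3) => x; rewrite !lin_ofE /= gP /= -surjective_pairing.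
Qed.

Definition dprod_class C N := exists Y : int -> lmodType R, (forall n, C (Y n)) /\ N = dprod Y.

Lemma dprod_class_left C : left_resolving C -> left_resolving (dprod_class C).
Proof.
move=> lC N [Y [CY ->]].
have [K hK] := choice (fun n => lC _ (CY n)); have [E hE] := choice hK.
have [i hi] := choice_dep hE; have [p hp] := choice_dep hi.
exists (dprod K), (dprod E), (dp_pair (fun n => compl (i n) (dp_proj K n))),
  (dp_pair (fun n => compl (p n) (dp_proj E n))); split.
  by exists K; split=> // n; case: (hp n).
split.
- by apply: dprod_injective => n; case: (hp n) => _ [].
- move=> x y e; apply: dprodP => n; have [_ [_ ii _ _ _]] := hp n.
  by apply: ii; have := congr1 (fun f : dprod E => f n) e; rewrite !dp_pairE /= !dp_projE.
- move=> y; split=> [e|[x <-]].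
    have h n : exists x, i n x = y n.
      have [_ [_ _ ip _ _]] := hp n; apply/(exactP ip).
      by have := congr1 (fun f : dprod Y => f n) e; rewrite dp_pairE /= dp_projE.
    have [x xP] := choice_dep h.
    by exists x; apply: dprodP => n; rewrite dp_pairE /= dp_projE xP.
  apply: dprodP => n; rewrite !dp_pairE /= !dp_projE dp_pairE /= dp_projE.
  by have [_ [_ _ ip _ _]] := hp n; apply/(exactP ip); exists (x n).
- move=> y; have h n : exists x, p n x = y n by have [_ [_ _ _ ps _]] := hp n; apply: ps.
  have [x xP] := choice_dep h.
  by exists x; apply: dprodP => n; rewrite dp_pairE /= dp_projE xP.
- move=> A FA f.
  have [g gP] := @lchoice _ _ (fun=> A) E (fun n g => forall x, p n (g x) = f x n)
    (fun n => ltac:(have [_ [_ _ _ _ pl]] := hp n; have [g gP] := pl A FA (compl (dp_proj Y n) f);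
       by exists g => x; rewrite gP /= dp_projE)).
  by exists (dp_pair g) => x; apply: dprodP => n; rewrite dp_pairE /= dp_projE dp_pairE gP.
Qed.

Section Null.
Context (A : complex R) (C : lmodType R -> Prop).
Hypothesis FA : FP_injective_complex A.
Hypothesis lC : left_resolving C.
Let T := tot A.
Let d : {linear T -> T} := totd A.

(** A map on the sum of the components of A lifts because it lifts on each component. *)
Lemma tot_lifts E N (p : {linear E -> N}) : FPlifts p -> lifts T p.
Proof.
move=> pl f.
have [g gP] := @lchoice _ _ (fun n => A n) (fun=> E)
  (fun n g => forall x, p (g x) = compl f (dinj (fun n => A n) n) x)
  (fun n => pl _ (FP_injective_component (k := n) FA) _).
exists (dsum_map g); apply: (dsum_ext (f := compl p (dsum_map g))) => n x /=.
by rewrite dsum_mapE gP.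
Qed.

(** A syzygy sM, with a differential, in a resolution of a differential module, together
    with the chain map sg from A to it that remains to be lifted. *)
Record stage := Stage {
  sM : lmodType R;
  sd : {linear sM -> sM};
  sg : {linear T -> sM};
  sdK : forall x, sd (sd x) = 0;
  sgd : forall x, sd (sg x) = sg (d x);
  sC : prod_class C sM }.

(** One step of the resolution.  lp covers the module of s by an injective differential
    module lE, and li is the inclusion of its kernel.  The differential of s' is minus the
    restriction of lD, so that D = lD + li o lp has square 0 on the product of all the
    lE.  The lift lg of the map of s need not commute with the differentials; its
    defect is, up to sign, the map of s'. *)
Record link (s s' : stage) := Link {
  lE : lmodType R;
  lD : {linear lE -> lE};
  lp : {linear lE -> sM s};
  li : {linear sM s' -> lE};
  lg : {linear T -> lE};
  lE_inj : injective_module lE;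
  lDK : forall x, lD (lD x) = 0;
  lpD : forall x, lp (lD x) = sd s (lp x);
  lpi : forall y, lp (li y) = 0;
  lDi : forall y, lD (li y) = - li (sd s' y);
  lpg : forall x, lp (lg x) = sg s x;
  lDg : forall x, lD (lg x) + li (sg s' x) = lg (d x) }.

Arguments lD {s s'} l.
Arguments lp {s s'} l.
Arguments li {s s'} l.
Arguments lg {s s'} l.
Arguments lE {s s'} l.

Lemma link_ex (s : stage) : exists s' (l : link s s'), True.
Proof.
case: s => N dN g dNK gd CN.
have [K [E [i [p [CK [iE ii ip ps pl]]]]]] := prod_class_cover lC CN.
have [q qP] := pl E (injective_FP iE) (compl dN p).
have [u uP] := tot_lifts pl g.
(* An injective cover p of N need not carry a differential; E * E with the differential
   (a, b) |-> (0, a) does, and its map (a, b) |-> p a + dN (p b) to N is compatible with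
   the differentials.  As q lifts dN o p, its kernel is K * E by (k, y) |-> (i k - q y, y). *)
have HD : linear (fun x : E * E => (0, x.1) : (E * E)%type).
  by move=> a x y; congr pair; rewrite /= scaler0 addr0.
have Hp : linear (fun x : E * E => p x.1 + dN (p x.2)).
  by move=> a x y; rewrite /= !linearP scalerDr addrACA.
have Hi : linear (fun y : K * E => (i y.1 - q y.2, y.2) : (E * E)%type).
  move=> a x y; congr pair; by rewrite /= (linearP i) (linearP q) opprD scalerBr addrACA.
have Hu : linear (fun x : T => (u x, 0) : (E * E)%type).
  by move=> a x y; congr pair; rewrite /= ?linearP // scaler0 addr0.
pose D := lin_of HD; pose P := lin_of Hp; pose I := lin_of Hi; pose U := lin_of Hu.
have DE x : D x = (0, x.1) by rewrite lin_ofE.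
have PE x : P x = p x.1 + dN (p x.2) by rewrite lin_ofE.
have IE x : I x = (i x.1 - q x.2, x.2) by rewrite lin_ofE.
have UE x : U x = (u x, 0) by rewrite lin_ofE.
have pi k : p (i k) = 0 by apply/(exactP ip); exists k.
have PI y : P (I y) = 0 by rewrite PE IE /= linearB pi qP sub0r addNr.
have PD x : P (D x) = dN (P x).
  by rewrite !PE DE /= linear0 add0r linearD dNK addr0.
have Iinj : injective I.
  move=> x y; rewrite !IE => -[e1 e2]; move: e1; rewrite e2 => /addIr /ii e1.
  by rewrite [x]surjective_pairing [y]surjective_pairing e1 e2.
have Iex x : P x = 0 -> exists y, I y = x.
  case: x => a b; rewrite PE /= => e.
  have /(exactP ip) [k kE] : p (a + q b) = 0 by rewrite linearD qP.
  by exists (k, b); rewrite IE /= kE addrK.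
have [d' d'P] := factor_inj (f := oppl (compl D I)) Iinj
  (fun x => Iex _ (etrans (linearN P _) (etrans (congr1 -%R (etrans (PD _) (etrans (congr1 dN (PI x)) (linear0 _)))) (oppr0 _)))).
have PU x : P (U x) = g x by rewrite PE UE /= uP !linear0 addr0.
have [g' g'P] := factor_inj (f := subl (compl U d) (compl D U)) Iinj
  (fun x => Iex _ (etrans (linearB P _ _) (etrans (congr2 (fun a b => a - b) (PU _) (etrans (PD _) (congr1 dN (PU x)))) (etrans (congr1 (fun a => a - _) (esym (gd x))) (subrr _))))).
have DD x : D (D x) = 0 by rewrite !DE.
have dTK x : d (d x) = 0.
  apply: (dsum_ext (f := compl d d) (g := zerol _ _)) => n y /=.
  by rewrite !totd_inj cdiffK linear0.
have d'K y : d' (d' y) = 0.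
  by apply: Iinj; rewrite linear0 d'P /= d'P /= (linearN D) DD !oppr0.
have gd' x : d' (g' x) = g' (d x).
  apply: Iinj; rewrite d'P /= !g'P /= dTK (linear0 U) sub0r (linearB D) DD subr0.
  by [].
have CK' : prod_class C (K * E)%type by right; exists K, E.
exists (Stage d'K gd' CK').
unshelve eexists (@Link (Stage dNK gd CN) (Stage d'K gd' CK') (E * E)%type D P I U (prod_injective iE iE) DD PD PI _ PU _) => //.
- by move=> y; rewrite /= d'P /= opprK.
- by move=> x; rewrite /= g'P /= addrC subrK.
Qed.

(** The product of the injective modules of all the steps, with the differential
    D = lD + li o lp, is an injective differential module that maps onto M through its
    component 0.  The lifts lg of the successive steps assemble into a chain map to it,
    to which tot_null applies. *)
Lemma tot_null_left_resolving (M : lmodType R) (dM : {linear M -> M}) (g : {linear T -> M}) :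
  C M -> (forall y, dM (dM y) = 0) -> (forall x, dM (g x) = g (d x)) ->
  exists h : {linear T -> M}, forall x, g x = dM (h x) + h (d x).
Proof.
move=> CM dMK gd.
have [nx nxP] := choice link_ex.
pose lk s : link s (nx s) := projT1 (cid (nxP s)).
pose st n := iter n nx (Stage dMK gd (or_introl CM : prod_class C M)).
pose E n := lE (lk (st n)).
pose shift n : {linear dprod E -> E n} := addl (compl (lD (lk (st n))) (dp_proj E n))
  (compl (li (lk (st n))) (compl (lp (lk (st n.+1))) (dp_proj E n.+1))).
have shiftE n t : shift n t = lD (lk (st n)) (t n) + li (lk (st n)) (lp (lk (st n.+1)) (t n.+1)).
  by rewrite /= !dp_projE.
pose D : {linear dprod E -> dprod E} := dp_pair shift.
have DE t n : D t n = lD (lk (st n)) (t n) + li (lk (st n)) (lp (lk (st n.+1)) (t n.+1)).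
  by rewrite dp_pairE shiftE.
have DD t : D (D t) = 0.
  apply: dprodP => n; rewrite !DE (linearD (lD _)) lDK add0r lDi (linearD (lp _)) lpi addr0 lpD.
  by rewrite addNr.
pose G : {linear T -> dprod E} := dp_pair (fun n => lg (lk (st n))).
have GE x n : G x n = lg (lk (st n)) x by rewrite dp_pairE.
have DG x : D (G x) = G (d x).
  by apply: dprodP => n; rewrite DE !GE lpg lDg.
have [h hE] := tot_null FA (dprod_injective (fun n => @lE_inj _ _ (lk (st n)))) DD DG.
exists (compl (lp (lk (st 0))) (compl (dp_proj E 0%N) h)) => x.
have e0 : G x 0%N = (D (h x) + h (d x)) 0%N by rewrite -hE.
have := congr1 (lp (lk (st 0))) e0; rewrite GE lpg dprodD DE !linearD lpD lpi addr0.
by rewrite /= !dp_projE.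
Qed.
End Null.

(** The largest class closed under both kinds of steps; it is the class of Ding injective
    modules, in the form of a coinductive predicate. *)
Definition biresolvable (M : lmodType R) : Prop := exists C, [/\ left_resolving C, right_resolving C & C M].
Lemma biresolvable_left : left_resolving biresolvable.
Proof.
move=> N [C [lC rC CN]]; have [K [E [i [p [CK s]]]]] := lC _ CN.
by exists K, E, i, p; split=> //; exists C.
Qed.
Lemma biresolvable_right : right_resolving biresolvable.
Proof.
move=> N [C [lC rC CN]]; have [K [E [i [p [CK s]]]]] := rC _ CN.
by exists K, E, i, p; split=> //; exists C.
Qed.

(** Take the product M of the X n, with the differential induced by - cdiff X, and g as a
    map from the sum of the A n to M: then tot_null_left_resolving applies, and the homotopy
    h consists of the components of degree 0 of the map obtained. *)
Lemma null_homotopy (A X : complex R) (g : forall n, {linear A n -> X (n - 1)}) :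
  FP_injective_complex A -> (forall n, biresolvable (X n)) ->
  (forall n a, cdiff X (n - 1) (g n a) = - g (n - 1) (cdiff A n a)) ->
  exists h : forall n, {linear A n -> X n},
    forall n a, g n a = cdiff X n (h n a) - h (n - 1) (cdiff A n a).
Proof.
move=> FA dX gd.
pose M : lmodType R := dprod (fun n => X n).
pose dM : {linear M -> M} := dp_pair (fun m => compl (xfer X (m + 1 - 1) m)
  (compl (cdiff X (m + 1)) (dp_proj (fun n => X n) (m + 1)))).
have dME (x : M) m : dM x m = xfer X (m + 1 - 1) m (cdiff X (m + 1) (x (m + 1))).
  by rewrite dp_pairE /= dp_projE.
have dMn (x : M) n : dM x (n - 1) = cdiff X n (x n).
  rewrite dME; have : n - 1 + 1 = n by rewrite subrK.
  by move: (n - 1 + 1) => j e; subst j; rewrite xfer_id.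
have dMK x : oppl dM (oppl dM x) = 0.
  rewrite /= linearN opprK; apply: dprodP => m; have -> : m = m + 1 - 1 by rewrite addrK.
  by rewrite dMn dME cdiff_xfer_cdiff.
pose gt : {linear tot A -> M} :=
  dsum_map (fun n => dp_pair (fun m => compl (xfer X (n - 1) m) (g n))).
have gtE n a m : gt (dinj (fun n => A n) n a) m = xfer X (n - 1) m (g n a).
  by rewrite dsum_mapE dp_pairE.
have gtd x : oppl dM (gt x) = gt (totd A x).
  apply: (dsum_ext (f := compl (oppl dM) gt) (g := compl gt (totd A))) => n a /=.
  rewrite totd_inj; apply: dprodP => m; rewrite dprodN dME !gtE cdiff_xfer gd !linearN opprK.
  have : m + 1 - 1 = m by rewrite addrK.
  by move: (m + 1 - 1) => j e; subst j; rewrite xfer_id.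
have CM : dprod_class biresolvable M by exists (fun n => X n).
have [h hE] := tot_null_left_resolving FA (dprod_class_left biresolvable_left) CM dMK gtd.
exists (fun n => oppl (compl (dp_proj (fun n => X n) n) (compl h (dinj (fun n => A n) n)))) => n a.
have := congr1 (fun f : M => f (n - 1)) (hE (dinj (fun n => A n) n a)).
rewrite gtE xfer_id dprodD /= dprodN dMn totd_inj => ->.
by rewrite !dp_projE linearN opprK.
Qed.

(** Lifts u n exist in each degree.  Their defect, the commutator of u with the
    differentials, takes values in the kernel Y, where it anticommutes with the
    differentials; a null homotopy h of it corrects u to the chain map u - i h. *)
Lemma chain_lift (A Y E Z : complex R) (i : chain_map Y E) (p : chain_map E Z) (f : chain_map A Z) :
  FP_injective_complex A -> (forall n, biresolvable (Y n)) -> cis_kernel i p ->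
  (forall n, FPlifts (p n)) ->
  exists g : chain_map A E, forall n x, p n (g n x) = f n x.
Proof.
move=> FA dY [ii ip] pl.
have [u uP] := @lchoice _ _ (fun n => A n) (fun n => E n) (fun n u => forall x, p n (u x) = f n x)
  (fun n => pl n _ (FP_injective_component (k := n) FA) (f n)).
pose df n : {linear A n -> E (n - 1)} :=
  subl (compl (cdiff E n) (u n)) (compl (u (n - 1)) (cdiff A n)).
have [g gP] := @lchoice _ _ (fun n => A n) (fun n => Y (n - 1))
  (fun n g => forall x, i (n - 1) (g x) = df n x)
  (fun n => factor_inj (f := df n) (ii (n - 1)) (fun x => proj1 (exactP (ip (n - 1)) _)
    (etrans (linearB (p (n - 1)) _ _) (etrans (congr2 (fun a b => a - b)
       (etrans (cmapC p _) (congr1 (cdiff Z n) (uP n x)))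
       (etrans (uP (n - 1) (cdiff A n x)) (cmapC f x))) (subrr _))))).
have gd n a : cdiff Y (n - 1) (g n a) = - g (n - 1) (cdiff A n a).
  apply: (ii (n - 1 - 1)); rewrite cmapC linearN !gP /= linearB !cdiffK linear0 sub0r subr0.
  by [].
have [h hE] := null_homotopy FA dY gd.
have gC n x : subl (u (n - 1)) (compl (i (n - 1)) (h (n - 1))) (cdiff A n x) =
    cdiff E n (subl (u n) (compl (i n) (h n)) x).
  rewrite /= linearB -cmapC.
  have := gP n x; rewrite hE /= linearB => /eqP; rewrite subr_eq => /eqP ->.
  by rewrite opprD opprB addrA addrCA addrN addr0.
exists (@ChainMap _ A E (fun n => subl (u n) (compl (i n) (h n))) gC) => n x.
by rewrite /= linearB uP (proj2 (exactP (ip n) _)) ?subr0 //; exists (h n x).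
Qed.
End Resolvable.

(** * Complexes with Ding injective components are Ding injective *)
Section DingModules.
Context {R : pzRingType}.

(** The modules of cycles of a given resolution E form a class closed under both kinds of
    steps. *)
Lemma Ding_biresolvable (M : lmodType R) : Ding_injective_module M -> biresolvable M.
Proof.
move=> [E [iE eE [i0 k0] lE]].
exists (fun N : lmodType R => exists k (i : {linear N -> E k}), is_kernel i (cdiff E k)); split; last by exists 0, i0.
- move=> N [k [i [ii ik]]].
  have [j ej] : exists j, k = j - 1 by exists (k + 1); rewrite addrK.
  subst k.
  pose K := eq_sm (cdiff E j) (zerol _ _).
  have [p pE] := factor_inj ii (fun x => proj1 (exactP ik (cdiff E j x)) (cdiffK x)).
  exists (subT K), (E j), (sub_val K), p; split.
    exists j, (sub_val K); split; first exact: sub_val_inj.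
    move=> y; split=> [h|[x <-]]; last exact: (sub_valP x).
    by have Ky : K y := h; exists (sub_mk Ky); rewrite sub_mkK.
  split=> //.
  + exact: sub_val_inj.
  + move=> y; split=> [e|[x <-]].
      have Ky : K y by rewrite -[K y]/(cdiff E j y = 0) -pE e linear0.
      by exists (sub_mk Ky); rewrite sub_mkK.
    by apply: ii; rewrite pE linear0; apply: (sub_valP x).
  + move=> y; have /(exactP (eE j)) [x xE] : cdiff E (j - 1) (i y) = 0 by apply/(exactP ik); exists y.
    by exists x; apply: ii; rewrite pE.
  + move=> A FA f; have [|g gE] := lE A FA j (compl i f).
      by move=> a /=; apply/(exactP ik); exists (f a).
    by exists g => x; apply: ii; rewrite pE gE.
- move=> N [k [i [ii ik]]].
  pose K := eq_sm (cdiff E (k - 1)) (zerol _ _).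
  have Kd x : K (cdiff E k x) by apply: cdiffK.
  exists (subT K), (E k), i, (corestr Kd); split.
    exists (k - 1), (sub_val K); split; first exact: sub_val_inj.
    move=> y; split=> [h|[x <-]]; last exact: (sub_valP x).
    by have Ky : K y := h; exists (sub_mk Ky); rewrite sub_mkK.
  split=> //.
  + move=> y; rewrite -(exactP ik); split=> e; first by rewrite -(corestrE Kd) e linear0.
    by apply: sub_val_inj; rewrite corestrE e linear0.
  + move=> y; have e : cdiff E (k - 1) (sub_val K y) = 0 := sub_valP y.
    have [x xE] := proj1 (exactP (eE k) _) e.
    by exists x; apply: sub_val_inj; rewrite corestrE.
  + move=> A FA f; have [|g gE] := lE A FA k (compl (sub_val K) f).
      by move=> a; apply: (sub_valP (f a)).
    by exists g => x; apply: sub_val_inj; rewrite corestrE gE.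
Qed.

(** A step for M gives one for M * J with the same kernel or cokernel, by adding J to the
    middle term. *)
Lemma biresolvable_prod (M J N : lmodType R) (u : {linear N -> (M * J)%type}) :
  biresolvable M -> injective_module J -> injective u -> is_surjective u -> biresolvable N.
Proof.
move=> [C [lC rC CM]] iJ ui us.
exists (fun L : lmodType R => C L \/ exists (M J : lmodType R) (v : {linear L -> (M * J)%type}),
   [/\ C M, injective_module J, injective v & is_surjective v]); split; last by right; exists M, J, u.
- move=> {M J N u CM iJ ui us} N [/lC [K [E [i [p [CK s]]]]]|[M [J [u [CM iJ ui us]]]]].
    by exists K, E, i, p; split=> //; left.
  have [K [E [i [p [CK [iE ii ip ps pl]]]]]] := lC _ CM.
  have H1 : linear (fun k : K => (i k, 0) : (E * J)%type).
    by move=> a x y; congr pair; rewrite ?linearP //= scaler0 addr0.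
  have H2 : linear (fun x : E * J => (p x.1, x.2) : (M * J)%type).
    by move=> a x y; congr pair; rewrite ?linearP.
  have [q qE] := factor_inj (f := lin_of H2) ui (fun x => us _).
  exists K, (E * J)%type, (lin_of H1), q; split; first by left.
  split.
  + exact: prod_injective.
  + by move=> x y; rewrite !lin_ofE => -[/ii].
  + move=> [x y]; split=> [e|[k]].
      have := qE (x, y); rewrite e linear0 lin_ofE => -[/esym /(exactP ip) [k <-] <-].
      by exists k; rewrite lin_ofE.
    rewrite lin_ofE => -[<- <-]; apply: ui; rewrite qE lin_ofE linear0; congr pair.
    by apply/(exactP ip); exists k.
  + move=> y; have [z zE] := ps (u y).1; exists (z, (u y).2).
    by apply: ui; rewrite qE lin_ofE /= zE -surjective_pairing.
  + move=> A FA f; have [g gE] := pl A FA (compl (fstl M J) (compl u f)).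
    have H3 : linear (fun a : A => (g a, (u (f a)).2) : (E * J)%type).
      by move=> a x y; congr pair; rewrite !linearP.
    by exists (lin_of H3) => x; apply: ui; rewrite qE !lin_ofE /= gE /= -surjective_pairing.
- move=> {M J N u CM iJ ui us} N [/rC [K [E [i [p [CK s]]]]]|[M [J [u [CM iJ ui us]]]]].
    by exists K, E, i, p; split=> //; left.
  have [K [E [i [p [CK [iE ii ip ps pl]]]]]] := rC _ CM.
  have H1 : linear (fun x : N => (i (u x).1, (u x).2) : (E * J)%type).
    by move=> a x y; congr pair; rewrite !linearP.
  exists K, (E * J)%type, (lin_of H1), (compl p (fstl E J)); split; first by left.
  split.
  + exact: prod_injective.
  + move=> x y; rewrite !lin_ofE => -[/ii e1 e2]; apply: ui.
    by rewrite [LHS]surjective_pairing e1 e2 -surjective_pairing.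
  + move=> [x y] /=; split=> [/(exactP ip) [m <-]|[z]].
      by have [z zE] := us (m, y); exists z; rewrite lin_ofE zE.
    by rewrite lin_ofE => -[<- _]; apply/(exactP ip); exists (u z).1.
  + by move=> y; have [x <-] := ps y; exists (x, 0).
  + move=> A FA f; have [g gE] := pl A FA f.
    have H3 : linear (fun a : A => (g a, 0) : (E * J)%type).
      by move=> a x y; congr pair; rewrite ?linearP //= scaler0 addr0.
    by exists (lin_of H3) => x; rewrite /= lin_ofE gE.
Qed.
End DingModules.

Section DingComplexes.
Context {R : pzRingType}.

Record cses (Y Z : complex R) : Type := CSes {
  cE : complex R;
  ci : chain_map Y cE;
  cp : chain_map cE Z;
  cE_inj : injective_complex cE;
  c_ker : cis_kernel ci cp;
  c_surj : csurjective cp;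
  c_lift : forall A, FP_injective_complex A -> forall f : chain_map A Z,
    exists g : chain_map A cE, forall n x, cp n (g n x) = f n x }.

Definition cbiresolvable (X : complex R) := forall n, biresolvable (X n).

(** X is covered by the disks on injective covers ph n : J (n - 1) -> X n.  Since the map
    w n : J n -> X n induced through the differential of X lifts along ph n, to q n, the
    kernel in degree n is isomorphic to K (n - 1) * J n. *)
Lemma cses_left (X : complex R) : cbiresolvable X -> exists K (s : cses K X), cbiresolvable K.
Proof.
move=> dX.
have [K hK] := choice (fun n => biresolvable_left (dX (n + 1))); have [J hJ] := choice hK.
have [i hi] := choice_dep hJ; have [p hp] := choice_dep hi.
pose ph n : {linear J (n - 1) -> X n} := compl (xfer X (n - 1 + 1) n) (p (n - 1)).
have iso n : exists u : {linear X n -> X (n - 1 + 1)}, forall x, u (ph n x) = p (n - 1) x /\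
    forall y, xfer X (n - 1 + 1) n (u y) = y.
  rewrite /ph; have : n - 1 + 1 = n by rewrite subrK.
  move: (p (n - 1)); move: (n - 1 + 1) => j q e; subst j; exists (idl _) => x.
  by split=> [|y]; rewrite /= xfer_id.
have phs n : is_surjective (ph n).
  move=> y; have [u uP] := iso n; have [_ [_ _ _ ps _]] := hp (n - 1).
  by have [x xE] := ps (u y); exists x; rewrite /= xE; apply: (uP x).2.
have phe n : exact_at (i (n - 1)) (ph n).
  move=> y; have [u uP] := iso n; have [_ [_ _ ip _ _]] := hp (n - 1).
  rewrite -(exactP ip); split=> [e|/= ->]; last by rewrite linear0.
  by rewrite -(uP y).1 e linear0.
have phl n : FPlifts (ph n).
  move=> A FA f; have [u uP] := iso n; have [_ [_ _ _ _ pl]] := hp (n - 1).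
  have [g gE] := pl A FA (compl u f); exists g => x.
  by rewrite /= gE; apply: (uP 0).2.
have iJ n : injective_module (J n) by have [_ []] := hp n.
have ii n : injective (i n) by have [_ []] := hp n.
pose P : chain_map (diskf J) X := disk_out ph.
have P2 n y : P n (0, y) = ph n y by apply: disk_outE.
pose w n : {linear J n -> X n} := compl (P n) (disk_bd J n).
have PE n (x : diskf J n) : P n x = ph n x.2 + w n x.1.
  by rewrite {1}(disk_split x) linearD disk_genE P2.
have [q qE] := @lchoice _ _ J (fun n => J (n - 1)) (fun n q => forall x, ph n (q x) = w n x)
  (fun n => phl n _ (injective_FP (iJ n)) (w n)).
pose KK := kercx P.
have dK : cbiresolvable KK.
  move=> n.
  have val_ex (x : KK n) : exists k, i (n - 1) k = (kercx_incl P n x).2 + q n (kercx_incl P n x).1.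
    apply/(exactP (@phe n)); rewrite linearD qE -PE.
    exact: (subcx_inclP (P := ker_sm P) x).
  have [v vE] := factor_inj (f := addl (compl (sndl (J n) (J (n - 1))) (kercx_incl P n))
    (compl (q n) (compl (fstl (J n) (J (n - 1))) (kercx_incl P n)))) (@ii (n - 1)) val_ex.
  have H : linear (fun x : KK n => (v x, (kercx_incl P n x).1) : (K (n - 1) * J n)%type).
    by move=> a x y; congr pair; rewrite !linearP.
  apply: (biresolvable_prod (u := lin_of H)); [|exact: iJ| |].
  - by have [] := hp (n - 1).
  - move=> x y; rewrite [lin_of H x]lin_ofE [lin_of H y]lin_ofE => e; apply: (subcx_incl_inj (P := ker_sm P)).
    have e1 : v x = v y := congr1 fst e.
    have e2 : (kercx_incl P n x).1 = (kercx_incl P n y).1 := congr1 snd e.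
    have := congr1 (i (n - 1)) e1; rewrite !vE.
    rewrite -[LHS]/((kercx_incl P n x).2 + q n (kercx_incl P n x).1).
    rewrite -[RHS]/((kercx_incl P n y).2 + q n (kercx_incl P n y).1) e2 => /addIr e3.
    rewrite -[LHS]/(kercx_incl P n x) -[RHS]/(kercx_incl P n y).
    by rewrite [LHS]surjective_pairing [RHS]surjective_pairing e2 e3.
  - move=> [k x].
    have e1 : ph n (i (n - 1) k) = 0 by apply/(exactP (@phe n)); exists k.
    have e2 : ph n (i (n - 1) k - q n x) + w n x = 0.
      by rewrite (linearB (ph n)) qE subrK e1.
    have h : ker_sm P n (x, i (n - 1) k - q n x) := etrans (PE n (x, _)) e2.
    have [z zE] := subcx_incl_ex (@ker_smd _ _ _ P) h; exists z.
    have zE' : kercx_incl P n z = (x, i (n - 1) k - q n x) := zE.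
    rewrite [lin_of H z]lin_ofE zE'; congr pair; apply: ii; rewrite vE.
    rewrite -[LHS]/((kercx_incl P n z).2 + q n (kercx_incl P n z).1).
    by rewrite zE' subrK.
have Ps : csurjective P.
  by move=> n y; have [x <-] := phs n y; exists (0, x).
have Pl n : FPlifts (P n).
  move=> A FA f; have [g gE] := phl n A FA f.
  by exists (compl (disk_gen J n) g) => x; rewrite /= disk_genE -gE; apply: P2.
exists KK.
have lft A (FA : FP_injective_complex A) (f : chain_map A X) :
    exists g : chain_map A (diskf J), forall n x, P n (g n x) = f n x.
  exact: chain_lift FA dK (kercx_is_kernel P) Pl.
by exists (CSes (disk_injective iJ) (kercx_is_kernel P) Ps lft).
Qed.

(** X embeds by x |-> (i x, i (d x)) into the disks on injective modules J n that
    contain X n with cokernel p n : J n -> M n.  As i d extends to a map t n on J n, the map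
    (a, b) |-> (p a, b - t a) is a cokernel in degree n, with values in M n * J (n - 1). *)
Lemma cses_right (X : complex R) : cbiresolvable X -> exists Z (s : cses X Z), cbiresolvable Z.
Proof.
move=> dX.
have [M hM] := choice (fun n => biresolvable_right (dX n)); have [J hJ] := choice hM.
have [i hi] := choice_dep hJ; have [p hp] := choice_dep hi.
have iJ n : injective_module (J n) by have [_ []] := hp n.
have ii n : injective (i n) by have [_ []] := hp n.
have ip n : exact_at (i n) (p n) by have [_ []] := hp n.
have ps n : is_surjective (p n) by have [_ []] := hp n.
have pl n : FPlifts (p n) by have [_ []] := hp n.
pose E := diskf J; pose I : chain_map X E := disk_in i.
have IE n x : I n x = (i n x, i (n - 1) (cdiff X n x)) by apply: disk_inE.
have [t tE] := @lchoice _ _ J (fun n => J (n - 1))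
  (fun n t => forall x, t (i n x) = compl (i (n - 1)) (cdiff X n) x)
  (fun n => iJ (n - 1) _ _ (i n) (compl (i (n - 1)) (cdiff X n)) (@ii n)).
have H n : linear (fun x : E n => (p n x.1, x.2 - t n x.1) : (M n * J (n - 1))%type).
  move=> a x y; congr pair; first by rewrite linearP.
  by rewrite /= (linearP (t n)) opprD scalerBr addrACA.
pose r n := lin_of (@H n).
have rE n x : r n x = (p n x.1, x.2 - t n x.1) by rewrite lin_ofE.
have rs n : is_surjective (r n).
  move=> [m y]; have [x xE] := ps n m.
  by exists (x, y + t n x); rewrite rE /= xE addrK.
have rk n : exact_at (I n) (r n).
  move=> [a b]; rewrite rE /=; split=> [[/(exactP (@ip n)) [x <-]]|[x]].
    by rewrite tE /= => /eqP; rewrite subr_eq0 => /eqP ->; exists x; rewrite IE.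
  rewrite IE => -[<- <-]; rewrite tE /= subrr; congr pair.
  by apply/(exactP (@ip n)); exists x.
pose Qo n : lmodType R := (M n * J (n - 1))%type.
have [dq dqE] := @lchoice _ _ Qo (fun n => Qo (n - 1))
  (fun n f => forall x, f (r n x) = compl (r (n - 1)) (cdiff E n) x)
  (fun n => factor_surj (f := compl (r (n - 1)) (cdiff E n)) (@rs n)
     (fun x e => ltac:(by have /(exactP (@rk n)) [y <-] := e;
         change (r (n - 1) (cdiff E n (I n y)) = 0);
         rewrite -cmapC; apply/(exactP (@rk (n - 1))); exists (cdiff X n y)))).
have dqK n x : dq (n - 1) (dq n x) = 0.
  have [y <-] := rs n x.
  rewrite dqE -[compl _ _ y]/(r (n - 1) (cdiff E n y)) dqE.
  by rewrite -[LHS]/(r (n - 1 - 1) (cdiff E (n - 1) (cdiff E n y))) cdiffK linear0.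
pose Q := @Complex R Qo dq dqK.
have rC n x : r (n - 1) (cdiff E n x) = cdiff Q n (r n x).
  by rewrite -[RHS]/(dq n (r n x)) dqE.
pose Rm := @ChainMap R E Q r rC.
have kI : cis_kernel I Rm.
  split=> n; last exact: rk.
  by move=> x y; rewrite !IE => -[/ii].
have Rl n : FPlifts (Rm n).
  move=> A FA f; have [g gE] := pl n A FA (compl (fstl (M n) (J (n - 1))) f).
  have Hg : linear (fun a : A => (g a, (f a).2 + t n (g a)) : E n).
    move=> a x y; congr pair; first by rewrite linearP.
    by rewrite /= !linearP scalerDr addrACA.
  by exists (lin_of Hg) => x; rewrite /= rE lin_ofE /= gE addrK /= -surjective_pairing.
exists Q.
have lft A (FA : FP_injective_complex A) (f : chain_map A Q) :
    exists g : chain_map A E, forall n x, Rm n (g n x) = f n x.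
  exact: chain_lift FA dX kI Rl.
exists (CSes (disk_injective iJ) kI (rs : csurjective Rm) lft) => n.
apply: (biresolvable_prod (u := idl (Qo n))); [by have [] := hp n|exact: iJ|by []|by move=> y; exists y].
Qed.

(** Choose the steps on both sides of X and splice them. *)
Lemma cbiresolvable_Ding (X : complex R) : cbiresolvable X -> Ding_injective_complex X.
Proof.
move=> dX.
pose T := {Y | cbiresolvable Y}.
have lex (Y : T) : exists K : T, exists s : cses (sval K) (sval Y), True.
  by have [K [s dK]] := cses_left (svalP Y); exists (exist _ K dK), s.
have rex (Y : T) : exists Z : T, exists s : cses (sval Y) (sval Z), True.
  by have [Z [s dZ]] := cses_right (svalP Y); exists (exist _ Z dZ), s.
have [nl nlP] := choice lex; have [nr nrP] := choice rex.
pose X0 : T := exist _ X dX.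
(* The n-th syzygy: X itself for n = 0, kernels for n > 0 and cokernels for n < 0. *)
pose Y (n : int) : T := match n with Posz k => iter k nl X0 | Negz k => iter k.+1 nr X0 end.
have sP n : exists s : cses (sval (Y n)) (sval (Y (n - 1))), True.
  case: n => [[|k]|k].
  - by have [s _] := nrP X0; exists s.
  - have -> : Posz k.+1 - 1 = Posz k by rewrite -addn1 PoszD addrK.
    by have [s _] := nlP (iter k nl X0); exists s.
  - have -> : Negz k - 1 = Negz k.+1 by rewrite !NegzE -opprD -PoszD addn1.
    by have [s _] := nrP (iter k.+1 nr X0); exists s.
pose s n : cses (sval (Y n)) (sval (Y (n - 1))) := projT1 (cid (sP n)).
exists (fun n => cE (s n)), (fun n => ccomp (ci (s (n - 1))) (cp (s n))).
have dK n k (x : cE (s n) k) : ccomp (ci (s (n - 1))) (cp (s n)) k x = 0 <-> cp (s n) k x = 0.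
  split=> /= [e|->]; last by rewrite linear0.
  by apply: (c_ker (s (n - 1))).1; rewrite e linear0.
split.
- by move=> n; apply: cE_inj.
- move=> n k y; rewrite dK; have [ji je] := c_ker (s (n - 1)).
  rewrite (exactP (je k)); split=> [[z <-]|[x <-]].
    by have [x <-] := c_surj (s n) z; exists x.
  by exists (cp (s n) k x).
- exists (ci (s 0)); have [ji je] := c_ker (s 0); split=> // k y.
  by rewrite dK; apply: je.
- move=> A FA n f fd; have [ji je] := c_ker (s (n - 1)).
  have [|u uE] := cfactor_inj (f := f) ji.
    by move=> k a; apply/(exactP (je k)); apply/dK; apply: fd.
  have [g gE] := c_lift (s n) FA u; exists g => k a.
  by rewrite /= gE uE.
Qed.
End DingComplexes.

(** * Components of Ding injective complexes are Ding injective *)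
Section ConstDisk.
Context {R : pzRingType}.
Implicit Types M N : lmodType R.

(** The sum of the disks on M in all degrees.  It serves as well as a disk in two fixed
    degrees for testing, and all its components are M * M. *)
Definition cdisk M : complex R := diskf (fun=> M).
Definition cdmap M N (f : {linear M -> N}) : chain_map (cdisk M) (cdisk N) :=
  disk_in (Y := cdisk M) (M := fun=> N) (fun n => compl f (fstl M M)).
Lemma cdmapE M N (f : {linear M -> N}) n x : cdmap f n x = (f x.1, f x.2).
Proof. by rewrite disk_inE diskf_diff. Qed.
Lemma cdmap_surj M N (f : {linear M -> N}) : is_surjective f -> csurjective (cdmap f).
Proof.
move=> pres_cells n [x y]; have [a aE] := pres_cells x; have [b bE] := pres_cells y.
by exists (a, b); rewrite cdmapE aE bE.
Qed.
Lemma cdmap_inj M N (f : {linear M -> N}) : injective f -> cinjective (cdmap f).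
Proof. by move=> fi n [x y] [x' y']; rewrite !cdmapE => -[/fi -> /fi ->]. Qed.

Definition to_disk (Y : complex R) k M (f : {linear Y k -> M}) : chain_map Y (cdisk M) :=
  disk_in (fun n => compl f (xfer Y n k)).
Lemma to_diskE (Y : complex R) k M (f : {linear Y k -> M}) x : (to_disk f k x).1 = f x.
Proof. by rewrite disk_inE /= xfer_id. Qed.
Definition of_disk (Y : complex R) k M (f : {linear M -> Y k}) : chain_map (cdisk M) Y :=
  disk_out (M := fun=> M) (fun n => compl (xfer Y k n) f).
Lemma of_disk_genE (Y : complex R) k M (f : {linear M -> Y k}) m x :
  of_disk f m (0, x) = xfer Y k m (f x).
Proof. exact: (disk_outE (M := fun=> M)). Qed.
Lemma of_diskE (Y : complex R) k M (f : {linear M -> Y k}) x : of_disk f k (0, x) = f x.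
Proof. by rewrite of_disk_genE xfer_id. Qed.

(** Extending along A -> B a map from A to E k amounts to extending a chain map along
    the map of disks. *)
Lemma injective_component (E : complex R) k : injective_complex E -> injective_module (E k).
Proof.
move=> iE A B i f ii; have [g gE] := iE _ _ (cdmap i) (of_disk f) (cdmap_inj ii).
exists (compl (g k) (disk_gen (fun=> B) k)) => x /=.
by rewrite disk_genE -(of_diskE f) -gE cdmapE linear0.
Qed.

Lemma projective_component (P : complex R) k : projective_complex P -> projective_module (P k).
Proof.
move=> pP A B p f ps; have [g gE] := pP _ _ (cdmap p) (to_disk f) (cdmap_surj ps).
exists (compl (fstl A A) (g k)) => x.
by rewrite -(to_diskE f) -gE cdmapE.
Qed.

(* V / K is the direct limit of the quotients of V by the spans of the finite lists of
   elements of K, and the same holds for the disks on these modules. *)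
Section QuoSystem.
Context (V : lmodType R) (K : submod V).
Definition qidx := {l : seq V | forall y, y \in l -> K y}.
Definition qle (l m : qidx) := {subset sval l <= sval m}.
Fact qnilP (y : V) : y \in [::] -> K y.
Proof. by []. Qed.
Definition qnil : qidx := exist (fun l : seq V => forall y, y \in l -> K y) [::] qnilP.
Lemma qle_directed : directed qle.
Proof.
split; first by constructor; exact: qnil.
- by move=> l x.
- by move=> a b c ab bc x /ab /bc.
- move=> [l hl] [m hm].
  have h y : y \in l ++ m -> K y by rewrite mem_cat => /orP[/hl|/hm].
  by exists (exist _ (l ++ m) h); split=> x /=; rewrite mem_cat => ->; rewrite ?orbT.
Qed.
Definition qobj (l : qidx) : lmodType R := quoT (mspan (sval l)).
Definition qq (l : qidx) : {linear V -> qobj l} := quo_pi (mspan (sval l)).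
Fact qmap_ex (l m : qidx) (h : qle l m) :
  exists f : {linear qobj l -> qobj m}, forall x, f (qq l x) = qq m x.
Proof.
apply: factor_surj; first exact: quo_pi_surj.
by move=> x /quo_piP hx; apply/quo_piP; apply: mspan_sub hx.
Qed.
Definition qmap l m (h : qle l m) := projT1 (cid (qmap_ex h)).
Lemma qmapE l m (h : qle l m) x : qmap h (qq l x) = qq m x.
Proof. exact: (projT2 (cid (qmap_ex h))). Qed.
Fact qlim_ex (l : qidx) :
  exists f : {linear qobj l -> quoT K}, forall x, f (qq l x) = quo_pi K x.
Proof.
apply: factor_surj; first exact: quo_pi_surj.
move=> x /quo_piP hx; apply/quo_piP.
by apply: (mspan_ind (f := idl V) (P := K)) hx; apply: (svalP l).
Qed.
Definition qlim l := projT1 (cid (qlim_ex l)).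
Lemma qlimE l x : qlim l (qq l x) = quo_pi K x.
Proof. exact: (projT2 (cid (qlim_ex l))). Qed.

Lemma qsurj l n (z : cdisk (qobj l) n) : exists w : cdisk V n, z = cdmap (qq l) n w.
Proof. by have [w <-] := cdmap_surj (quo_pi_surj (P := mspan (sval l))) z; exists w. Qed.
Lemma qmap_cd l m (h : qle l m) n (w : cdisk V n) :
  cdmap (qmap h) n (cdmap (qq l) n w) = cdmap (qq m) n w.
Proof. by rewrite !cdmapE /= !qmapE. Qed.
Lemma qlim_cd l n (w : cdisk V n) :
  cdmap (qlim l) n (cdmap (qq l) n w) = cdmap (quo_pi K) n w.
Proof. by rewrite !cdmapE /= !qlimE. Qed.

Definition qsys : direct_system R qle.
Proof.
exists (fun l => cdisk (qobj l)) (fun l m h => cdmap (qmap h)).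
- by move=> l h n z; have [w ->] := qsurj z; rewrite qmap_cd.
- by move=> a b c ab bc ac n z; have [w ->] := qsurj z; rewrite !qmap_cd.
Defined.

Lemma qsys_lim : direct_limit (S := qsys) (fun l => cdmap (qlim l)).
Proof.
pose l0 := qnil.
split.
  by move=> l m h n z; have [w ->] := qsurj z; rewrite qmap_cd !qlim_cd.
move=> T t tc; split.
  have [|u uE] := cfactor_surj (f := ccomp (t l0) (cdmap (qq l0))) (cdmap_surj (quo_pi_surj (P := K))).
    move=> n [x y]; rewrite cdmapE => -[/quo_piP Kx /quo_piP Ky].
    have hl z : z \in [:: x; y] -> K z by rewrite !inE => /orP[/eqP ->|/eqP ->].
    pose l : qidx := exist _ [:: x; y] hl.
    have h : qle l0 l by [].
    rewrite /= -(tc _ _ h) /= qmap_cd cdmapE.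
    have -> : qq l (x, y).1 = 0 by apply/quo_piP; apply: mem_mspan; rewrite inE eqxx.
    have -> : qq l (x, y).2 = 0 by apply/quo_piP; apply: mem_mspan; rewrite !inE eqxx orbT.
    exact: (linear0 (t l n)).
  exists u => l n z; have [w ->] := qsurj z.
  have h : qle l0 l by [].
  by rewrite qlim_cd uE /= -(tc _ _ h) /= qmap_cd.
move=> u v uE vE n z; have [w <-] := cdmap_surj (quo_pi_surj (P := K)) z.
by rewrite -(qlim_cd l0) uE vE.
Qed.

Context (F : complex R) (k : int).
Hypothesis fF : finitely_presented_complex F.

(** Maps F k -> V / K are chain maps from F to the disk on V / K, so the finite
    presentation of F makes them factor through a stage. *)
Lemma qsys_factor (g : {linear F k -> quoT K}) :
  exists (l : qidx) (h : {linear F k -> qobj l}), forall x, qlim l (h x) = g x.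
Proof.
have fac := proj1 (@fF _ _ _ _ _ qle_directed qsys_lim).
have [l [h hE]] := fac (to_disk g).
exists l, (compl (fstl _ _) (h k)) => x.
by rewrite -(to_diskE g) -hE cdmapE.
Qed.

Lemma qsys_vanish l (g : {linear F k -> qobj l}) : (forall x, qlim l (g x) = 0) ->
  exists (m : qidx) (h : qle l m), forall x, qmap h (g x) = 0.
Proof.
move=> g0; have van := proj2 (@fF _ _ _ _ _ qle_directed qsys_lim).
have [|m [h hE]] := van l (to_disk g) (to_disk (zerol (F k) (qobj l))).
  move=> n x; rewrite !cdmapE !disk_inE /= !g0.
  by rewrite linear0.
exists m, h => x; rewrite -(to_diskE g).
have e1 : cdmap (qmap h) k (to_disk g k x) =
          cdmap (qmap h) k (to_disk (zerol (F k) (qobj l)) k x) := hE k x.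
move: (congr1 fst e1); rewrite !cdmapE => e2.
by rewrite (e2 : qmap h (to_disk g k x).1 = _) [X in qmap h X]to_diskE linear0.
Qed.
End QuoSystem.

Lemma rV_span m (V : lmodType R) (s : m.-tuple V) x :
  mspan s x <-> exists v, rV_map (fun i => tnth s i) v = x.
Proof.
split=> [|[v <-]].
  have r0 : exists v, rV_map (fun i => tnth s i) v = 0 by exists 0; rewrite linear0.
  have rL a u w : (exists v, rV_map (fun i => tnth s i) v = u) ->
      (exists v, rV_map (fun i => tnth s i) v = w) -> exists v, rV_map (fun i => tnth s i) v = a *: u + w.
    by move=> [y <-] [z <-]; exists (a *: y + z); rewrite linearP.
  apply: (mspan_ind (f := idl V) (P := Submod r0 rL)) => y /tnthP [i ->].
  by exists (delta_mx 0 i); rewrite rV_mapE.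
rewrite lin_ofE; apply: sm_sum => i; apply: smZ; apply: mem_mspan; exact: mem_tnth.
Qed.

(** Apply the finite presentation of F twice.  The direct limit of the quotients of F k
    by finitely generated submodules is 0, so F k equals a finitely generated
    submodule of itself.  Then F k is a quotient of R^n by K, hence a limit of quotients
    by finitely generated submodules of K, and the identity factors through one of them:
    F k is a direct summand of a finitely presented module. *)
Lemma fp_component (F : complex R) k :
  finitely_presented_complex F -> finitely_presented_module (F k).
Proof.
move=> fF.
have [s sP] : exists s : seq (F k), forall x, mspan s x.
  pose K : submod (F k) := @Submod R (F k) (fun=> True) I (fun _ _ _ _ _ => I).
  pose l0 := qnil K.
  have [|m [h hE]] := qsys_vanish fF (l := l0) (g := qq l0).
    by move=> x; rewrite qlimE; apply/quo_piP.
  by exists (sval m) => x; have := hE x; rewrite qmapE => /quo_piP.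
pose n := size s; pose p : {linear 'rV[R]_n -> F k} := rV_map (fun i => tnth (in_tuple s) i).
have ps : is_surjective p by move=> x; have /(rV_span (in_tuple s)) := sP x.
pose K := eq_sm p (zerol _ _).
have [g gE] := factor_surj (f := quo_pi K) ps (fun v e => proj2 (quo_piP K v) e).
have [l [h hE]] := qsys_factor fF g.
(* ee is a lift of h o p to R^n; then K is generated by l and by the v - ee v for v in the
   standard basis, as ee maps K into the span of l *)
have [e eE] := choice (fun i : 'I_n => quo_pi_surj (P := mspan (sval l)) (h (p (delta_mx 0 i)))).
pose ee : {linear 'rV[R]_n -> 'rV[R]_n} := rV_map e.
have eeE v : qq l (ee v) = h (p v).
  by apply: (rV_ext (f := compl (qq l) ee) (g := compl h p)) => i /=; rewrite rV_mapE eE.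
have Ke v : p (v - ee v) = 0.
  have ev : quo_pi K (ee v) = quo_pi K v.
    exact: etrans (esym (qlimE l _)) (etrans (congr1 (qlim l) (eeE v)) (etrans (hE _) (gE _))).
  apply/(quo_piP K); rewrite (linearB (quo_pi K)) ev; exact: subrr.
pose L := sval l ++ [seq delta_mx 0 i - ee (delta_mx 0 i) | i : 'I_n].
exists (size L), n, (rV_map (fun i => tnth (in_tuple L) i)), p; split=> // v.
rewrite -(rV_span (in_tuple L)); split=> [pv|].
  have -> : v = ee v + (v - ee v) by rewrite addrC subrK.
  apply: smD.
    have hv : qq l (ee v) = 0 := etrans (eeE v) (etrans (congr1 h pv) (linear0 h)).
    apply: mspan_sub (proj1 (quo_piP _ _) hv) => y yl.
    by rewrite mem_cat yl.
  have -> : v - ee v = rV_map (fun i => delta_mx 0 i - ee (delta_mx 0 i)) v.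
    by apply: (rV_ext (f := subl (idl _) ee)) => i; rewrite rV_mapE.
  rewrite lin_ofE; apply: sm_sum => i; apply: smZ; apply: mem_mspan.
  by rewrite mem_cat fintype.image_f ?orbT.
apply: (mspan_eq0 (f := p)) => y; rewrite mem_cat => /orP[/(svalP l) //|/mapP [i _ ->]].
exact: Ke.
Qed.

Section ComponentRes.
Context (F : complex R) (P : cprojective_resolution F) (k : int).
Definition component_res : projective_resolution (F k) :=
  @ProjRes R (F k) (fun n => P n k) (fun n => cpdiff P n k) (cpaug P k)
    (fun n => projective_component (k := k) (@cpproj _ _ P n)) (@cpaug_surj _ _ P k) (@cpaug_exact _ _ P k)
    (fun n => @cpdiff_exact _ _ P n k).
End ComponentRes.

(** Chain maps to the disk are families of maps from the components, so Ext^1 into the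
    disk is the product of the Ext^1(F n, M). *)
Lemma disk_FP_injective M : FP_injective_module M -> FP_injective_complex (cdisk M).
Proof.
move=> FM F fF P f fd.
have [g gE] := @lchoice _ _ (fun n => P 0%N n) (fun=> M)
  (fun n g => forall x, g (cpdiff P 0 n x) = compl (fstl M M) (f n) x)
  (fun n => FM _ (@fp_component F n fF) (component_res P n) (compl (fstl M M) (f n))
     (fun x => congr1 fst (fd n x))).
exists (disk_in g) => n x; rewrite disk_inE -cmapC !gE /=.
by rewrite [RHS](disk_in_eq (M := fun=> M)).
Qed.

(** Chain maps from the disk on an FP-injective module A to E n are families of maps
    from A to the components of E n, so the degree k part of the resolution is exact under
    Hom(A, -). *)
Lemma Ding_component (X : complex R) k : Ding_injective_complex X -> Ding_injective_module (X k).
Proof.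
move=> [E [d [iE eE [i [ii ie]] lE]]].
pose C := @Complex R (fun n => E n k) (fun n => d n k)
  (fun n x => proj2 (exactP (eE n k) _) (ex_intro _ x erefl)).
exists C; split.
- by move=> n; exact: (injective_component (iE n)).
- by move=> n; apply: eE.
- by exists (i k); split; [apply: ii | apply: ie].
- move=> A FA n f fd.
  have [|g gE] := lE _ (disk_FP_injective FA) n (of_disk (f : {linear A -> E (n - 1) k})).
    apply: (disk_out_ext (M := fun=> A) (f := ccomp (d (n - 1)) (of_disk (f : {linear A -> E (n - 1) k}))) (h := czero _ _)) => m y.
    rewrite -[LHS]/(d (n - 1) m (of_disk (f : {linear A -> E (n - 1) k}) m (0, y))) of_disk_genE.
    by rewrite xfer_natural fd linear0.
  exists (compl (g k) (disk_gen (fun=> A) k)) => a /=.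
  rewrite disk_genE -[RHS](of_diskE (f : {linear A -> E (n - 1) k})); exact: gE.
Qed.
End ConstDisk.

Theorem theorem2 (R : pzRingType) (X : complex R) :
  Ding_injective_complex X <-> forall n : int, Ding_injective_module (X n).
Proof.
split=> [dX n|dX]; first exact: Ding_component.
by apply: cbiresolvable_Ding => n; apply: Ding_biresolvable.
Qed.
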